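(* Let $\Lambda$ be a sequence of distinct real numbers such that there exists an entire function $G_\Lambda$ vanishing on $\Lambda$ with $G_\Lambda(x+iy)\ll_\eta e^{cx^2}$ for some $c>0$ in every strip $|y|\le\eta$. Let $\Lambda^*$ be another locally finite subset of $\mathbb{R}$, and suppose there are functions $g_\lambda:\mathbb{R}\to\mathbb{C}$ ($\lambda\in\Lambda$) and $h_{\lambda^*}:\mathbb{R}\to\mathbb{C}$ ($\lambda^*\in\Lambda^*$) such that: (a) there is $\eta_0>0$ such that for every real $x$ the two series $E_\pm(x,z):=2\pi i\sum'_{\mp\lambda^*\ge0}h_{\lambda^*}(x)e^{-2\pi i\lambda^* z}$ (sum over $\lambda^*\in\Lambda^*$ with $\mp\lambda^*\ge 0$) converge absolutely for $\pm\operatorname{Im} z\ge\eta_0$; (b) for every $\varepsilon>0$ and $x\in\mathbb{R}$, $g_\lambda(x)e^{-\varepsilon\lambda^2}\to0$ as $|\lambda|\to\infty$; (c) for every $\varepsilon>0$ and every $z$ with $|\operatorname{Im} z|\ge\eta_0$, the function $f_{\varepsilon,z}(x):=e^{-\varepsilon x^2}/(z-x)$ satisfies $f_{\varepsilon,z}(x)=\sum_{\lambda\in\Lambda}f_{\varepsilon,z}(\lambda)g_\lambda(x)+\sum_{\lambda^*\in\Lambda^*}\widehat{f_{\varepsilon,z}}(\lambda^* )h_{\lambda^*}(x)$ for all real $x$. Then for every real $x$, the functions $z\mapsto E_\pm(x,z)$ extend to meromorphic functions on $\mathbb{C}$ with simple poles at $x$ and at every point $\lambda\in\Lambda$, with respective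 residues $\pm1$ and $\pm g_\lambda(x)$, and the functional equation $E_+(x,z)=-E_-(x,z)$ holds.
   Context: The Fourier transform is $\widehat{f}(\xi)=\int_{\mathbb{R}}f(x)e^{-2\pi i x\xi}dx$. A prime on a summation sign, as in $\sum'_{\lambda^*}$, means that a possible term with $\lambda^*=0$ is divided by $2$, all other terms being summed as usual.
   Formalization: The residue of E_± at x is ∓1, not the printed ±1, which contradicts (c) for every x outside Λ; residues at λ stay ±g_λ(x) (zero allowed), and if x lies in Λ the two principal parts add. G_Λ is assumed not identically zero. *)

(* Defs.v *)
From Stdlib Require Import Reals List.
From Coquelicot Require Import Coquelicot.
Open Scope R_scope.

Definition Cexp (z : C) : C := (exp (Re z) * cos (Im z), exp (Re z) * sin (Im z)).

Definition Csum (F : R -> C) (l : list R) : C :=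
  fold_right (fun a acc => Cplus (F a) acc) (RtoC 0) l.

Definition finite_part (A : R -> Prop) (l : list R) : Prop :=
  NoDup l /\ forall a, In a l -> A a.

(* The sum of F over the index set A is the limit of its finite partial sums
   along the finite subsets of A ordered by inclusion; for complex terms this
   is the same as absolute convergence. *)
Definition is_usum (A : R -> Prop) (F : R -> C) (S : C) : Prop :=
  forall eps : R, 0 < eps ->
  exists l0 : list R, finite_part A l0 /\
  forall l : list R, finite_part A l -> incl l0 l ->
    Cmod (Cminus (Csum F l) S) < eps.

Definition abs_summable (A : R -> Prop) (F : R -> C) : Prop :=
  exists B : R, forall l : list R, finite_part A l ->
    fold_right (fun a acc => Cmod (F a) + acc) 0 l <= B.

Definition locally_finite (A : R -> Prop) : Prop :=
  forall T : R, exists l : list R, forall a : R, A a -> Rabs a <= T -> In a l.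

Definition holomorphic_on (U : C -> Prop) (f : C -> C) : Prop :=
  forall z : C, U z -> @ex_derive C_AbsRing C_NormedModule f z.

Definition entire (f : C -> C) : Prop := holomorphic_on (fun _ => True) f.

Definition Cdisc (p : C) (r : R) (z : C) : Prop := Cmod (Cminus z p) < r.

(* The values of M at its poles are irrelevant. *)
Definition meromorphic (M : C -> C) : Prop :=
  forall p : C, exists (n : nat) (phi : C -> C) (r : R),
    0 < r /\ holomorphic_on (Cdisc p r) phi /\
    forall z : C, Cdisc p r z -> z <> p ->
      M z = Cdiv (phi z) (Cpow (Cminus z p) n).

(* When rho = 0 the singularity is removable: the coefficients g_lambda(x) may
   vanish, so "a simple pole of residue rho" has to include this case. *)
Definition simple_pole (M : C -> C) (p rho : C) : Prop :=
  exists (phi : C -> C) (r : R),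
    0 < r /\ holomorphic_on (Cdisc p r) phi /\
    forall z : C, Cdisc p r z -> z <> p ->
      M z = Cplus (Cdiv rho (Cminus z p)) (phi z).

Definition Fourier (f : R -> C) (xi : R) : C :=
  @RInt_gen C_R_CompleteNormedModule
    (fun t => Cmult (f t) (Cexp (Cmult (Cmult (RtoC (-2 * PI)) Ci) (RtoC (t * xi)))))
    (Rbar_locally m_infty) (Rbar_locally p_infty).

Definition gauss_cauchy (eps : R) (z : C) (t : R) : C :=
  Cdiv (RtoC (exp (- eps * t ^ 2))) (Cminus z (RtoC t)).

Definition prime_weight (t : R) : R := if Req_EM_T t 0 then 1 / 2 else 1.

(* Below, s is the sign: s = 1 stands for E_+ and s = -1 for E_-. *)

Definition E_index (Ls : R -> Prop) (s : R) (t : R) : Prop := Ls t /\ 0 <= - s * t.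

Definition E_term (h : R -> R -> C) (x : R) (z : C) (t : R) : C :=
  Cmult (RtoC (prime_weight t))
    (Cmult (h t x) (Cexp (Cmult (Cmult (RtoC (-2 * PI)) Ci) (Cmult (RtoC t) z)))).

Definition is_E (Ls : R -> Prop) (h : R -> R -> C) (s x : R) (z v : C) : Prop :=
  exists S : C, is_usum (E_index Ls s) (E_term h x z) S /\
    v = Cmult (Cmult (RtoC (2 * PI)) Ci) S.

(* M is a meromorphic continuation of z |-> E_s(x,z), initially given on
   s * Im z >= eta0, with the prescribed simple poles and no others.

   Signs.  For Im z > 0 and xi < 0 the Fourier transform of 1/(z - t) at xi is
   - 2 pi i exp(-2 pi i xi z), and it is 0 for xi > 0, so the interpolation
   formula with eps -> 0 formally reads
     1/(z - x) = sum_lambda g_lambda(x)/(z - lambda) - E_+(x,z);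
   hence E_+ has residue -1 at x and g_lambda(x) at lambda, and E_- = - E_+ has
   the opposite ones.  If x itself lies in Lambda, the two contributions at
   this point add up. *)
Definition E_continuation (L Ls : R -> Prop) (g h : R -> R -> C) (eta0 s x : R)
    (M : C -> C) : Prop :=
  (forall z : C, eta0 <= s * Im z -> is_E Ls h s x z (M z)) /\
  meromorphic M /\
  holomorphic_on (fun z => z <> RtoC x /\ forall lam, L lam -> z <> RtoC lam) M /\
  (~ L x -> simple_pole M (RtoC x) (RtoC (- s))) /\
  (forall lam : R, L lam -> lam <> x ->
     simple_pole M (RtoC lam) (Cmult (RtoC s) (g lam x))) /\
  (L x -> simple_pole M (RtoC x) (Cplus (RtoC (- s)) (Cmult (RtoC s) (g x x)))).

(* Main.v *)
Require Import Defs.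
From Stdlib Require Import Reals List Lra Lia ClassicalEpsilon Permutation.
From Coquelicot Require Import Coquelicot.
Open Scope R_scope.

(* Let A_eps(z) = e^(-eps x^2)/(z - x) - sum_lambda e^(-eps lambda^2) g_lambda(x)/(z - lambda).
   By the interpolation formula A_eps(z) is, for |Im z| >= eta0, a sum over the dual
   set of Fourier transforms of f_(eps,z).  Moving the line of integration to height
   1/sqrt eps up or down picks up at most the residue at z, and the remaining integral
   is exponentially small in 1/sqrt eps away from the frequency 0.  As the dual set is
   locally finite, A_eps tends to -E_+ for Im z >= eta0 and to E_- for Im z <= -eta0 as
   eps -> 0, with an error of at most polynomial growth in z.

   The residues of B_eps(z) = e^(eps z^2) A_eps(z) are independent of eps.  The product
   e^(-4 c z^2) G(z) (z - x) B_eps(z) has no poles and decays in horizontal strips, so by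
   the maximum principle its convergence on the two boundary lines of a strip extends to
   the interior.  Dividing by the weight on the boundary of a small square around a
   given point and applying the maximum principle once more, B_eps converges locally
   uniformly up to its poles.  The limit continues both -E_+ and E_-.  It
   suffices to keep finitely many terms of the sum over lambda, more and more of them
   as eps -> 0.

   The function theory rests on Goursat's theorem alone: it gives the mean value
   property, hence the maximum principle, and the latter applied to difference quotients
   gives removable singularities and the holomorphy of uniform limits. *)

(** * Complex differentiability *)

(** The hypotheses speak only about [|Im z| >= eta0], while all poles are real, and the estimate
    there grows like [e^(eps x^2)] along horizontal lines. Multiplying by [G(z) (z - x)] removes the
    poles at the price of another [e^(c x^2)]; as [eps <= c], the exponent [4 c] pays for both and
    leaves [e^(-2 c x^2)] for the polynomial factors. Up to height [1/sqrt eps] the factor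
    [e^(eps y^2)] of the Gaussian stays bounded, while a frequency [xi] gains
    [e^(-2 pi |xi| / sqrt eps)]. Frequency 0 gains nothing: there the upward and downward shifts are
    averaged, so the residue counts by half, which is the origin of the prime on the sum, and [1/(w
    - u) + 1/(w + u) = 2 w / ((w - u)(w + u))] makes the remaining integrals smaller by an order of
    [sqrt eps]. Goursat's theorem alone does not make derivatives holomorphic. Caratheodory's form
    of differentiability turns such questions into continuity of a difference quotient at its base
    point, and a maximum principle that tolerates exceptional points of mere continuity answers
    them. *)

Definition Ccont (f : C -> C) (z : C) : Prop :=
  forall eps, 0 < eps -> exists d, 0 < d /\
    forall w, Cmod (w - z) < d -> Cmod (f w - f z) < eps.

(* Caratheodory's form of complex differentiability: the difference quotient
   extends continuously to z. *)
Definition Cder (f : C -> C) (z l : C) : Prop :=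
  exists q : C -> C, q z = l /\ Ccont q z /\ forall w, f w = (f z + q w * (w - z))%C.

Lemma Cmod_sub_sym (a b : C) : Cmod (a - b) = Cmod (b - a).
Proof. rewrite <- Cmod_opp. f_equal. ring. Qed.

Lemma Cmod_triangle_sub (a b : C) : Cmod (a - b) <= Cmod a + Cmod b.
Proof. rewrite <- (Cmod_opp b). apply Cmod_triangle. Qed.

Lemma Cmod_triangle_rev (a b : C) : Cmod a - Cmod b <= Cmod (a - b).
Proof.
  replace a with ((a - b) + b)%C at 1 by ring.
  generalize (Cmod_triangle (a - b) b). lra.
Qed.

Lemma Cmod_le_abs (z : C) : Cmod z <= Rabs (Re z) + Rabs (Im z).
Proof.
  destruct z as [x y].
  replace ((x, y) : C) with (RtoC x + Ci * RtoC y)%C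
    by (unfold Cplus, Cmult, RtoC, Ci; simpl; f_equal; ring).
  eapply Rle_trans; [apply Cmod_triangle|].
  rewrite Cmod_mult, Cmod_Ci, !Cmod_R. simpl.
  apply Req_le. f_equal; [| rewrite Rmult_1_l]; f_equal; ring.
Qed.

Lemma Rabs_im_le_Cmod (z : C) : Rabs (Im z) <= Cmod z.
Proof. eapply Rle_trans; [|apply Rmax_Cmod]. apply Rmax_r. Qed.

Lemma Csub_neq_0 (a b : C) : a <> b -> (a - b)%C <> RtoC 0.
Proof.
  intros H E. apply H. replace a with ((a - b) + b)%C by ring. rewrite E. ring.
Qed.

Lemma Csub_eq_0 (a b : C) : (a - b)%C = RtoC 0 -> a = b.
Proof.
  intros E. replace a with ((a - b) + b)%C by ring. rewrite E. ring.
Qed.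

Lemma Cmod_sub_gt_0 (a b : C) : a <> b -> 0 < Cmod (a - b).
Proof. intros H. apply Cmod_gt_0, Csub_neq_0, H. Qed.

Lemma Cmod_sub_diag (a : C) : Cmod (a - a) = 0.
Proof. replace (a - a)%C with (RtoC 0) by ring. apply Cmod_0. Qed.

Lemma Ccont_const (c z : C) : Ccont (fun _ => c) z.
Proof.
  intros e He. exists 1. split; [lra|]. intros. now rewrite Cmod_sub_diag.
Qed.

Lemma Ccont_id (z : C) : Ccont (fun w => w) z.
Proof. intros e He. exists e. auto. Qed.

Lemma Ccont_ext_loc (f g : C -> C) (z : C) (r : R) :
  0 < r -> (forall w, Cmod (w - z) < r -> f w = g w) -> Ccont f z -> Ccont g z.
Proof.
  intros Hr E H e He. destruct (H e He) as [d [Hd H']].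
  exists (Rmin d r). split; [now apply Rmin_pos|]. intros w Hw.
  assert (Cmod (w - z) < d) by (eapply Rlt_le_trans; [apply Hw|apply Rmin_l]).
  assert (Cmod (w - z) < r) by (eapply Rlt_le_trans; [apply Hw|apply Rmin_r]).
  rewrite <- !E; auto. now rewrite Cmod_sub_diag.
Qed.

Lemma Ccont_ext (f g : C -> C) (z : C) : (forall w, f w = g w) -> Ccont f z -> Ccont g z.
Proof. intros E. apply (Ccont_ext_loc f g z 1); [lra|auto]. Qed.

Lemma Ccont_plus (f g : C -> C) (z : C) :
  Ccont f z -> Ccont g z -> Ccont (fun w => f w + g w)%C z.
Proof.
  intros Hf Hg e He.
  destruct (Hf (e / 2)) as [d1 [Hd1 H1]]; [lra|].
  destruct (Hg (e / 2)) as [d2 [Hd2 H2]]; [lra|].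
  exists (Rmin d1 d2). split; [now apply Rmin_pos|]. intros w Hw.
  specialize (H1 w (Rlt_le_trans _ _ _ Hw (Rmin_l _ _))).
  specialize (H2 w (Rlt_le_trans _ _ _ Hw (Rmin_r _ _))).
  replace (f w + g w - (f z + g z))%C with ((f w - f z) + (g w - g z))%C by ring.
  generalize (Cmod_triangle (f w - f z) (g w - g z)). lra.
Qed.

Lemma Ccont_mult (f g : C -> C) (z : C) :
  Ccont f z -> Ccont g z -> Ccont (fun w => f w * g w)%C z.
Proof.
  intros Hf Hg e He.
  set (A := 1 + Cmod (g z)). set (B := 1 + Cmod (f z)).
  assert (HA : 1 <= A) by (unfold A; generalize (Cmod_ge_0 (g z)); lra).
  assert (HB : 1 <= B) by (unfold B; generalize (Cmod_ge_0 (f z)); lra).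
  destruct (Hf (e / (2 * A))) as [d1 [Hd1 H1]]; [apply Rdiv_lt_0_compat; lra|].
  destruct (Hg (e / (2 * B))) as [d2 [Hd2 H2]]; [apply Rdiv_lt_0_compat; lra|].
  destruct (Hg 1) as [d3 [Hd3 H3]]; [lra|].
  exists (Rmin d1 (Rmin d2 d3)). split; [repeat apply Rmin_pos; auto|]. intros w Hw.
  assert (W1 := Rlt_le_trans _ _ _ Hw (Rmin_l _ _)).
  assert (W' := Rlt_le_trans _ _ _ Hw (Rmin_r _ _)).
  assert (W2 := Rlt_le_trans _ _ _ W' (Rmin_l _ _)).
  assert (W3 := Rlt_le_trans _ _ _ W' (Rmin_r _ _)).
  specialize (H1 w W1). specialize (H2 w W2). specialize (H3 w W3).
  replace (f w * g w - f z * g z)%C with ((f w - f z) * g w + f z * (g w - g z))%C by ring.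
  eapply Rle_lt_trans; [apply Cmod_triangle|]. rewrite !Cmod_mult.
  assert (G : Cmod (g w) <= A).
  { replace (g w) with ((g w - g z) + g z)%C by ring.
    generalize (Cmod_triangle (g w - g z) (g z)). unfold A. lra. }
  assert (P1 : Cmod (f w - f z) * Cmod (g w) <= Cmod (f w - f z) * A)
    by (apply Rmult_le_compat_l; [apply Cmod_ge_0|auto]).
  assert (P2 : Cmod (f w - f z) * A < e / (2 * A) * A)
    by (apply Rmult_lt_compat_r; lra).
  assert (P3 : Cmod (f z) * Cmod (g w - g z) <= B * (e / (2 * B))).
  { apply Rmult_le_compat; try apply Cmod_ge_0; unfold B in *; lra. }
  replace (e / (2 * A) * A) with (e / 2) in P2 by (field; lra).
  replace (B * (e / (2 * B))) with (e / 2) in P3 by (field; lra).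
  lra.
Qed.

Lemma Ccont_opp (f : C -> C) (z : C) : Ccont f z -> Ccont (fun w => - f w)%C z.
Proof.
  intros H. apply (Ccont_ext (fun w => - RtoC 1 * f w)%C).
  - intros w. ring.
  - apply Ccont_mult; [apply Ccont_const|auto].
Qed.

Lemma Ccont_minus (f g : C -> C) (z : C) :
  Ccont f z -> Ccont g z -> Ccont (fun w => f w - g w)%C z.
Proof. intros Hf Hg. apply Ccont_plus; [auto|now apply Ccont_opp]. Qed.

Lemma Ccont_comp (f g : C -> C) (z : C) :
  Ccont f z -> Ccont g (f z) -> Ccont (fun w => g (f w)) z.
Proof.
  intros Hf Hg e He. destruct (Hg e He) as [d [Hd H]].
  destruct (Hf d Hd) as [d' [Hd' H']]. exists d'. auto.
Qed.

Lemma Ccont_neq_0 (f : C -> C) (z : C) : Ccont f z -> f z <> RtoC 0 ->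
  exists d, 0 < d /\ forall w, Cmod (w - z) < d ->
    Cmod (f z) / 2 < Cmod (f w) /\ f w <> RtoC 0.
Proof.
  intros H Hz. apply Cmod_gt_0 in Hz.
  destruct (H (Cmod (f z) / 2)) as [d [Hd H']]; [lra|].
  exists d. split; auto. intros w Hw. specialize (H' w Hw).
  assert (Cmod (f z) / 2 < Cmod (f w)).
  { generalize (Cmod_triangle_rev (f z) (f w)). rewrite Cmod_sub_sym. lra. }
  split; auto. apply Cmod_gt_0. lra.
Qed.

Lemma Ccont_inv (f : C -> C) (z : C) :
  Ccont f z -> f z <> RtoC 0 -> Ccont (fun w => / f w)%C z.
Proof.
  intros H Hz e He.
  destruct (Ccont_neq_0 f z H Hz) as [d1 [Hd1 H1]].
  assert (Hm := proj1 (Cmod_gt_0 _) Hz). set (m := Cmod (f z)) in *.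
  destruct (H (e * (m * m / 2))) as [d2 [Hd2 H2]].
  { apply Rmult_lt_0_compat; [auto|]. apply Rdiv_lt_0_compat; [|lra].
    now apply Rmult_lt_0_compat. }
  exists (Rmin d1 d2). split; [now apply Rmin_pos|]. intros w Hw.
  destruct (H1 w (Rlt_le_trans _ _ _ Hw (Rmin_l _ _))) as [K1 K2].
  specialize (H2 w (Rlt_le_trans _ _ _ Hw (Rmin_r _ _))).
  replace (/ f w - / f z)%C with ((f z - f w) / (f w * f z))%C by (field; auto).
  rewrite Cmod_div, Cmod_mult by now apply Cmult_neq_0.
  rewrite Cmod_sub_sym. fold m.
  assert (m * m / 2 < Cmod (f w) * m) by nra.
  apply Rlt_div_l; [nra|]. nra.
Qed.

Lemma Ccont_div (f g : C -> C) (z : C) :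
  Ccont f z -> Ccont g z -> g z <> RtoC 0 -> Ccont (fun w => f w / g w)%C z.
Proof. intros. apply Ccont_mult; [auto|now apply Ccont_inv]. Qed.

Definition Cdiff (f : C -> C) (z : C) : Prop := exists l, Cder f z l.

Lemma Cdiff_cont (f : C -> C) (z : C) : Cdiff f z -> Ccont f z.
Proof.
  intros [l [q [_ [Hq E]]]]. apply (Ccont_ext (fun w => f z + q w * (w - z))%C); [auto|].
  apply Ccont_plus; [apply Ccont_const|]. apply Ccont_mult; [auto|].
  apply Ccont_minus; [apply Ccont_id|apply Ccont_const].
Qed.

(** [Cder] asks for one factor on the whole plane, so a factor known only near [z] is exchanged for
    the true difference quotient, which is defined everywhere and agrees with it near [z]. *)
Lemma Cdiff_loc (f q : C -> C) (z : C) (r : R) : 0 < r -> Ccont q z ->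
  (forall w, Cmod (w - z) < r -> f w = (f z + q w * (w - z))%C) -> Cdiff f z.
Proof.
  intros Hr Hq E.
  exists (q z), (fun w => if Ceq_dec w z then q z else ((f w - f z) / (w - z))%C).
  split; [|split].
  - destruct (Ceq_dec z z); congruence.
  - apply (Ccont_ext_loc q _ z r); auto. intros w Hw.
    destruct (Ceq_dec w z) as [->|N]; auto.
    rewrite (E w Hw). field. now apply Csub_neq_0.
  - intros w. destruct (Ceq_dec w z) as [->|N]; [ring|].
    field. now apply Csub_neq_0.
Qed.

Lemma Cdiff_glob (f q : C -> C) (z : C) : Ccont q z ->
  (forall w, f w = (f z + q w * (w - z))%C) -> Cdiff f z.
Proof. intros Hq E. now exists (q z), q. Qed.

Lemma Cdiff_ext_loc (f g : C -> C) (z : C) (r : R) :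
  0 < r -> (forall w, Cmod (w - z) < r -> f w = g w) -> Cdiff f z -> Cdiff g z.
Proof.
  intros Hr E [l [q [_ [Hq H]]]]. apply (Cdiff_loc g q z r Hr Hq).
  intros w Hw. rewrite <- !E; auto. now rewrite Cmod_sub_diag.
Qed.

Lemma Cdiff_const (c z : C) : Cdiff (fun _ => c) z.
Proof. apply (Cdiff_glob _ (fun _ => RtoC 0)); [apply Ccont_const|intros; ring]. Qed.

Lemma Cdiff_id (z : C) : Cdiff (fun w => w) z.
Proof. apply (Cdiff_glob _ (fun _ => RtoC 1)); [apply Ccont_const|intros; ring]. Qed.

Lemma Cdiff_plus (f g : C -> C) (z : C) :
  Cdiff f z -> Cdiff g z -> Cdiff (fun w => f w + g w)%C z.
Proof.
  intros [a [p [_ [Hp Ef]]]] [b [q [_ [Hq Eg]]]].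
  apply (Cdiff_glob _ (fun w => p w + q w)%C); [now apply Ccont_plus|].
  intros w. rewrite (Ef w), (Eg w). ring.
Qed.

Lemma Cdiff_mult (f g : C -> C) (z : C) :
  Cdiff f z -> Cdiff g z -> Cdiff (fun w => f w * g w)%C z.
Proof.
  intros [a [p [_ [Hp Ef]]]] Dg. assert (Cg := Cdiff_cont _ _ Dg).
  destruct Dg as [b [q [_ [Hq Eg]]]].
  apply (Cdiff_glob _ (fun w => p w * g w + f z * q w)%C).
  - apply Ccont_plus; apply Ccont_mult; auto using Ccont_const.
  - intros w. rewrite (Ef w), (Eg w). ring.
Qed.

Lemma Cdiff_minus (f g : C -> C) (z : C) :
  Cdiff f z -> Cdiff g z -> Cdiff (fun w => f w - g w)%C z.
Proof.
  intros Hf Hg. apply (Cdiff_ext_loc (fun w => f w + - RtoC 1 * g w)%C _ z 1).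
  - lra.
  - intros w _. ring.
  - apply Cdiff_plus; [auto|]. apply Cdiff_mult; [apply Cdiff_const|auto].
Qed.

Lemma Cdiff_comp (f g : C -> C) (z : C) :
  Cdiff f z -> Cdiff g (f z) -> Cdiff (fun w => g (f w)) z.
Proof.
  intros Df. assert (Cf := Cdiff_cont _ _ Df).
  destruct Df as [a [p [_ [Hp Ef]]]]. intros [b [q [_ [Hq Eg]]]].
  apply (Cdiff_glob _ (fun w => q (f w) * p w)%C).
  - apply Ccont_mult; auto. now apply Ccont_comp.
  - intros w. rewrite (Eg (f w)). rewrite (Ef w) at 2. ring.
Qed.

Lemma Cdiff_inv (f : C -> C) (z : C) : Cdiff f z -> f z <> RtoC 0 -> Cdiff (fun w => / f w)%C z.
Proof.
  intros Df Hz. assert (Cf := Cdiff_cont _ _ Df).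
  destruct (Ccont_neq_0 f z Cf Hz) as [d [Hd H]].
  destruct Df as [a [p [_ [Hp Ef]]]].
  apply (Cdiff_loc _ (fun w => - p w / (f w * f z))%C z d Hd).
  - apply Ccont_div; [now apply Ccont_opp| |now apply Cmult_neq_0].
    apply Ccont_mult; auto using Ccont_const.
  - intros w Hw. destruct (H w Hw) as [_ Hn].
    assert (K : (p w * (w - z) = f w - f z)%C) by (rewrite (Ef w); ring).
    replace (/ f z + - p w / (f w * f z) * (w - z))%C
      with (/ f z - (p w * (w - z)) / (f w * f z))%C by (field; auto).
    rewrite K. field. auto.
Qed.

Lemma Cdiff_div (f g : C -> C) (z : C) :
  Cdiff f z -> Cdiff g z -> g z <> RtoC 0 -> Cdiff (fun w => f w / g w)%C z.
Proof. intros. apply Cdiff_mult; [auto|now apply Cdiff_inv]. Qed.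

(** The bridge between the derivative that occurs in the statement and Caratheodory's form, in which
    all arguments below are carried out. *)
Lemma Cdiff_iff (f : C -> C) (z : C) :
  Cdiff f z <-> @ex_derive C_AbsRing C_NormedModule f z.
Proof.
  split.
  - intros [l [q [Hl [Hq E]]]]. exists l. split.
    { apply (is_linear_scal_l (K := C_AbsRing) (V := C_NormedModule)). }
    intros x Hx.
    rewrite <- (is_filter_lim_locally_unique (V := AbsRing_NormedModule C_AbsRing) z x Hx).
    intros eps. destruct (Hq eps (cond_pos eps)) as [d [Hd H]].
    exists (mkposreal d Hd). intros w Hw.
    change (Cmod (f w - f z - (w - z) * l) <= eps * Cmod (w - z)).
    change (Cmod (w - z) < d) in Hw.
    rewrite (E w). replace (f z + q w * (w - z) - f z - (w - z) * l)%C
      with ((q w - l) * (w - z))%C by ring.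
    rewrite Cmod_mult. apply Rmult_le_compat_r; [apply Cmod_ge_0|].
    rewrite <- Hl. left. auto.
  - intros [l [_ H]]. specialize (H z (fun P HP => HP)).
    exists l, (fun w => if Ceq_dec w z then l else ((f w - f z) / (w - z))%C).
    split; [|split].
    + destruct (Ceq_dec z z); congruence.
    + intros e He. assert (He2 : 0 < e / 2) by lra.
      destruct (H (mkposreal _ He2)) as [d Hd].
      exists d. split; [apply cond_pos|]. intros w Hw.
      destruct (Ceq_dec z z) as [_|N]; [|congruence].
      destruct (Ceq_dec w z) as [->|N]; [now rewrite Cmod_sub_diag|].
      specialize (Hd w Hw).
      change (Cmod (f w - f z - (w - z) * l) <= e / 2 * Cmod (w - z)) in Hd.
      assert (N' := Csub_neq_0 _ _ N).
      replace ((f w - f z) / (w - z) - l)%C with ((f w - f z - (w - z) * l) / (w - z))%C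
        by (field; auto).
      rewrite Cmod_div by auto. apply Cmod_gt_0 in N'.
      apply Rlt_div_l; [auto|]. nra.
    + intros w. destruct (Ceq_dec w z) as [->|N]; [ring|].
      field. now apply Csub_neq_0.
Qed.

(** * Elementary inequalities and the complex exponential *)

Lemma Rdiv_le_compat (a b c d : R) : 0 <= a -> a <= b -> 0 < d -> d <= c -> a / c <= b / d.
Proof.
  intros Ha Hab Hd Hdc. apply Rmult_le_compat; auto.
  - left. apply Rinv_0_lt_compat. lra.
  - apply Rinv_le_contravar; auto.
Qed.

Lemma exp_le_compat (x y : R) : x <= y -> exp x <= exp y.
Proof. intros [H|H]; [left; now apply exp_increasing|right; now rewrite H]. Qed.

Lemma Ceq_le_eps (a b : C) : (forall e, 0 < e -> Cmod (a - b) <= e) -> a = b.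
Proof.
  intros H. apply Csub_eq_0, Cmod_eq_0. apply Rle_antisym; [|apply Cmod_ge_0].
  apply le_epsilon. intros e He. rewrite Rplus_0_l. auto.
Qed.

Lemma Cexp_plus (z w : C) : Cexp (z + w) = (Cexp z * Cexp w)%C.
Proof.
  destruct z as [a b], w as [c d]. unfold Cexp, Cmult, Cplus; simpl.
  rewrite exp_plus, cos_plus, sin_plus. f_equal; ring.
Qed.

Lemma Cexp_0 : Cexp 0 = RtoC 1.
Proof. unfold Cexp, RtoC; simpl. rewrite exp_0, cos_0, sin_0. f_equal; ring. Qed.

Lemma Cmod_Cexp (z : C) : Cmod (Cexp z) = exp (Re z).
Proof.
  assert (H : Cmod (Cexp z) ^ 2 = exp (Re z) ^ 2).
  { rewrite Cmod2_alt. unfold Cexp; simpl.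
    generalize (sin2_cos2 (Im z)). unfold Rsqr. intros E.
    replace 1 with (sin (Im z) * sin (Im z) + cos (Im z) * cos (Im z)) by auto.
    ring_simplify. replace (exp (Re z) ^ 2) with (exp (Re z) ^ 2 * 1) by ring.
    rewrite <- E. ring_simplify. nra. }
  generalize (Cmod_ge_0 (Cexp z)) (exp_pos (Re z)). nra.
Qed.

Lemma Cexp_neq_0 (z : C) : Cexp z <> RtoC 0.
Proof. apply Cmod_gt_0. rewrite Cmod_Cexp. apply exp_pos. Qed.

Lemma derivable_pt_lim_0_bound (f : R -> R) (l : R) : derivable_pt_lim f 0 l ->
  forall e, 0 < e -> exists d, 0 < d /\
    forall x, Rabs x < d -> Rabs (f x - f 0 - l * x) <= e * Rabs x.
Proof.
  intros H e He. destruct (H e He) as [d Hd]. exists d. split; [apply cond_pos|].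
  intros x Hx. destruct (Req_dec x 0) as [->|N].
  - replace (f 0 - f 0 - l * 0) with 0 by ring. rewrite Rabs_R0. lra.
  - specialize (Hd x N Hx). rewrite Rplus_0_l in Hd.
    replace (f x - f 0 - l * x) with (((f x - f 0) / x - l) * x) by (field; auto).
    rewrite Rabs_mult. apply Rmult_le_compat_r; [apply Rabs_pos|lra].
Qed.

Lemma Cdiff_Cexp_0 : Cdiff Cexp 0.
Proof.
  exists (RtoC 1), (fun w => if Ceq_dec w 0 then RtoC 1 else ((Cexp w - 1) / w)%C).
  split; [destruct (Ceq_dec 0 0); congruence|split].
  2:{ intros w. rewrite Cexp_0. destruct (Ceq_dec w 0) as [->|N].
      - rewrite Cexp_0. ring.
      - field. auto. }
  intros e He.
  (* The remainders below add up to at most [9 e' r], with 4 from the real and 5 from the imaginary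
     part, so [e / 16] suffices; [e' <= 1] keeps [exp x - 1] and [sin y] within [2 r]. *)
  assert (He4 : 0 < Rmin 1 (e / 16)) by (apply Rmin_pos; lra).
  set (e' := Rmin 1 (e / 16)) in *.
  assert (E1 : e' <= 1) by apply Rmin_l. assert (E2 : e' <= e / 16) by apply Rmin_r. clearbody e'.
  destruct (derivable_pt_lim_0_bound exp 1 derivable_pt_lim_exp_0 e' He4) as [d1 [Hd1 H1]].
  destruct (derivable_pt_lim_0_bound sin 1 derivable_pt_lim_sin_0 e' He4) as [d2 [Hd2 H2]].
  assert (Dc := derivable_pt_lim_cos 0). rewrite sin_0, Ropp_0 in Dc.
  destruct (derivable_pt_lim_0_bound cos 0 Dc e' He4) as [d3 [Hd3 H3]].
  exists (Rmin e' (Rmin d1 (Rmin d2 d3))). split; [repeat apply Rmin_pos; auto|].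
  intros w Hw. destruct (Ceq_dec 0 0) as [_|N]; [|congruence].
  replace (w - 0)%C with w in Hw by ring.
  destruct (Ceq_dec w 0) as [->|N]; [now rewrite Cmod_sub_diag|].
  assert (W0 := Rlt_le_trans _ _ _ Hw (Rmin_l _ _)).
  assert (W' := Rlt_le_trans _ _ _ Hw (Rmin_r _ _)).
  assert (W1 := Rlt_le_trans _ _ _ W' (Rmin_l _ _)).
  assert (W'' := Rlt_le_trans _ _ _ W' (Rmin_r _ _)).
  assert (W2 := Rlt_le_trans _ _ _ W'' (Rmin_l _ _)).
  assert (W3 := Rlt_le_trans _ _ _ W'' (Rmin_r _ _)).
  replace ((Cexp w - 1) / w - 1)%C with ((Cexp w - 1 - w) / w)%C by (field; auto).
  rewrite Cmod_div by auto. apply Cmod_gt_0 in N. apply Rlt_div_l; [auto|].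
  eapply Rle_lt_trans; [apply Cmod_le_abs|].
  assert (X := re_le_Cmod w). assert (Y := Rabs_im_le_Cmod w).
  destruct w as [x y]. simpl in *.
  specialize (H1 x ltac:(lra)). specialize (H2 y ltac:(lra)). specialize (H3 y ltac:(lra)).
  rewrite exp_0 in H1. rewrite sin_0 in H2. rewrite cos_0 in H3.
  set (r := Cmod (x, y)) in *.
  assert (Ax := Rabs_pos x). assert (Ay := Rabs_pos y).
  assert (B1 : Rabs (exp x - 1 - 1 * x) <= e' * r) by nra.
  assert (B2 : Rabs (sin y - 0 - 1 * y) <= e' * r) by nra.
  assert (B3 : Rabs (cos y - 1 - 0 * y) <= e' * r) by nra.
  assert (Sy : Rabs (sin y) <= 1) by (apply Rabs_le; generalize (SIN_bound y); lra).
  assert (Cy : Rabs (cos y) <= 1) by (apply Rabs_le; generalize (COS_bound y); lra).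
  assert (Ex : Rabs (exp x - 1) <= 2 * r).
  { replace (exp x - 1) with ((exp x - 1 - 1 * x) + x) by ring.
    eapply Rle_trans; [apply Rabs_triang|]. nra. }
  assert (Syr : Rabs (sin y) <= 2 * r).
  { replace (sin y) with ((sin y - 0 - 1 * y) + y) by ring.
    eapply Rle_trans; [apply Rabs_triang|]. nra. }
  replace (exp x * cos y + - (1) + - x)
    with ((exp x - 1 - 1 * x) + ((cos y - 1 - 0 * y) + (exp x - 1) * (cos y - 1 - 0 * y))) by ring.
  replace (exp x * sin y + - 0 + - y)
    with ((sin y - 0 - 1 * y) + (exp x - 1) * sin y) by ring.
  assert (T1 := Rabs_triang (exp x - 1 - 1 * x) ((cos y - 1 - 0 * y) + (exp x - 1) * (cos y - 1 - 0 * y))).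
  assert (T2 := Rabs_triang (cos y - 1 - 0 * y) ((exp x - 1) * (cos y - 1 - 0 * y))).
  assert (T3 := Rabs_triang (sin y - 0 - 1 * y) ((exp x - 1) * sin y)).
  rewrite Rabs_mult in T2, T3.
  assert (M1 : Rabs (exp x - 1) * Rabs (cos y - 1 - 0 * y) <= 2 * (e' * r)).
  { apply Rmult_le_compat; try apply Rabs_pos; nra. }
  assert (M2 : Rabs (exp x - 1) * Rabs (sin y) <= (2 * r) * (2 * e')).
  { apply Rmult_le_compat; try apply Rabs_pos; nra. }
  assert (e' * r <= e / 16 * r) by (apply Rmult_le_compat_r; lra).
  assert (0 < e * r) by now apply Rmult_lt_0_compat. lra.
Qed.

Lemma Cdiff_Cexp (z : C) : Cdiff Cexp z.
Proof.
  apply (Cdiff_ext_loc (fun w => Cexp z * Cexp (w - z))%C _ z 1).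
  - lra.
  - intros w _. rewrite <- Cexp_plus. f_equal. ring.
  - apply Cdiff_mult; [apply Cdiff_const|]. apply (Cdiff_comp (fun w => w - z)%C Cexp).
    + apply Cdiff_minus; [apply Cdiff_id|apply Cdiff_const].
    + replace (z - z)%C with (RtoC 0) by ring. apply Cdiff_Cexp_0.
Qed.

(** * Continuity along real paths *)

Definition Pcont (f : R -> C) (t : R) : Prop :=
  forall eps, 0 < eps -> exists d, 0 < d /\
    forall s, Rabs (s - t) < d -> Cmod (f s - f t) < eps.

Lemma Pcont_comp (f : C -> C) (p : R -> C) (t : R) :
  Pcont p t -> Ccont f (p t) -> Pcont (fun s => f (p s)) t.
Proof.
  intros Hp Hf e He. destruct (Hf e He) as [d [Hd H]].
  destruct (Hp d Hd) as [d' [Hd' H']]. exists d'. auto.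
Qed.

Lemma Pcont_ext (f g : R -> C) (t : R) : (forall s, f s = g s) -> Pcont f t -> Pcont g t.
Proof.
  intros E H e He. destruct (H e He) as [d [Hd K]]. exists d. split; auto.
  intros s Hs. rewrite <- !E. auto.
Qed.

Lemma Pcont_reflect (f : R -> C) (t : R) : Pcont f (- t) -> Pcont (fun s => f (- s)) t.
Proof.
  intros H e He. destruct (H e He) as [d [Hd K]]. exists d. split; auto. intros s Hs.
  apply K. replace (- s - - t) with (- (s - t)) by ring. now rewrite Rabs_Ropp.
Qed.

Lemma Pcont_plus (f g : R -> C) (t : R) : Pcont f t -> Pcont g t -> Pcont (fun s => f s + g s)%C t.
Proof.
  intros Hf Hg e He.
  destruct (Hf (e / 2)) as [d1 [Hd1 H1]]; [lra|]. destruct (Hg (e / 2)) as [d2 [Hd2 H2]]; [lra|].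
  exists (Rmin d1 d2). split; [now apply Rmin_pos|]. intros s Hs.
  specialize (H1 s (Rlt_le_trans _ _ _ Hs (Rmin_l _ _))).
  specialize (H2 s (Rlt_le_trans _ _ _ Hs (Rmin_r _ _))).
  replace (f s + g s - (f t + g t))%C with ((f s - f t) + (g s - g t))%C by ring.
  eapply Rle_lt_trans; [apply Cmod_triangle|]. lra.
Qed.

Lemma Pcont_re (f : R -> C) (t : R) : Pcont f t -> continuous (fun s => Re (f s)) t.
Proof.
  intros H. apply filterlim_locally. intros eps.
  destruct (H eps (cond_pos eps)) as [d [Hd K]]. exists (mkposreal d Hd).
  intros s Hs. specialize (K s Hs). change (Rabs (Re (f s) - Re (f t)) < eps).
  eapply Rle_lt_trans; [|apply K]. apply (re_le_Cmod (f s - f t)).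
Qed.

Lemma Pcont_im (f : R -> C) (t : R) : Pcont f t -> continuous (fun s => Im (f s)) t.
Proof.
  intros H. apply filterlim_locally. intros eps.
  destruct (H eps (cond_pos eps)) as [d [Hd K]]. exists (mkposreal d Hd).
  intros s Hs. specialize (K s Hs). change (Rabs (Im (f s) - Im (f t)) < eps).
  eapply Rle_lt_trans; [|apply K]. apply (Rabs_im_le_Cmod (f s - f t)).
Qed.

Lemma Pcont_horiz (c t : R) : Pcont (fun s => (s, c)) t.
Proof.
  intros e He. exists e. split; auto. intros s Hs.
  replace ((s, c) - (t, c))%C with (RtoC (s - t))
    by (unfold Cminus, Cplus, Copp, RtoC; simpl; f_equal; ring).
  now rewrite Cmod_R.
Qed.

Lemma Pcont_vert (c t : R) : Pcont (fun s => (c, s)) t.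
Proof.
  intros e He. exists e. split; auto. intros s Hs.
  replace ((c, s) - (c, t))%C with (Ci * RtoC (s - t))%C
    by (unfold Cminus, Cplus, Cmult, Copp, RtoC, Ci; simpl; f_equal; ring).
  rewrite Cmod_mult, Cmod_Ci, Cmod_R. lra.
Qed.

(** * Goursat's theorem and the mean value property *)

(** Taken componentwise, so that the calculus of real Riemann integrals applies; [RInt_gen_line_int]
    leads back to the complex-valued integral in the definition of [Fourier]. *)
Definition CI (f : R -> C) (a b : R) : C :=
  (RInt (fun t => Re (f t)) a b, RInt (fun t => Im (f t)) a b).

Definition Pcont_on (f : R -> C) (a b : R) : Prop := forall t, a <= t <= b -> Pcont f t.

Lemma Pcont_on_re (f : R -> C) (a b : R) : a <= b -> Pcont_on f a b ->
  ex_RInt (fun t => Re (f t)) a b.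
Proof.
  intros Hab H. apply (ex_RInt_continuous (V := R_CompleteNormedModule)).
  intros t. rewrite Rmin_left, Rmax_right by auto. intros Ht. now apply Pcont_re, H.
Qed.

Lemma Pcont_on_im (f : R -> C) (a b : R) : a <= b -> Pcont_on f a b ->
  ex_RInt (fun t => Im (f t)) a b.
Proof.
  intros Hab H. apply (ex_RInt_continuous (V := R_CompleteNormedModule)).
  intros t. rewrite Rmin_left, Rmax_right by auto. intros Ht. now apply Pcont_im, H.
Qed.

Lemma CI_ext (f g : R -> C) (a b : R) : a <= b ->
  (forall t, a <= t <= b -> f t = g t) -> CI f a b = CI g a b.
Proof.
  intros Hab E. unfold CI. f_equal; apply RInt_ext; intros t;
  rewrite Rmin_left, Rmax_right by auto; intros Ht; rewrite E; auto; lra.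
Qed.

Lemma CI_minus (f g : R -> C) (a b : R) : a <= b -> Pcont_on f a b -> Pcont_on g a b ->
  CI (fun t => f t - g t)%C a b = (CI f a b - CI g a b)%C.
Proof.
  intros Hab Hf Hg. unfold CI, Cminus, Cplus, Copp; simpl. f_equal.
  - apply (RInt_minus (V := R_CompleteNormedModule) (fun t => Re (f t)) (fun t => Re (g t)));
    now apply Pcont_on_re.
  - apply (RInt_minus (V := R_CompleteNormedModule) (fun t => Im (f t)) (fun t => Im (g t)));
    now apply Pcont_on_im.
Qed.

Lemma CI_plus (f g : R -> C) (a b : R) : a <= b -> Pcont_on f a b -> Pcont_on g a b ->
  CI (fun t => f t + g t)%C a b = (CI f a b + CI g a b)%C.
Proof.
  intros Hab Hf Hg. unfold CI, Cplus; simpl. f_equal.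
  - apply (RInt_plus (V := R_CompleteNormedModule) (fun t => Re (f t)) (fun t => Re (g t)));
    now apply Pcont_on_re.
  - apply (RInt_plus (V := R_CompleteNormedModule) (fun t => Im (f t)) (fun t => Im (g t)));
    now apply Pcont_on_im.
Qed.

Lemma CI_scal (k : C) (f : R -> C) (a b : R) : a <= b -> Pcont_on f a b ->
  CI (fun t => k * f t)%C a b = (k * CI f a b)%C.
Proof.
  intros Hab Hf. destruct k as [u v].
  assert (Er := Pcont_on_re f a b Hab Hf). assert (Ei := Pcont_on_im f a b Hab Hf).
  assert (S : forall k h, ex_RInt h a b -> ex_RInt (fun t => k * h t) a b /\
     RInt (fun t => k * h t) a b = k * RInt h a b).
  { intros k h Hh. split; [apply (ex_RInt_scal (V := R_NormedModule) h a b k Hh)|].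
    apply (RInt_scal (V := R_CompleteNormedModule) h a b k Hh). }
  unfold CI, Cmult; simpl. f_equal.
  - destruct (S u _ Er) as [X1 X2]. destruct (S v _ Ei) as [Y1 Y2].
    rewrite <- X2, <- Y2.
    apply (RInt_minus (V := R_CompleteNormedModule) (fun t => u * Re (f t)) (fun t => v * Im (f t))); auto.
  - destruct (S u _ Ei) as [X1 X2]. destruct (S v _ Er) as [Y1 Y2].
    rewrite <- X2, <- Y2.
    apply (RInt_plus (V := R_CompleteNormedModule) (fun t => u * Im (f t)) (fun t => v * Re (f t))); auto.
Qed.

Lemma CI_Chasles (f : R -> C) (a b c : R) : a <= b -> b <= c -> Pcont_on f a c ->
  (CI f a b + CI f b c)%C = CI f a c.
Proof.
  intros Hab Hbc H.
  assert (H1 : Pcont_on f a b) by (intros t Ht; apply H; lra).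
  assert (H2 : Pcont_on f b c) by (intros t Ht; apply H; lra).
  unfold CI, Cplus; simpl. f_equal.
  - apply (RInt_Chasles (V := R_CompleteNormedModule)); now apply Pcont_on_re.
  - apply (RInt_Chasles (V := R_CompleteNormedModule)); now apply Pcont_on_im.
Qed.

(** The factor 2 is the price of bounding the real and imaginary parts separately; sharp constants
    are irrelevant below. *)
Lemma CI_bound (f : R -> C) (a b M : R) : a <= b -> Pcont_on f a b ->
  (forall t, a <= t <= b -> Cmod (f t) <= M) -> Cmod (CI f a b) <= 2 * M * (b - a).
Proof.
  intros Hab Hf HM. eapply Rle_trans; [apply Cmod_le_abs|]. unfold CI; simpl.
  assert (X := abs_RInt_le_const (fun t => Re (f t)) a b M Hab (Pcont_on_re f a b Hab Hf)).
  assert (Y := abs_RInt_le_const (fun t => Im (f t)) a b M Hab (Pcont_on_im f a b Hab Hf)).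
  specialize (X ltac:(intros t Ht; eapply Rle_trans; [apply re_le_Cmod|auto])).
  specialize (Y ltac:(intros t Ht; eapply Rle_trans; [apply Rabs_im_le_Cmod|auto])).
  lra.
Qed.

Lemma CI_bound_fun (f : R -> C) (g : R -> R) (a b : R) : a <= b -> Pcont_on f a b ->
  ex_RInt g a b ->
  (forall t, a <= t <= b -> Cmod (f t) <= g t) -> Cmod (CI f a b) <= 2 * RInt g a b.
Proof.
  intros Hab Hf Hg HM. eapply Rle_trans; [apply Cmod_le_abs|]. unfold CI; simpl.
  assert (S : forall h : R -> R, ex_RInt h a b -> (forall t, a <= t <= b -> Rabs (h t) <= g t) ->
     Rabs (RInt h a b) <= RInt g a b).
  { intros h Hh B. eapply Rle_trans; [apply (abs_RInt_le h a b Hab Hh)|].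
    apply RInt_le; auto; [now apply ex_RInt_norm|]. intros; apply B; lra. }
  assert (X := S (fun t => Re (f t)) (Pcont_on_re f a b Hab Hf)).
  assert (Y := S (fun t => Im (f t)) (Pcont_on_im f a b Hab Hf)).
  specialize (X ltac:(intros t Ht; eapply Rle_trans; [apply re_le_Cmod|auto])).
  specialize (Y ltac:(intros t Ht; eapply Rle_trans; [apply Rabs_im_le_Cmod|auto])).
  lra.
Qed.

Lemma CI_antiderivative (f F : R -> C) (a b : R) : a <= b -> Pcont_on f a b ->
  (forall t, a <= t <= b -> is_derive (fun s => Re (F s)) t (Re (f t))) ->
  (forall t, a <= t <= b -> is_derive (fun s => Im (F s)) t (Im (f t))) ->
  CI f a b = (F b - F a)%C.
Proof.
  intros Hab Hf Dr Di. unfold CI, Cminus, Cplus, Copp; simpl. f_equal.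
  - apply is_RInt_unique.
    apply (is_RInt_derive (V := R_CompleteNormedModule) (fun s => Re (F s)) (fun t => Re (f t)));
    intros t; rewrite Rmin_left, Rmax_right by auto; intros Ht; auto. now apply Pcont_re, Hf.
  - apply is_RInt_unique.
    apply (is_RInt_derive (V := R_CompleteNormedModule) (fun s => Im (F s)) (fun t => Im (f t)));
    intros t; rewrite Rmin_left, Rmax_right by auto; intros Ht; auto. now apply Pcont_im, Hf.
Qed.

(** * Nested rectangles and bisection *)

Lemma dependent_choice_rel {S : Type} (Q : S -> Prop) (Rel : S -> S -> Prop) (s0 : S) :
  Q s0 -> (forall s, Q s -> exists s', Q s' /\ Rel s s') ->
  exists u : nat -> S, u O = s0 /\ forall n, Q (u n) /\ Rel (u n) (u (Datatypes.S n)).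
Proof.
  intros H0 H.
  set (T := {s : S | Q s}).
  assert (step : forall t : T, {t' : T | Rel (proj1_sig t) (proj1_sig t')}).
  { intros [s Hs]. apply constructive_indefinite_description.
    destruct (H s Hs) as [s' [Hs' HR]]. now exists (exist _ s' Hs'). }
  set (u := fix u n : T := match n with O => exist _ s0 H0 | Datatypes.S n => proj1_sig (step (u n)) end).
  exists (fun n => proj1_sig (u n)). split; [reflexivity|]. intros n. split.
  - apply proj2_sig.
  - apply (proj2_sig (step (u n))).
Qed.

Lemma nested_intervals (a b : nat -> R) :
  (forall n, a n <= a (S n)) -> (forall n, b (S n) <= b n) -> (forall n, a n <= b n) ->
  exists x, forall n, a n <= x <= b n.
Proof.
  intros Ha Hb Hab.
  assert (Ma : forall n m, (n <= m)%nat -> a n <= a m).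
  { intros n m L. induction L; [lra|]. eapply Rle_trans; eauto. }
  assert (Mb : forall n m, (n <= m)%nat -> b m <= b n).
  { intros n m L. induction L; [lra|]. eapply Rle_trans; eauto. }
  assert (U : forall n m, a n <= b m).
  { intros n m. apply Rle_trans with (a (max n m)); [apply Ma; lia|].
    apply Rle_trans with (b (max n m)); [auto|apply Mb; lia]. }
  destruct (completeness (fun x => exists n, x = a n)) as [x [X1 X2]].
  - exists (b O). intros y [n ->]. auto.
  - exists (a O). now exists O.
  - exists x. intros n. split; [apply X1; now exists n|].
    apply X2. intros y [m ->]. auto.
Qed.

Lemma pow_half_small (A d : R) : 0 < d -> exists n : nat, A / 2 ^ n < d.
Proof.
  intros Hd. destruct (Rle_lt_dec A 0) as [HA|HA].
  { exists O. simpl. lra. }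
  destruct (pow_lt_1_zero (/ 2) ltac:(rewrite Rabs_right; lra) (d / A)) as [n Hn].
  { now apply Rdiv_lt_0_compat. }
  exists n. specialize (Hn n (le_n n)).
  rewrite pow_inv in Hn.
  rewrite Rabs_right in Hn by (left; apply Rinv_0_lt_compat, pow_lt; lra).
  apply (Rmult_lt_compat_l A) in Hn; [|auto].
  replace (A * (d / A)) with d in Hn by (field; lra). exact Hn.
Qed.

(** Compactness in the form of an induction principle. If [P] failed, it would fail on one of the
    quarters, and iterating gives failing rectangles that shrink to a point, against the local
    hypothesis. It serves Goursat's theorem and both halves of [rect_max]. *)
Lemma rect_bisection (P : R -> R -> R -> R -> Prop) (a0 b0 c0 d0 : R) :
  a0 <= b0 -> c0 <= d0 ->
  (forall a b c d, a0 <= a -> a <= b -> b <= b0 -> c0 <= c -> c <= d -> d <= d0 ->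
     P a ((a + b) / 2) c ((c + d) / 2) -> P ((a + b) / 2) b c ((c + d) / 2) ->
     P a ((a + b) / 2) ((c + d) / 2) d -> P ((a + b) / 2) b ((c + d) / 2) d -> P a b c d) ->
  (forall x y, a0 <= x <= b0 -> c0 <= y <= d0 -> exists delta, 0 < delta /\
     forall a b c d, a0 <= a <= x -> x <= b <= b0 -> c0 <= c <= y -> y <= d <= d0 ->
       b - a < delta -> d - c < delta -> P a b c d) ->
  P a0 b0 c0 d0.
Proof.
  intros Hab Hcd Hsub Hloc. apply Classical_Prop.NNPP. intros HN.
  set (Q := fun s : (R * R) * (R * R) =>
    let '((a, b), (c, d)) := s in
    a0 <= a /\ a <= b /\ b <= b0 /\ c0 <= c /\ c <= d /\ d <= d0 /\ ~ P a b c d).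
  set (Rel := fun s s' : (R * R) * (R * R) =>
    let '((a, b), (c, d)) := s in let '((a', b'), (c', d')) := s' in
    a <= a' /\ b' <= b /\ c <= c' /\ d' <= d /\
    b' - a' = (b - a) / 2 /\ d' - c' = (d - c) / 2).
  destruct (dependent_choice_rel Q Rel ((a0, b0), (c0, d0))) as [u [U0 U]].
  - repeat split; auto; lra.
  - intros [[a b] [c d]] (H1 & H2 & H3 & H4 & H5 & H6 & H7).
    destruct (classic (P a ((a + b) / 2) c ((c + d) / 2))) as [K1|K1];
      [|exists ((a, (a + b) / 2), (c, (c + d) / 2)); repeat split; auto; lra].
    destruct (classic (P ((a + b) / 2) b c ((c + d) / 2))) as [K2|K2];
      [|exists (((a + b) / 2, b), (c, (c + d) / 2)); repeat split; auto; lra].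
    destruct (classic (P a ((a + b) / 2) ((c + d) / 2) d)) as [K3|K3];
      [|exists ((a, (a + b) / 2), ((c + d) / 2, d)); repeat split; auto; lra].
    destruct (classic (P ((a + b) / 2) b ((c + d) / 2) d)) as [K4|K4];
      [|exists (((a + b) / 2, b), ((c + d) / 2, d)); repeat split; auto; lra].
    exfalso. apply H7. now apply Hsub.
  - set (ua := fun n => fst (fst (u n))). set (ub := fun n => snd (fst (u n))).
    set (uc := fun n => fst (snd (u n))). set (ud := fun n => snd (snd (u n))).
    assert (UQ : forall n, a0 <= ua n /\ ua n <= ub n /\ ub n <= b0 /\ c0 <= uc n /\
      uc n <= ud n /\ ud n <= d0 /\ ~ P (ua n) (ub n) (uc n) (ud n)).
    { intros n. unfold ua, ub, uc, ud. destruct (U n) as [H _].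
      destruct (u n) as [[a b] [c d]]. exact H. }
    assert (UR : forall n, ua n <= ua (S n) /\ ub (S n) <= ub n /\ uc n <= uc (S n) /\
      ud (S n) <= ud n /\ ub (S n) - ua (S n) = (ub n - ua n) / 2 /\
      ud (S n) - uc (S n) = (ud n - uc n) / 2).
    { intros n. unfold ua, ub, uc, ud. destruct (U n) as [_ H].
      destruct (u n) as [[a b] [c d]], (u (S n)) as [[a' b'] [c' d']]. exact H. }
    assert (L1 : forall n, ub n - ua n = (b0 - a0) / 2 ^ n).
    { induction n as [|n IH]; [unfold ub, ua; rewrite U0; simpl; lra|].
      destruct (UR n) as (_ & _ & _ & _ & E & _). rewrite E, IH. simpl. field.
      apply pow_nonzero; lra. }
    assert (L2 : forall n, ud n - uc n = (d0 - c0) / 2 ^ n).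
    { induction n as [|n IH]; [unfold ud, uc; rewrite U0; simpl; lra|].
      destruct (UR n) as (_ & _ & _ & _ & _ & E). rewrite E, IH. simpl. field.
      apply pow_nonzero; lra. }
    destruct (nested_intervals ua ub) as [x Hx]; try (intros n; apply (UR n) || apply (UQ n)).
    destruct (nested_intervals uc ud) as [y Hy]; try (intros n; apply (UR n) || apply (UQ n)).
    assert (X0 := Hx O). assert (Y0 := Hy O).
    unfold ua, ub in X0. unfold uc, ud in Y0. rewrite U0 in X0, Y0. simpl in X0, Y0.
    destruct (Hloc x y X0 Y0) as [delta [Hd H]].
    destruct (pow_half_small ((b0 - a0) + (d0 - c0)) delta Hd) as [n Hn].
    assert (P1 : 0 <= (b0 - a0) / 2 ^ n)
      by (apply Rdiv_le_0_compat; [lra|apply pow_lt; lra]).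
    assert (P2 : 0 <= (d0 - c0) / 2 ^ n)
      by (apply Rdiv_le_0_compat; [lra|apply pow_lt; lra]).
    replace (((b0 - a0) + (d0 - c0)) / 2 ^ n)
      with ((b0 - a0) / 2 ^ n + (d0 - c0) / 2 ^ n) in Hn by (field; apply pow_nonzero; lra).
    rewrite <- L1, <- L2 in *.
    destruct (UQ n) as (Q1 & Q2 & Q3 & Q4 & Q5 & Q6 & Q7). apply Q7.
    assert (Hxn := Hx n). assert (Hyn := Hy n).
    apply H; lra.
Qed.

Definition rect (a b c d : R) (z : C) : Prop := a <= Re z <= b /\ c <= Im z <= d.

(** The counterclockwise contour integral, with opposite sides paired so that every real integral
    runs upwards in its variable; [Ci] comes from [dz = i dt] on the vertical sides. *)
Definition rect_int (f : C -> C) (a b c d : R) : C :=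
  (CI (fun t => f (t, c)) a b - CI (fun t => f (t, d)) a b
   + Ci * (CI (fun t => f (b, t)) c d - CI (fun t => f (a, t)) c d))%C.

Definition rect_bdry (a b c d : R) (z : C) : Prop :=
  rect a b c d z /\ (Re z = a \/ Re z = b \/ Im z = c \/ Im z = d).

Definition Ccont_bdry (f : C -> C) (a b c d : R) : Prop :=
  forall z, rect_bdry a b c d z -> Ccont f z.

Definition Ccont_rect (f : C -> C) (a b c d : R) : Prop :=
  forall z, rect a b c d z -> Ccont f z.

Lemma Pcont_on_bdry (f : C -> C) (a b c d : R) : a <= b -> c <= d ->
  Ccont_bdry f a b c d ->
  Pcont_on (fun t => f (t, c)) a b /\ Pcont_on (fun t => f (t, d)) a b /\
  Pcont_on (fun t => f (b, t)) c d /\ Pcont_on (fun t => f (a, t)) c d.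
Proof.
  intros Hab Hcd H. repeat split; intros t Ht.
  - apply (Pcont_comp f (fun s => (s, c))); [apply Pcont_horiz|].
    apply H. split; [split; simpl; lra|simpl; auto].
  - apply (Pcont_comp f (fun s => (s, d))); [apply Pcont_horiz|].
    apply H. split; [split; simpl; lra|simpl; auto].
  - apply (Pcont_comp f (fun s => (b, s))); [apply Pcont_vert|].
    apply H. split; [split; simpl; lra|simpl; auto].
  - apply (Pcont_comp f (fun s => (a, s))); [apply Pcont_vert|].
    apply H. split; [split; simpl; lra|simpl; auto].
Qed.

Lemma Ccont_rect_bdry (f : C -> C) (a b c d : R) :
  Ccont_rect f a b c d -> Ccont_bdry f a b c d.
Proof. intros H z [Hz _]. now apply H. Qed.

Lemma rect_int_minus (f g : C -> C) (a b c d : R) : a <= b -> c <= d ->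
  Ccont_bdry f a b c d -> Ccont_bdry g a b c d ->
  rect_int (fun z => f z - g z)%C a b c d = (rect_int f a b c d - rect_int g a b c d)%C.
Proof.
  intros Hab Hcd Hf Hg.
  destruct (Pcont_on_bdry f a b c d Hab Hcd Hf) as (F1 & F2 & F3 & F4).
  destruct (Pcont_on_bdry g a b c d Hab Hcd Hg) as (G1 & G2 & G3 & G4).
  unfold rect_int.
  rewrite (CI_minus (fun t => f (t, c)) (fun t => g (t, c))),
    (CI_minus (fun t => f (t, d)) (fun t => g (t, d))),
    (CI_minus (fun t => f (b, t)) (fun t => g (b, t))),
    (CI_minus (fun t => f (a, t)) (fun t => g (a, t))); auto.
  ring.
Qed.

Lemma rect_int_scal (k : C) (f : C -> C) (a b c d : R) : a <= b -> c <= d ->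
  Ccont_bdry f a b c d ->
  rect_int (fun z => k * f z)%C a b c d = (k * rect_int f a b c d)%C.
Proof.
  intros Hab Hcd Hf.
  destruct (Pcont_on_bdry f a b c d Hab Hcd Hf) as (F1 & F2 & F3 & F4).
  unfold rect_int.
  rewrite (CI_scal k (fun t => f (t, c))), (CI_scal k (fun t => f (t, d))),
    (CI_scal k (fun t => f (b, t))), (CI_scal k (fun t => f (a, t))); auto.
  ring.
Qed.

Lemma rect_int_bound (f : C -> C) (a b c d M : R) : a <= b -> c <= d ->
  Ccont_rect f a b c d -> (forall z, rect a b c d z -> Cmod (f z) <= M) ->
  Cmod (rect_int f a b c d) <= 4 * M * ((b - a) + (d - c)).
Proof.
  intros Hab Hcd Hf HM. unfold rect_int.
  eapply Rle_trans; [apply Cmod_triangle|]. rewrite Cmod_mult, Cmod_Ci.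
  assert (B1 := Cmod_triangle_sub (CI (fun t => f (t, c)) a b) (CI (fun t => f (t, d)) a b)).
  assert (B2 := Cmod_triangle_sub (CI (fun t => f (b, t)) c d) (CI (fun t => f (a, t)) c d)).
  destruct (Pcont_on_bdry f a b c d Hab Hcd (Ccont_rect_bdry _ _ _ _ _ Hf)) as (F1 & F2 & F3 & F4).
  assert (C1 := CI_bound _ a b M Hab F1). assert (C2 := CI_bound _ a b M Hab F2).
  assert (C3 := CI_bound _ c d M Hcd F3). assert (C4 := CI_bound _ c d M Hcd F4).
  specialize (C1 ltac:(intros t Ht; apply HM; split; simpl; lra)).
  specialize (C2 ltac:(intros t Ht; apply HM; split; simpl; lra)).
  specialize (C3 ltac:(intros t Ht; apply HM; split; simpl; lra)).
  specialize (C4 ltac:(intros t Ht; apply HM; split; simpl; lra)).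
  lra.
Qed.

Lemma rect_int_split_x (f : C -> C) (a m b c d : R) : a <= m -> m <= b -> c <= d ->
  Ccont_rect f a b c d ->
  rect_int f a b c d = (rect_int f a m c d + rect_int f m b c d)%C.
Proof.
  intros H1 H2 H3 H. unfold rect_int.
  rewrite <- (CI_Chasles (fun t => f (t, c)) a m b), <- (CI_Chasles (fun t => f (t, d)) a m b);
  auto.
  ring.
  all: apply (Pcont_on_bdry f a b c d); auto using Ccont_rect_bdry; lra.
Qed.

Lemma rect_int_split_y (f : C -> C) (a b c m d : R) : a <= b -> c <= m -> m <= d ->
  Ccont_rect f a b c d ->
  rect_int f a b c d = (rect_int f a b c m + rect_int f a b m d)%C.
Proof.
  intros H1 H2 H3 H. unfold rect_int.
  rewrite <- (CI_Chasles (fun t => f (a, t)) c m d), <- (CI_Chasles (fun t => f (b, t)) c m d);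
  auto.
  ring.
  all: apply (Pcont_on_bdry f a b c d); auto using Ccont_rect_bdry; lra.
Qed.

Lemma CI_const (k : C) (a b : R) : a <= b -> CI (fun _ => k) a b = (RtoC (b - a) * k)%C.
Proof.
  intros H. unfold CI. rewrite !RInt_const. destruct k as [u v].
  unfold scal; simpl; unfold mult; simpl. unfold Cmult, RtoC; simpl. f_equal; ring.
Qed.

Lemma rect_int_const (k : C) (a b c d : R) : a <= b -> c <= d ->
  rect_int (fun _ => k) a b c d = RtoC 0.
Proof. intros. unfold rect_int. rewrite !CI_const by auto. ring. Qed.

Lemma rect_int_id (a b c d : R) : a <= b -> c <= d ->
  rect_int (fun z => z) a b c d = RtoC 0.
Proof.
  intros H1 H2. unfold rect_int.
  rewrite (CI_antiderivative (fun t => (t, c)) (fun t => (t * t / 2, c * t))),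
    (CI_antiderivative (fun t => (t, d)) (fun t => (t * t / 2, d * t))),
    (CI_antiderivative (fun t => (b, t)) (fun t => (b * t, t * t / 2))),
    (CI_antiderivative (fun t => (a, t)) (fun t => (a * t, t * t / 2))); auto.
  - unfold Cminus, Cplus, Copp, Cmult, Ci, RtoC; simpl. f_equal; field.
  all: intros t _; first [apply Pcont_vert|apply Pcont_horiz|simpl; auto_derive; auto; field].
Qed.

Theorem goursat (f : C -> C) (a b c d : R) : a <= b -> c <= d ->
  (forall z, rect a b c d z -> Cdiff f z) -> rect_int f a b c d = RtoC 0.
Proof.
  intros Hab Hcd Hf.
  assert (Hc : Ccont_rect f a b c d) by (intros z Hz; now apply Cdiff_cont, Hf).
  apply Cmod_eq_0. apply Rle_antisym; [|apply Cmod_ge_0].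
  apply le_epsilon. intros e He. rewrite Rplus_0_l.
  set (s := (b - a) + (d - c)).
  assert (Hs : 0 <= s) by (unfold s; lra).
  (* The summand 1 covers the degenerate rectangle [s = 0]. *)
  set (k := e / (s ^ 2 + 1)).
  assert (Hk : 0 < k) by (apply Rdiv_lt_0_compat; nra).
  assert (K : Cmod (rect_int f a b c d) <= k * ((b - a) + (d - c)) ^ 2).
  { apply (rect_bisection (fun a b c d => Cmod (rect_int f a b c d) <= k * ((b - a) + (d - c)) ^ 2));
    auto.
    - intros a' b' c' d' H1 H2 H3 H4 H5 H6.
      set (m := (a' + b') / 2). set (n := (c' + d') / 2). intros P1 P2 P3 P4.
      assert (C' : Ccont_rect f a' b' c' d')
        by (intros z [Z1 Z2]; apply Hc; split; lra).
      rewrite (rect_int_split_x f a' m b') by (auto; unfold m; lra).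
      rewrite (rect_int_split_y f a' m c' n d'), (rect_int_split_y f m b' c' n d');
        try (intros z [Z1 Z2]; apply C'; unfold m, n in *; split; lra); try (unfold m, n; lra).
      eapply Rle_trans; [apply Cmod_triangle|].
      assert (T1 := Cmod_triangle (rect_int f a' m c' n) (rect_int f a' m n d')).
      assert (T2 := Cmod_triangle (rect_int f m b' c' n) (rect_int f m b' n d')).
      (* A quarter has half the half-perimeter, hence a quarter of its square: the claimed bound is
         exactly additive over the four quarters. *)
      replace (k * (b' - a' + (d' - c')) ^ 2) with
        (k * (m - a' + (n - c')) ^ 2 + k * (b' - m + (n - c')) ^ 2
         + k * (m - a' + (d' - n)) ^ 2 + k * (b' - m + (d' - n)) ^ 2)
        by (unfold m, n; field).
      lra.
    - intros x y Hx Hy.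
      destruct (Hf (x, y)) as [l [q [Hl [Hq E]]]]; [split; simpl; auto|].
      destruct (Hq (k / 4)) as [dl [Hdl HD]]; [lra|].
      exists (dl / 2). split; [lra|].
      intros a' b' c' d' H1 H2 H3 H4 H5 H6.
      assert (C' : Ccont_rect f a' b' c' d')
        by (intros z [Z1 Z2]; apply Hc; split; lra).
      (* The affine part of [f] at [(x, y)] has zero integral. What is left is
         [(q z - l) (z - (x, y))], of size at most [k / 4] times the half-perimeter [s'], and
         [rect_int_bound] turns this into [k s'^2]. *)
      set (A := fun z : C => (f (x, y) - l * (x, y) - (- l) * z)%C).
      assert (CA : Ccont_rect A a' b' c' d').
      { intros z _. apply Ccont_minus; [apply Ccont_const|].
        apply Ccont_mult; [apply Ccont_const|apply Ccont_id]. }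
      assert (IA : rect_int A a' b' c' d' = RtoC 0).
      { unfold A. rewrite (rect_int_minus (fun _ => f (x, y) - l * (x, y))%C (fun z => - l * z)%C);
          try lra; try (intros z _; apply Ccont_const).
        rewrite rect_int_const, rect_int_scal, rect_int_id; try lra. ring.
        intros z _; apply Ccont_id.
        intros z _; apply Ccont_mult; [apply Ccont_const|apply Ccont_id]. }
      assert (I : rect_int f a' b' c' d' = rect_int (fun z => f z - A z)%C a' b' c' d').
      { rewrite rect_int_minus by (auto using Ccont_rect_bdry; lra). rewrite IA. ring. }
      rewrite I. set (s' := b' - a' + (d' - c')).
      eapply Rle_trans; [apply (rect_int_bound _ _ _ _ _ (k / 4 * s')); try lra|].
      + intros z Hz; apply Ccont_minus; auto.
      + intros z [Z1 Z2].
        assert (D : Cmod (z - (x, y)) <= s').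
        { eapply Rle_trans; [apply Cmod_le_abs|]. destruct z as [zx zy]. simpl in *.
          apply Rplus_le_compat; apply Rabs_le; lra. }
        replace (f z - A z)%C with ((q z - l) * (z - (x, y)))%C
          by (unfold A; rewrite (E z); ring).
        rewrite Cmod_mult. apply Rmult_le_compat; try apply Cmod_ge_0; auto.
        rewrite <- Hl. left. apply HD. unfold s' in D. lra.
      + fold s'. apply Req_le. field. }
  eapply Rle_trans; [apply K|]. fold s. unfold k.
  apply (Rmult_le_reg_r (s ^ 2 + 1)); [nra|].
  replace (e / (s ^ 2 + 1) * s ^ 2 * (s ^ 2 + 1)) with (e * s ^ 2) by (field; nra).
  nra.
Qed.

(** * Means over circles *)

Definition circ (p : C) (r t : R) : C := (p + ((r * cos t)%R, (r * sin t)%R))%C.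

Lemma Cexp_ln (r t : R) : 0 < r -> Cexp (ln r, t) = (r * cos t, r * sin t).
Proof. intros H. unfold Cexp; simpl. now rewrite exp_ln. Qed.

Lemma Cmod_circ (p : C) (r t : R) : 0 < r -> Cmod (circ p r t - p) = r.
Proof.
  intros H. unfold circ. rewrite <- Cexp_ln by auto.
  replace (p + Cexp (ln r, t) - p)%C with (Cexp (ln r, t)) by ring.
  rewrite Cmod_Cexp. simpl. now apply exp_ln.
Qed.

Lemma Pcont_circ (p : C) (r t : R) : 0 < r -> Pcont (circ p r) t.
Proof.
  intros H e He.
  destruct (Pcont_comp (fun w => p + Cexp w)%C (fun s => (ln r, s)) t (Pcont_vert _ _)) with (eps := e)
    as [d [Hd K]]; auto.
  - apply Ccont_plus; [apply Ccont_const|]. apply Cdiff_cont, Cdiff_Cexp.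
  - exists d. split; auto. intros s Hs. specialize (K s Hs).
    rewrite !Cexp_ln in K by auto. exact K.
Qed.

Lemma annulus_mean (f : C -> C) (p : C) (s r : R) : 0 < s -> s <= r ->
  (forall w, s <= Cmod (w - p) <= r -> Cdiff f w) ->
  CI (fun t => f (circ p s t)) 0 (2 * PI) = CI (fun t => f (circ p r t)) 0 (2 * PI).
Proof.
  intros Hs Hsr Hf. assert (Hpi := PI_RGT_0).
  set (F := fun w => f (p + Cexp w)%C).
  assert (G : rect_int F (ln s) (ln r) 0 (2 * PI) = RtoC 0).
  { apply goursat; [now apply ln_le|lra|]. intros w [W1 W2].
    apply (Cdiff_comp (fun w => p + Cexp w)%C f).
    - apply Cdiff_plus; [apply Cdiff_const|apply Cdiff_Cexp].
    - apply Hf. replace (p + Cexp w - p)%C with (Cexp w) by ring. rewrite Cmod_Cexp.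
      rewrite <- (exp_ln s), <- (exp_ln r) by lra. split; now apply exp_le_compat. }
  unfold rect_int in G.
  (* By the period [2 pi i] of the exponential the two horizontal sides coincide and cancel; the
     vertical sides are the means over the two circles. *)
  rewrite (CI_ext (fun t => F (t, 2 * PI)) (fun t => F (t, 0))) in G.
  2: now apply ln_le.
  2:{ intros t _. unfold F, Cexp; simpl. now rewrite cos_2PI, sin_2PI, cos_0, sin_0. }
  rewrite (CI_ext (fun t => F (ln s, t)) (fun t => f (circ p s t))) in G.
  2: lra.
  2:{ intros t _. unfold F, circ. rewrite Cexp_ln by lra. auto. }
  rewrite (CI_ext (fun t => F (ln r, t)) (fun t => f (circ p r t))) in G.
  2: lra.
  2:{ intros t _. unfold F, circ. rewrite Cexp_ln by lra. auto. }

  set (X := CI (fun t => f (circ p s t)) 0 (2 * PI)) in *.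
  set (Y := CI (fun t => f (circ p r t)) 0 (2 * PI)) in *.
  set (Z := CI (fun t => F (t, 0)) (ln s) (ln r)) in *.
  assert (G' : (Ci * (Z - Z + Ci * (Y - X)) = Ci * 0)%C) by (f_equal; exact G).
  replace (Ci * (Z - Z + Ci * (Y - X)))%C with ((Ci * Ci) * (Y - X))%C in G' by ring.
  replace (Ci * Ci)%C with (- RtoC 1)%C in G'
    by (unfold Ci, Cmult, Copp, RtoC; simpl; f_equal; ring).
  symmetry. apply Csub_eq_0. replace (Y - X)%C with (- RtoC 1 * (- RtoC 1 * (Y - X)))%C by ring.
  rewrite G'. ring.
Qed.

(* The circle is the image of a vertical segment under p + exp, so that the
   mean over circles around p does not depend on the radius; p itself is
   only approached. *)
Theorem circle_mean (f : C -> C) (p : C) (r : R) : 0 < r ->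
  (forall w, 0 < Cmod (w - p) <= r -> Cdiff f w) -> Ccont f p ->
  CI (fun t => f (circ p r t)) 0 (2 * PI) = (RtoC (2 * PI) * f p)%C.
Proof.
  intros Hr Hf Hp. assert (Hpi := PI_RGT_0).
  apply Ceq_le_eps. intros e He.
  destruct (Hp (e / (4 * PI))) as [d [Hd H]]; [apply Rdiv_lt_0_compat; lra|].
  set (s := Rmin (d / 2) r).
  assert (Hs : 0 < s) by (apply Rmin_pos; lra).
  assert (Hsr : s <= r) by apply Rmin_r.
  assert (Hsd : s <= d / 2) by apply Rmin_l.
  rewrite <- (annulus_mean f p s r) by (auto; intros w Hw; apply Hf; lra).
  replace (RtoC (2 * PI)) with (RtoC (2 * PI - 0)) by (f_equal; ring).
  assert (Pf : Pcont_on (fun t => f (circ p s t)) 0 (2 * PI)).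
  { intros t _. apply Pcont_comp; [now apply Pcont_circ|].
    apply Cdiff_cont, Hf. rewrite Cmod_circ; lra. }
  assert (Pc : Pcont_on (fun _ => f p) 0 (2 * PI)).
  { intros t _ e' He'. exists 1. split; [lra|]. intros. now rewrite Cmod_sub_diag. }
  rewrite <- CI_const by lra. rewrite <- CI_minus by (auto; lra).
  eapply Rle_trans; [apply (CI_bound _ _ _ (e / (4 * PI)))|].
  - lra.
  - intros t Ht. apply (Pcont_comp (fun v => v - f p)%C); [now apply Pf|].
    apply Ccont_minus; [apply Ccont_id|apply Ccont_const].
  - intros t Ht. left. apply H. rewrite Cmod_circ; lra.
  - apply Req_le. field. lra.
Qed.

(** * The maximum principle *)

Definition Rcont (u : C -> R) (z : C) : Prop :=
  forall eps, 0 < eps -> exists d, 0 < d /\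
    forall w, Cmod (w - z) < d -> Rabs (u w - u z) < eps.

Lemma Rcont_Cmod (f : C -> C) (z : C) : Ccont f z -> Rcont (fun w => Cmod (f w)) z.
Proof.
  intros H e He. destruct (H e He) as [d [Hd K]]. exists d. split; auto.
  intros w Hw. specialize (K w Hw). apply Rabs_def1.
  - generalize (Cmod_triangle_rev (f w) (f z)). lra.
  - generalize (Cmod_triangle_rev (f z) (f w)). rewrite Cmod_sub_sym. lra.
Qed.

Lemma Rcont_continuity (u : C -> R) (phi : R -> R) (z : C) :
  Rcont u z -> continuity_pt phi (u z) -> Rcont (fun w => phi (u w)) z.
Proof.
  intros Hu Hp e He. destruct (Hp e He) as [a [Ha K]].
  destruct (Hu a Ha) as [d [Hd H]]. exists d. split; auto. intros w Hw.
  destruct (Req_dec (u w) (u z)) as [->|N].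
  - rewrite Rminus_diag. now rewrite Rabs_R0.
  - apply (K (u w)). split; [|now apply H]. split; [exact I|auto].
Qed.

Lemma Rcont_plus (u v : C -> R) (z : C) : Rcont u z -> Rcont v z ->
  Rcont (fun w => u w + v w) z.
Proof.
  intros Hu Hv e He. destruct (Hu (e / 2)) as [d1 [Hd1 H1]]; [lra|].
  destruct (Hv (e / 2)) as [d2 [Hd2 H2]]; [lra|].
  exists (Rmin d1 d2). split; [now apply Rmin_pos|]. intros w Hw.
  specialize (H1 w (Rlt_le_trans _ _ _ Hw (Rmin_l _ _))).
  specialize (H2 w (Rlt_le_trans _ _ _ Hw (Rmin_r _ _))).
  replace (u w + v w - (u z + v z)) with ((u w - u z) + (v w - v z)) by ring.
  eapply Rle_lt_trans; [apply Rabs_triang|lra].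
Qed.

Lemma rect_diam (a b c d : R) (z w : C) : rect a b c d z -> rect a b c d w ->
  Cmod (z - w) <= (b - a) + (d - c).
Proof.
  intros [Z1 Z2] [W1 W2]. eapply Rle_trans; [apply Cmod_le_abs|].
  destruct z, w. simpl in *. apply Rplus_le_compat; apply Rabs_le; lra.
Qed.

Lemma rect_bounded_cases (u : C -> R) (a b c d m n B1 B2 B3 B4 : R) :
  (forall z, rect a m c n z -> u z <= B1) -> (forall z, rect m b c n z -> u z <= B2) ->
  (forall z, rect a m n d z -> u z <= B3) -> (forall z, rect m b n d z -> u z <= B4) ->
  forall z, rect a b c d z -> u z <= Rmax (Rmax B1 B2) (Rmax B3 B4).
Proof.
  intros H1 H2 H3 H4 z [Zx Zy].
  assert (M1 := Rmax_l (Rmax B1 B2) (Rmax B3 B4)). assert (M2 := Rmax_r (Rmax B1 B2) (Rmax B3 B4)).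
  assert (M3 := Rmax_l B1 B2). assert (M4 := Rmax_r B1 B2).
  assert (M5 := Rmax_l B3 B4). assert (M6 := Rmax_r B3 B4).
  destruct (Rle_dec (Re z) m), (Rle_dec (Im z) n).
  - specialize (H1 z ltac:(split; lra)). lra.
  - specialize (H3 z ltac:(split; lra)). lra.
  - specialize (H2 z ltac:(split; lra)). lra.
  - specialize (H4 z ltac:(split; lra)). lra.
Qed.

Lemma rect_locally_bounded (u : C -> R) (a b c d : R) (z : C) (e : R) :
  0 < e -> Rcont u z ->
  exists delta, 0 < delta /\ forall a' b' c' d', rect a' b' c' d' z ->
    b' - a' < delta -> d' - c' < delta -> forall w, rect a' b' c' d' w -> u w <= u z + e.
Proof.
  intros He H. destruct (H e He) as [dl [Hdl K]]. exists (dl / 2). split; [lra|].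
  intros a' b' c' d' Hz H1 H2 w Hw.
  assert (D := rect_diam _ _ _ _ _ _ Hw Hz).
  specialize (K w ltac:(lra)). apply Rabs_def2 in K. lra.
Qed.

Lemma rect_max (u : C -> R) (a b c d : R) : a <= b -> c <= d ->
  (forall z, rect a b c d z -> Rcont u z) ->
  exists P, rect a b c d P /\ forall z, rect a b c d z -> u z <= u P.
Proof.
  intros Hab Hcd Hu.
  assert (B : exists B, forall z, rect a b c d z -> u z <= B).
  { apply (rect_bisection (fun a b c d => exists B, forall z, rect a b c d z -> u z <= B)); auto.
    - intros a' b' c' d' _ _ _ _ _ _ [B1 H1] [B2 H2] [B3 H3] [B4 H4].
      eexists. eapply rect_bounded_cases; eauto.
    - intros x y Hx Hy.
      destruct (rect_locally_bounded u a b c d (x, y) 1) as [dl [Hdl K]]; [lra| |].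
      + apply Hu. split; auto.
      + exists dl. split; auto. intros a' b' c' d' H1 H2 H3 H4 H5 H6.
        exists (u (x, y) + 1). apply K; auto. split; simpl; lra. }
  destruct B as [B HB].
  destruct (completeness (fun y => exists z, rect a b c d z /\ y = u z)) as [M [M1 M2]].
  - exists B. intros y [z [Hz ->]]. auto.
  - exists (u (a, c)), (a, c). split; auto. split; simpl; lra.
  - apply Classical_Prop.NNPP. intros HN.
    assert (L : forall z, rect a b c d z -> u z < M).
    { intros z Hz. destruct (M1 (u z)) as [h|h]; [exists z; auto|auto|].
      exfalso. apply HN. exists z. split; auto. intros w Hw. rewrite h. apply M1. exists w; auto. }
    (* If the supremum [M] is not attained, every point leaves a gap below [M], half of which
       survives nearby by continuity. Bisection makes the gap uniform, against the choice of [M] as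
       least upper bound. *)
    assert (B' : exists m, m < M /\ forall z, rect a b c d z -> u z <= m).
    { apply (rect_bisection (fun a b c d => exists m, m < M /\ forall z, rect a b c d z -> u z <= m)); auto.
      - intros a' b' c' d' _ _ _ _ _ _ [B1 [L1 H1]] [B2 [L2 H2]] [B3 [L3 H3]] [B4 [L4 H4]].
        exists (Rmax (Rmax B1 B2) (Rmax B3 B4)). split; [repeat apply Rmax_lub_lt; auto|].
        eapply rect_bounded_cases; eauto.
      - intros x y Hx Hy.
        assert (Lz := L (x, y) ltac:(split; auto)).
        destruct (rect_locally_bounded u a b c d (x, y) ((M - u (x, y)) / 2)) as [dl [Hdl K]]; [lra| |].
        + apply Hu. split; auto.
        + exists dl. split; auto. intros a' b' c' d' H1 H2 H3 H4 H5 H6.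
          exists (u (x, y) + (M - u (x, y)) / 2). split; [lra|].
          apply K; auto. split; simpl; lra. }
    destruct B' as [m [Hm Hb]].
    assert (M <= m); [|lra]. apply M2. intros y [z [Hz ->]]. auto.
Qed.

Definition rect_int_pt (a b c d : R) (z : C) : Prop := a < Re z < b /\ c < Im z < d.

(** Nothing is required at [P] itself: the maximum principle has to apply to difference quotients,
    which are known to be continuous but not yet differentiable at their base points. *)
Definition punctured_diff (f : C -> C) (P : C) : Prop :=
  exists r, 0 < r /\ forall w, 0 < Cmod (w - P) < r -> Cdiff f w.

Lemma rect_not_bdry (a b c d : R) (z : C) : rect a b c d z -> ~ rect_bdry a b c d z ->
  rect_int_pt a b c d z.
Proof.
  intros [H1 H2] N.
  assert (~ (Re z = a \/ Re z = b \/ Im z = c \/ Im z = d)) by (intros h; apply N; split; [split|]; auto).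
  split; lra.
Qed.

Lemma rect_interior_disc (a b c d : R) (P : C) : rect_int_pt a b c d P ->
  exists r, 0 < r /\ (forall w, Cmod (w - P) < r -> rect_int_pt a b c d w) /\
    (forall w, rect_bdry a b c d w -> r <= Cmod (w - P)).
Proof.
  intros [H1 H2].
  set (r := Rmin (Rmin (Re P - a) (b - Re P)) (Rmin (Im P - c) (d - Im P))).
  assert (R1 := Rmin_l (Rmin (Re P - a) (b - Re P)) (Rmin (Im P - c) (d - Im P))).
  assert (R2 := Rmin_r (Rmin (Re P - a) (b - Re P)) (Rmin (Im P - c) (d - Im P))).
  assert (R3 := Rmin_l (Re P - a) (b - Re P)). assert (R4 := Rmin_r (Re P - a) (b - Re P)).
  assert (R5 := Rmin_l (Im P - c) (d - Im P)). assert (R6 := Rmin_r (Im P - c) (d - Im P)).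
  fold r in R1, R2.
  assert (K : forall w, Cmod (w - P) < r -> rect_int_pt a b c d w).
  { intros w Hw.
    assert (X := Rle_lt_trans _ _ _ (re_le_Cmod (w - P)) Hw).
    assert (Y := Rle_lt_trans _ _ _ (Rabs_im_le_Cmod (w - P)) Hw).
    apply Rabs_def2 in X. apply Rabs_def2 in Y. destruct w, P; simpl in *. split; simpl; lra. }
  exists r. split; [unfold r; repeat apply Rmin_pos; lra|]. split; auto.
  intros w [_ Hb]. apply Rnot_lt_le. intros Hw. destruct (K w Hw) as [K1 K2]. lra.
Qed.

(** The list will hold the base points of the difference quotients involved; some punctured disc
    around any point avoids all of them. *)
Lemma punctured_off_list (f : C -> C) (a b c d : R) (l : list C) (P : C) :
  (forall w, rect a b c d w -> ~ In w l -> Cdiff f w) ->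
  rect_int_pt a b c d P -> punctured_diff f P.
Proof.
  intros Hf HP. destruct (rect_interior_disc _ _ _ _ _ HP) as [r [Hr [K _]]].
  assert (S : exists s, 0 < s /\ forall w, 0 < Cmod (w - P) < s -> ~ In w l).
  { clear -l. induction l as [|q l [s [Hs IH]]]; [exists 1; split; [lra|auto]|].
    destruct (Ceq_dec q P) as [->|N].
    - exists s. split; auto. intros w Hw [E|E]; [|now apply (IH w)].
      subst w. rewrite Cmod_sub_diag in Hw. lra.
    - exists (Rmin s (Cmod (q - P))). split; [apply Rmin_pos; [auto|now apply Cmod_sub_gt_0]|].
      intros w [W1 W2] [E|E].
      + subst w. generalize (Rlt_le_trans _ _ _ W2 (Rmin_r _ _)). lra.
      + apply (IH w); auto. split; auto. eapply Rlt_le_trans; [apply W2|apply Rmin_l]. }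
  destruct S as [s [Hs S]]. exists (Rmin r s). split; [now apply Rmin_pos|].
  intros w [W1 W2]. apply Hf.
  - destruct (K w (Rlt_le_trans _ _ _ W2 (Rmin_l _ _))). split; lra.
  - apply S. split; auto. eapply Rlt_le_trans; [apply W2|apply Rmin_r].
Qed.

(* Adding delta |z - P0|^2 to |f|^2 makes the mean over small circles strictly
   larger than the central value, which rules out an interior maximum. *)
Theorem max_principle (f : C -> C) (a b c d M : R) : a <= b -> c <= d ->
  Ccont_rect f a b c d ->
  (forall z, rect_int_pt a b c d z -> punctured_diff f z) ->
  (forall z, rect_bdry a b c d z -> Cmod (f z) <= M) ->
  forall z, rect a b c d z -> Cmod (f z) <= M.
Proof.
  intros Hab Hcd Hc Hp HM P0 HP0. apply Rnot_lt_le. intros HN.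
  assert (HM0 : 0 <= M).
  { apply Rle_trans with (Cmod (f (a, c))); [apply Cmod_ge_0|].
    apply HM. split; [split; simpl; lra|simpl; auto]. }
  set (D := (b - a) + (d - c) + 1).
  assert (HD : 1 <= D) by (unfold D; lra).
  set (N0 := Cmod (f P0)) in *.
  (* As distances in the rectangle are below [D], the perturbation adds at most half of
     [N0^2 - M^2], so the perturbed function still cannot have its maximum on the boundary. *)
  set (dl := (N0 ^ 2 - M ^ 2) / (2 * D ^ 2)).
  assert (Hdl : 0 < dl) by (apply Rdiv_lt_0_compat; nra).
  set (u := fun z => Cmod (f z) ^ 2 + dl * Cmod (z - P0) ^ 2).
  destruct (rect_max u a b c d Hab Hcd) as [P [HP Hmax]].
  { intros z Hz. apply Rcont_plus.
    - apply (Rcont_continuity (fun w => Cmod (f w)) (fun x => x ^ 2)).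
      + apply Rcont_Cmod. auto.
      + apply derivable_continuous_pt, derivable_pt_pow.
    - apply (Rcont_continuity (fun w => Cmod (w - P0)) (fun x => dl * x ^ 2)).
      + apply Rcont_Cmod. apply Ccont_minus; [apply Ccont_id|apply Ccont_const].
      + apply derivable_continuous_pt. apply derivable_pt_scal, derivable_pt_pow. }
  assert (U0 : N0 ^ 2 <= u P).
  { generalize (Hmax P0 HP0). unfold u at 1. fold N0. rewrite Cmod_sub_diag.
    replace (N0 ^ 2 + dl * 0 ^ 2) with (N0 ^ 2) by ring. auto. }
  assert (HPi : rect_int_pt a b c d P).
  { apply rect_not_bdry; auto. intros Hb. specialize (HM P Hb).
    assert (X := rect_diam _ _ _ _ _ _ HP HP0).
    assert (X1 : Cmod (P - P0) ^ 2 <= D ^ 2).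
    { apply pow_incr. split; [apply Cmod_ge_0|unfold D; lra]. }
    assert (X2 : Cmod (f P) ^ 2 <= M ^ 2) by (apply pow_incr; split; [apply Cmod_ge_0|auto]).
    assert (X3 : dl * Cmod (P - P0) ^ 2 <= dl * D ^ 2) by (apply Rmult_le_compat_l; lra).
    assert (X4 : dl * D ^ 2 = (N0 ^ 2 - M ^ 2) / 2) by (unfold dl; field; nra).
    unfold u in U0. nra. }
  destruct (Hp P HPi) as [r1 [Hr1 K1]].
  destruct (rect_interior_disc _ _ _ _ _ HPi) as [r2 [Hr2 [K2 _]]].
  set (r := Rmin r1 r2 / 2).
  assert (Hm : 0 < Rmin r1 r2) by now apply Rmin_pos.
  assert (Hr : 0 < r) by (unfold r; lra).
  assert (L1 : r < r1) by (generalize (Rmin_l r1 r2); unfold r; lra).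
  assert (L2 : r < r2) by (generalize (Rmin_r r1 r2); unfold r; lra).
  assert (Hpi := PI_RGT_0).
  assert (CP : Ccont f P) by now apply Hc.
  assert (Mean := circle_mean f P r Hr ltac:(intros w Hw; apply K1; lra) CP).
  assert (Pf : Pcont_on (fun t => f (circ P r t)) 0 (2 * PI)).
  { intros t _. apply Pcont_comp; [now apply Pcont_circ|].
    apply Cdiff_cont, K1. rewrite Cmod_circ; lra. }
  (* Multiplication by the conjugate makes the mean value [|f P|^2]. Together with
     [2 Re (k f w) <= |f P|^2 + |f w|^2] this replaces the subharmonicity of [|f|^2]. *)
  set (k := Cconj (f P)).
  assert (Mk : CI (fun t => k * f (circ P r t))%C 0 (2 * PI) = (RtoC (2 * PI * Cmod (f P) ^ 2))).
  { rewrite CI_scal by (auto; lra). rewrite Mean, (RtoC_mult (2 * PI) (Cmod (f P) ^ 2)).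
    replace (RtoC (Cmod (f P) ^ 2)) with (f P * k)%C by (symmetry; apply Cmod2_conj). ring. }
  assert (Mk' : RInt (fun t => Re (k * f (circ P r t))) 0 (2 * PI) = 2 * PI * Cmod (f P) ^ 2)
    by exact (f_equal Re Mk).
  set (X := Re (P - P0)). set (Y := Im (P - P0)).
  set (A := 2 * Cmod (f P) ^ 2).
  set (rhs := fun t => A - dl * (2 * r * (X * cos t + Y * sin t) + r ^ 2)).
  assert (I : is_RInt rhs 0 (2 * PI) (2 * PI * A - dl * (2 * PI * r ^ 2))).
  { set (F := fun t => A * t - dl * (2 * r * (X * sin t - Y * cos t) + r ^ 2 * t)).
    replace (2 * PI * A - dl * (2 * PI * r ^ 2)) with (minus (F (2 * PI)) (F 0)).
    - apply (is_RInt_derive (V := R_CompleteNormedModule) F rhs).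
      + intros t _. unfold F, rhs. auto_derive; auto. ring.
      + intros t _. unfold rhs.
        apply (ex_derive_continuous (V := R_NormedModule)). auto_derive. auto.
    - unfold F, minus, plus, opp; simpl. rewrite cos_2PI, sin_2PI, cos_0, sin_0. ring. }
  assert (Pk : Pcont_on (fun t => k * f (circ P r t))%C 0 (2 * PI)).
  { intros t Ht. apply (Pcont_comp (fun w => k * w)%C _ t (Pf t Ht)).
    apply Ccont_mult; [apply Ccont_const|apply Ccont_id]. }
  assert (Ek := Pcont_on_re _ 0 (2 * PI) ltac:(lra) Pk).
  assert (LE : RInt (fun t => 2 * Re (k * f (circ P r t))) 0 (2 * PI) <= RInt rhs 0 (2 * PI)).
  { apply RInt_le; [lra| |eexists; apply I|].
    - apply (ex_RInt_scal (V := R_NormedModule)). exact Ek.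
    - intros t Ht. set (w := circ P r t).
      assert (Hw : rect a b c d w).
      { destruct (K2 w) as [Q1 Q2]; [unfold w; rewrite Cmod_circ; lra|]. split; lra. }
      assert (Uw := Hmax w Hw). unfold u in Uw.
      (* The term linear in [cos t] and [sin t] integrates to zero over the circle, while [r^2]
         survives; multiplied by [dl], it gives the strict inequality. *)
      assert (E1 : Cmod (w - P0) ^ 2 = Cmod (P - P0) ^ 2 + 2 * r * (X * cos t + Y * sin t) + r ^ 2).
      { rewrite !Cmod2_alt. unfold w, circ, X, Y. destruct P as [px py], P0 as [qx qy]. simpl.
        generalize (sin2_cos2 t). unfold Rsqr. intros E.
        replace (r * (r * 1)) with (r * r * (sin t * sin t + cos t * cos t)) by (rewrite E; ring).
        ring. }
      assert (E2 : 2 * Re (k * f w) <= Cmod (f P) ^ 2 + Cmod (f w) ^ 2).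
      { rewrite !Cmod2_alt. unfold k. destruct (f P) as [p1 p2], (f w) as [w1 w2]. simpl.
        generalize (pow2_ge_0 (p1 - w1)) (pow2_ge_0 (p2 - w2)). simpl. lra. }
      unfold rhs, A. fold w. rewrite E1 in Uw. lra. }
  rewrite (is_RInt_unique _ _ _ _ I) in LE.
  assert (S : RInt (fun t => 2 * Re (k * f (circ P r t))) 0 (2 * PI)
    = 2 * RInt (fun t => Re (k * f (circ P r t))) 0 (2 * PI)).
  { apply (RInt_scal (V := R_CompleteNormedModule) _ 0 (2 * PI) 2 Ek). }
  rewrite S, Mk' in LE. unfold A in LE.
  assert (0 < dl * (2 * PI * r ^ 2))
    by (apply Rmult_lt_0_compat; [auto|]; apply Rmult_lt_0_compat; [lra|now apply pow_lt]).
  lra.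
Qed.

(** * Limits of complex sequences *)

Definition Clim (u : nat -> C) (l : C) : Prop :=
  forall e, 0 < e -> exists N, forall n, (N <= n)%nat -> Cmod (u n - l) < e.

Lemma Clim_unique (u : nat -> C) (a b : C) : Clim u a -> Clim u b -> a = b.
Proof.
  intros Ha Hb. apply Ceq_le_eps. intros e He.
  destruct (Ha (e / 2)) as [N1 H1]; [lra|]. destruct (Hb (e / 2)) as [N2 H2]; [lra|].
  specialize (H1 (max N1 N2) ltac:(lia)). specialize (H2 (max N1 N2) ltac:(lia)).
  replace (a - b)%C with ((u (max N1 N2) - b) - (u (max N1 N2) - a))%C by ring.
  eapply Rle_trans; [apply Cmod_triangle_sub|]. lra.
Qed.

Lemma Clim_scal (k : C) (u : nat -> C) (a : C) : Clim u a -> Clim (fun n => k * u n)%C (k * a)%C.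
Proof.
  intros Ha e He. assert (Hk := Cmod_ge_0 k).
  destruct (Ha (e / (Cmod k + 1))) as [N H1]; [apply Rdiv_lt_0_compat; lra|].
  exists N. intros n Hn. specialize (H1 n Hn).
  replace (k * u n - k * a)%C with (k * (u n - a))%C by ring. rewrite Cmod_mult.
  apply Rlt_div_r in H1; [|lra]. assert (X := Cmod_ge_0 (u n - a)). lra.
Qed.

Lemma Clim_ext (u v : nat -> C) (a : C) : (forall n, u n = v n) -> Clim u a -> Clim v a.
Proof.
  intros E H e He. destruct (H e He) as [N K]. exists N. intros n Hn. rewrite <- E. auto.
Qed.

Lemma Clim_plus (u v : nat -> C) (a b : C) : Clim u a -> Clim v b ->
  Clim (fun n => u n + v n)%C (a + b)%C.
Proof.
  intros Ha Hb e He.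
  destruct (Ha (e / 2)) as [N1 H1]; [lra|]. destruct (Hb (e / 2)) as [N2 H2]; [lra|].
  exists (max N1 N2). intros n Hn. specialize (H1 n ltac:(lia)). specialize (H2 n ltac:(lia)).
  replace (u n + v n - (a + b))%C with ((u n - a) + (v n - b))%C by ring.
  eapply Rle_lt_trans; [apply Cmod_triangle|]. lra.
Qed.

Lemma Clim_minus (u v : nat -> C) (a b : C) : Clim u a -> Clim v b ->
  Clim (fun n => u n - v n)%C (a - b)%C.
Proof.
  intros Ha Hb. apply (Clim_ext (fun n => u n + - RtoC 1 * v n)%C); [intros; ring|].
  replace (a - b)%C with (a + - RtoC 1 * b)%C by ring.
  apply Clim_plus; [auto|now apply Clim_scal].
Qed.

Lemma inv_S_small (d : R) : 0 < d -> exists N, forall n, (N <= n)%nat -> / INR (S n) < d.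
Proof.
  intros Hd. destruct (archimed_cor1 d Hd) as [N [H1 H2]]. exists N. intros n Hn.
  eapply Rle_lt_trans; [|apply H1]. apply Rinv_le_contravar; [now apply lt_0_INR|].
  apply le_INR. lia.
Qed.

Lemma Clim_complete (u : nat -> C) :
  (forall e, 0 < e -> exists N, forall n m, (N <= n)%nat -> (N <= m)%nat -> Cmod (u n - u m) < e) ->
  exists l, Clim u l.
Proof.
  intros H.
  assert (HR : ex_finite_lim_seq (fun n => Re (u n))).
  { apply ex_lim_seq_cauchy_corr. intros e. destruct (H e (cond_pos e)) as [N HN].
    exists N. intros n m Hn Hm. eapply Rle_lt_trans; [|apply (HN n m Hn Hm)].
    apply (re_le_Cmod (u n - u m)). }
  assert (HI : ex_finite_lim_seq (fun n => Im (u n))).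
  { apply ex_lim_seq_cauchy_corr. intros e. destruct (H e (cond_pos e)) as [N HN].
    exists N. intros n m Hn Hm. eapply Rle_lt_trans; [|apply (HN n m Hn Hm)].
    apply (Rabs_im_le_Cmod (u n - u m)). }
  destruct HR as [x Hx], HI as [y Hy].
  apply is_lim_seq_spec in Hx. apply is_lim_seq_spec in Hy.
  exists (x, y). intros e He.
  assert (He2 : 0 < e / 2) by lra.
  destruct (Hx (mkposreal _ He2)) as [N1 H1]. destruct (Hy (mkposreal _ He2)) as [N2 H2].
  exists (max N1 N2). intros n Hn.
  specialize (H1 n ltac:(lia)). specialize (H2 n ltac:(lia)). simpl in H1, H2.
  eapply Rle_lt_trans; [apply Cmod_le_abs|]. destruct (u n). simpl in *.
  unfold Rminus in *. lra.
Qed.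

Lemma Clim_bound (u : nat -> C) (l z : C) (B : R) (N : nat) : Clim u l ->
  (forall n, (N <= n)%nat -> Cmod (z - u n) <= B) -> Cmod (z - l) <= B.
Proof.
  intros H HB. apply le_epsilon. intros e He. destruct (H e He) as [N' H'].
  specialize (H' (max N N') ltac:(lia)). specialize (HB (max N N') ltac:(lia)).
  replace (z - l)%C with ((z - u (max N N')) + (u (max N N') - l))%C by ring.
  eapply Rle_trans; [apply Cmod_triangle|]. lra.
Qed.

(** * Difference quotients *)

Definition dquot (f : C -> C) (z l w : C) : C :=
  if Ceq_dec w z then l else ((f w - f z) / (w - z))%C.

Lemma dquot_diag (f : C -> C) (z l : C) : dquot f z l z = l.
Proof. unfold dquot. destruct (Ceq_dec z z); congruence. Qed.

Lemma dquot_off (f : C -> C) (z l w : C) : w <> z ->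
  dquot f z l w = ((f w - f z) / (w - z))%C.
Proof. intros. unfold dquot. destruct (Ceq_dec w z); congruence. Qed.

Lemma dquot_eq (f : C -> C) (z l w : C) : f w = (f z + dquot f z l w * (w - z))%C.
Proof.
  unfold dquot. destruct (Ceq_dec w z) as [->|N]; [ring|].
  field. now apply Csub_neq_0.
Qed.

Lemma dquot_cont_diag (f : C -> C) (z l : C) : Cder f z l -> Ccont (dquot f z l) z.
Proof.
  intros [q [Hl [Hq E]]]. apply (Ccont_ext q); auto. intros w. unfold dquot.
  destruct (Ceq_dec w z) as [->|N]; auto. rewrite (E w). field. now apply Csub_neq_0.
Qed.

Lemma dquot_cont_Cder (f : C -> C) (z l : C) : Ccont (dquot f z l) z -> Cder f z l.
Proof.
  intros H. exists (dquot f z l). split; [apply dquot_diag|split; [auto|]].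
  intros w. apply dquot_eq.
Qed.

Lemma dquot_diff_off (f : C -> C) (z l w : C) : w <> z -> Cdiff f w -> Cdiff (dquot f z l) w.
Proof.
  intros N Hf. apply (Cdiff_ext_loc (fun w => (f w - f z) / (w - z))%C _ w (Cmod (w - z))).
  - now apply Cmod_sub_gt_0.
  - intros v Hv. rewrite dquot_off; auto. intros ->. rewrite Cmod_sub_sym in Hv. lra.
  - apply Cdiff_div.
    + apply Cdiff_minus; [auto|apply Cdiff_const].
    + apply Cdiff_minus; [apply Cdiff_id|apply Cdiff_const].
    + now apply Csub_neq_0.
Qed.

Lemma dquot_cont (f : C -> C) (z l w : C) : Cder f z l -> Cdiff f w -> Ccont (dquot f z l) w.
Proof.
  intros Hz Hw. destruct (Ceq_dec w z) as [->|N]; [now apply dquot_cont_diag|].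
  now apply Cdiff_cont, dquot_diff_off.
Qed.

Lemma rect_bounded (f : C -> C) (a b c d : R) : a <= b -> c <= d -> Ccont_rect f a b c d ->
  exists B, 0 <= B /\ forall z, rect a b c d z -> Cmod (f z) <= B.
Proof.
  intros Hab Hcd H. destruct (rect_max (fun z => Cmod (f z)) a b c d Hab Hcd) as [P [HP K]].
  - intros z Hz. now apply Rcont_Cmod, H.
  - exists (Cmod (f P)). split; [apply Cmod_ge_0|auto].
Qed.

Definition dquot2 (f f' : C -> C) (z z' w : C) : C :=
  ((dquot f z (f' z) w - dquot f z' (f' z') w) / (z - z'))%C.

(** For [w] away from [z] and [z'], the right-hand side depends on [z'] only through [w - z'] and
    the value at [z'] of a function continuous at [z]; hence the uniform convergence on the boundary
    as [z'] tends to [z]. *)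
Lemma dquot2_bdry (f f' : C -> C) (z z' w : C) : w <> z -> w <> z' -> z <> z' ->
  dquot2 f f' z z' w =
  ((f w - f z - dquot f z (f' z) z' * (w - z)) / ((w - z) * (w - z')))%C.
Proof.
  intros H1 H2 H3. unfold dquot2.
  rewrite !dquot_off by auto.
  field. repeat split; apply Csub_neq_0; auto.
Qed.

(** At [w = z] the second quotient becomes the difference quotient of [dquot f z (f' z)] at its own
    base point, the quantity whose limit is wanted. *)
Lemma dquot2_diag (f f' : C -> C) (z z' : C) : z <> z' ->
  dquot2 f f' z z' z = ((dquot f z (f' z) z' - f' z) / (z' - z))%C.
Proof.
  intros H. unfold dquot2. rewrite dquot_diag, !dquot_off by auto.
  field. repeat split; apply Csub_neq_0; auto.
Qed.

(* The second difference quotients k(w) = (q_z(w) - q_{z'}(w)) / (z - z') are,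
   away from the diagonal, explicit functions that converge uniformly on the boundary
   as z' -> z.  By the maximum principle they converge at w = z too, which says
   that q_z is differentiable at z. *)
Theorem dquot_diff_diag (f : C -> C) (a b c d : R) (z l : C) :
  rect_int_pt a b c d z -> (forall w, rect a b c d w -> Cdiff f w) ->
  Cder f z l -> Cdiff (dquot f z l) z.
Proof.
  intros Hz Hf Hl.
  (* Derivatives are chosen at all points because [dquot2] involves a varying second base point; at
     [z] the given [l] is kept. *)
  destruct (choice (fun w m => rect a b c d w -> Cder f w m)) as [f0 Hf0].
  { intros w. destruct (classic (rect a b c d w)) as [R|R].
    - destruct (Hf w R) as [m Hm]. now exists m.
    - exists l. tauto. }
  set (f' := fun w => if Ceq_dec w z then l else f0 w).
  assert (Hf' : forall w, rect a b c d w -> Cder f w (f' w)).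
  { intros w Hw. unfold f'. destruct (Ceq_dec w z) as [->|N]; auto. }
  assert (Ez : f' z = l) by (unfold f'; destruct (Ceq_dec z z); congruence).
  clearbody f'. clear f0 Hf0. rewrite <- Ez in *. clear l Ez.
  assert (Hab : a <= b /\ c <= d) by (destruct Hz; lra). destruct Hab as [Hab Hcd].
  assert (Hfc : Ccont_rect f a b c d) by (intros w Hw; now apply Cdiff_cont, Hf).
  destruct (rect_interior_disc _ _ _ _ _ Hz) as [s [Hs [S1 S2]]].
  destruct (rect_bounded f a b c d Hab Hcd Hfc) as [B [HB0 HB]].
  set (q := dquot f z (f' z)) in *.
  assert (Hq : Ccont q z) by now apply dquot_cont_diag.
  set (A := (2 * B / s + Cmod (f' z) + 1) * (4 / s ^ 2)).
  assert (HA : 0 < A).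
  { unfold A. apply Rmult_lt_0_compat; [|apply Rdiv_lt_0_compat; [lra|nra]].
    generalize (Cmod_ge_0 (f' z)). assert (0 <= 2 * B / s) by (apply Rdiv_le_0_compat; lra). lra. }
  assert (Cau : forall e, 0 < e -> exists dl, 0 < dl /\ forall z1 z2,
    0 < Cmod (z1 - z) < dl -> 0 < Cmod (z2 - z) < dl ->
    Cmod (dquot2 f f' z z1 z - dquot2 f f' z z2 z) <= e).
  { intros e He.
    (* On the boundary the tolerance [e s / 8] bounds one part of the difference below by [e / 2],
       the radius [e / (4 A)] the other. Radius [s / 2] keeps [z1] and [z2] at distance [s / 2] from
       the boundary, and 1 bounds [q z1]. *)
    destruct (Hq (Rmin 1 (e * s / 8))) as [d1 [Hd1 K1]].
    { apply Rmin_pos; [lra|]. assert (0 < e * s) by now apply Rmult_lt_0_compat. lra. }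
    set (dl := Rmin d1 (Rmin (s / 2) (e / (4 * A)))).
    assert (D1 : dl <= d1) by apply Rmin_l.
    assert (D23 := Rmin_r d1 (Rmin (s / 2) (e / (4 * A)))). fold dl in D23.
    assert (D2 := Rle_trans _ _ _ D23 (Rmin_l _ _)).
    assert (D3 := Rle_trans _ _ _ D23 (Rmin_r _ _)).
    exists dl. split.
    { unfold dl. apply Rmin_pos; [auto|]. apply Rmin_pos; [lra|]. apply Rdiv_lt_0_compat; lra. }
    intros z1 z2 H1 H2.
    assert (N1 : z <> z1) by (intros <-; rewrite Cmod_sub_diag in H1; lra).
    assert (N2 : z <> z2) by (intros <-; rewrite Cmod_sub_diag in H2; lra).
    assert (R1 : rect a b c d z1) by (destruct (S1 z1) as [Q1 Q2]; [lra|split; lra]).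
    assert (R2 : rect a b c d z2) by (destruct (S1 z2) as [Q1 Q2]; [lra|split; lra]).
    assert (Rz : rect a b c d z) by (destruct Hz; split; lra).
    set (k := fun w => (dquot2 f f' z z1 w - dquot2 f f' z z2 w)%C).
    change (Cmod (k z) <= e).
    apply (max_principle k a b c d e Hab Hcd); auto.
    - intros w Hw. unfold k, dquot2.
      apply Ccont_minus; apply Ccont_div; try apply Ccont_const;
        try (apply Csub_neq_0; auto); apply Ccont_minus; apply dquot_cont; auto.
    - intros w Hw. apply (punctured_off_list k a b c d (z :: z1 :: z2 :: nil)); auto.
      intros v Hv Hn. simpl in Hn.
      assert (z <> v /\ z1 <> v /\ z2 <> v) as (V1 & V2 & V3) by tauto.
      unfold k, dquot2.
      apply Cdiff_minus; apply Cdiff_div; try apply Cdiff_const;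
        try (apply Csub_neq_0; auto); apply Cdiff_minus; apply dquot_diff_off; auto.
    - intros w Hw. assert (W := S2 w Hw).
      assert (T1 : s / 2 <= Cmod (w - z1)).
      { replace (w - z1)%C with ((w - z) - (z1 - z))%C by ring.
        generalize (Cmod_triangle_rev (w - z) (z1 - z)). lra. }
      assert (T2 : s / 2 <= Cmod (w - z2)).
      { replace (w - z2)%C with ((w - z) - (z2 - z))%C by ring.
        generalize (Cmod_triangle_rev (w - z) (z2 - z)). lra. }
      assert (V0 : w <> z) by (intros ->; rewrite Cmod_sub_diag in W; lra).
      assert (V1 : w <> z1) by (intros ->; rewrite Cmod_sub_diag in T1; lra).
      assert (V2 : w <> z2) by (intros ->; rewrite Cmod_sub_diag in T2; lra).
      unfold k. rewrite !dquot2_bdry by auto. fold q.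
      assert (M0 := Csub_neq_0 _ _ V0). assert (M1 := Csub_neq_0 _ _ V1).
      assert (M2 := Csub_neq_0 _ _ V2).
      (* The first summand carries the factor [z1 - z2], the second the factor [q z2 - q z1]; both
         are small near [z] by continuity of [q]. *)
      replace ((f w - f z - q z1 * (w - z)) / ((w - z) * (w - z1))
          - (f w - f z - q z2 * (w - z)) / ((w - z) * (w - z2)))%C
        with (((f w - f z) / (w - z) - q z1) * ((z1 - z) - (z2 - z)) / ((w - z1) * (w - z2))
          + ((q z2 - q z) - (q z1 - q z)) / (w - z2))%C by (field; auto).
      assert (Qz : q z = f' z) by apply dquot_diag.
      assert (Q1 := K1 z1 ltac:(lra)). assert (Q2 := K1 z2 ltac:(lra)).
      assert (Mi := Rmin_l 1 (e * s / 8)). assert (Mi' := Rmin_r 1 (e * s / 8)).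
      assert (Bq : Cmod (q z1) <= Cmod (f' z) + 1).
      { rewrite <- Qz. replace (q z1) with ((q z1 - q z) + q z)%C by ring.
        generalize (Cmod_triangle (q z1 - q z) (q z)). lra. }
      assert (Bf : Cmod ((f w - f z) / (w - z)) <= 2 * B / s).
      { rewrite Cmod_div by auto. apply Rdiv_le_compat; try apply Cmod_ge_0; try lra.
        eapply Rle_trans; [apply Cmod_triangle_sub|].
        assert (X1 := HB w (proj1 Hw)). assert (X2 := HB z Rz). lra. }
      eapply Rle_trans; [apply Cmod_triangle|].
      rewrite !Cmod_div by (auto; apply Cmult_neq_0; auto). rewrite !Cmod_mult.
      assert (G1 := Cmod_triangle_sub ((f w - f z) / (w - z)) (q z1)).
      assert (G2 := Cmod_triangle_sub (z1 - z) (z2 - z)).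
      assert (G3 := Cmod_triangle_sub (q z2 - q z) (q z1 - q z)).
      assert (F1 : Cmod ((f w - f z) / (w - z) - q z1) * Cmod (z1 - z - (z2 - z))
          / (Cmod (w - z1) * Cmod (w - z2))
        <= (2 * B / s + Cmod (f' z) + 1) * (2 * dl) / (s / 2 * (s / 2))).
      { apply Rdiv_le_compat.
        - apply Rmult_le_pos; apply Cmod_ge_0.
        - apply Rmult_le_compat; try apply Cmod_ge_0; lra.
        - nra.
        - apply Rmult_le_compat; lra. }
      assert (F2 : Cmod (q z2 - q z - (q z1 - q z)) / Cmod (w - z2) <= (e * s / 4) / (s / 2)).
      { apply Rdiv_le_compat; try apply Cmod_ge_0; lra. }
      assert (F3 : (2 * B / s + Cmod (f' z) + 1) * (2 * dl) / (s / 2 * (s / 2)) = 2 * (A * dl))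
        by (unfold A; field; lra).
      assert (F4 : e * s / 4 / (s / 2) = e / 2) by (field; lra).
      assert (F5 : A * dl <= e / 4).
      { apply Rle_trans with (A * (e / (4 * A))); [apply Rmult_le_compat_l; lra|].
        right. field. lra. }
      lra. }
  (* One particular sequence tending to [z] produces the limit [m]; [Cau] then extends the
     convergence to all [w]. *)
  set (zn := fun n : nat => (z + RtoC (s / (INR n + 2)))%C).
  assert (Zn : forall n, Cmod (zn n - z) = s / (INR n + 2)).
  { intros n. unfold zn. replace (z + RtoC (s / (INR n + 2)) - z)%C with (RtoC (s / (INR n + 2))) by ring.
    rewrite Cmod_R. apply Rabs_right. left. apply Rdiv_lt_0_compat; auto. generalize (pos_INR n); lra. }
  assert (Zs : forall dl, 0 < dl -> exists N, forall n, (N <= n)%nat -> 0 < Cmod (zn n - z) < dl).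
  { intros dl Hdl. destruct (INR_archimed dl s Hdl) as [N HN]. exists N. intros n Hn.
    rewrite Zn. apply le_INR in Hn. assert (P := pos_INR n). assert (P' := pos_INR N).
    split; [apply Rdiv_lt_0_compat; lra|]. apply Rlt_div_l; [lra|].
    assert (INR N * dl <= INR n * dl) by (apply Rmult_le_compat_r; lra). lra. }
  destruct (Clim_complete (fun n => dquot2 f f' z (zn n) z)) as [m Hm].
  { intros e He. destruct (Cau (e / 2)) as [dl [Hdl K]]; [lra|].
    destruct (Zs dl Hdl) as [N HN]. exists N. intros n n' Hn Hn'.
    eapply Rle_lt_trans; [apply K; auto|]. lra. }
  exists m. apply dquot_cont_Cder. intros e He.
  destruct (Cau (e / 2)) as [dl [Hdl K]]; [lra|]. destruct (Zs dl Hdl) as [N HN].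
  exists dl. split; auto. intros w Hw. rewrite dquot_diag.
  destruct (Ceq_dec w z) as [->|Nw]; [rewrite dquot_diag, Cmod_sub_diag; lra|].
  rewrite dquot_off by auto.
  assert (E : ((q w - q z) / (w - z))%C = dquot2 f f' z w z).
  { rewrite dquot2_diag by auto. unfold q at 2. now rewrite dquot_diag. }
  rewrite E. apply Rle_lt_trans with (e / 2); [|lra].
  apply (Clim_bound _ _ _ _ N Hm). intros n Hn. apply K; auto.
  split; auto. now apply Cmod_sub_gt_0.
Qed.

(** * Limits and zeros of holomorphic functions *)

Lemma max_principle_diff (f : C -> C) (a b c d M : R) : a <= b -> c <= d ->
  (forall z, rect a b c d z -> Cdiff f z) ->
  (forall z, rect_bdry a b c d z -> Cmod (f z) <= M) ->
  forall z, rect a b c d z -> Cmod (f z) <= M.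
Proof.
  intros Hab Hcd Hf. apply max_principle; auto.
  - intros z Hz. now apply Cdiff_cont, Hf.
  - intros z Hz. apply (punctured_off_list f a b c d nil); auto.
Qed.

(** Phrased without a limit function, so that the maximum principle can be applied to [f n - f m]
    before any limit is known to exist. *)
Definition unif_cauchy (U : C -> Prop) (f : nat -> C -> C) : Prop :=
  forall e, 0 < e -> exists N, forall n m, (N <= n)%nat -> (N <= m)%nat ->
    forall z, U z -> Cmod (f n z - f m z) <= e.

Lemma unif_cauchy_lim (U : C -> Prop) (f : nat -> C -> C) (z : C) :
  unif_cauchy U f -> U z -> exists l, Clim (fun n => f n z) l.
Proof.
  intros H Hz. apply Clim_complete. intros e He. destruct (H (e / 2)) as [N HN]; [lra|].
  exists N. intros n m Hn Hm. specialize (HN n m Hn Hm z Hz). lra.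
Qed.

Lemma unif_cauchy_rect (f : nat -> C -> C) (a b c d : R) : a <= b -> c <= d ->
  (forall n z, rect a b c d z -> Cdiff (f n) z) ->
  unif_cauchy (rect_bdry a b c d) f -> unif_cauchy (rect a b c d) f.
Proof.
  intros Hab Hcd Hf H e He. destruct (H e He) as [N HN]. exists N. intros n m Hn Hm.
  apply (max_principle_diff (fun z => f n z - f m z)%C); auto.
  intros z Hz. apply Cdiff_minus; auto.
Qed.

(** The difference quotients of the [f n] at [z] are uniformly Cauchy on the boundary, hence inside,
    including at [z], by the maximum principle. Their limit is therefore continuous at [z], and off
    [z] it is the difference quotient of [F]. *)
Theorem weierstrass_diff (f : nat -> C -> C) (F : C -> C) (a b c d : R) (z : C) :
  (forall n w, rect a b c d w -> Cdiff (f n) w) ->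
  unif_cauchy (rect_bdry a b c d) f ->
  (forall w, rect a b c d w -> Clim (fun n => f n w) (F w)) ->
  rect_int_pt a b c d z -> Cdiff F z.
Proof.
  intros Hf Hb HF Hz.
  assert (Hab : a <= b /\ c <= d) by (destruct Hz; lra). destruct Hab as [Hab Hcd].
  assert (Rz : rect a b c d z) by (destruct Hz; split; lra).
  destruct (rect_interior_disc _ _ _ _ _ Hz) as [s [Hs [S1 S2]]].
  destruct (choice (fun n l => Cder (f n) z l)) as [l Hl].
  { intros n. apply Hf, Rz. }
  set (q := fun n => dquot (f n) z (l n)).
  assert (Hq : unif_cauchy (rect a b c d) q).
  { intros e He. destruct (unif_cauchy_rect f a b c d Hab Hcd Hf Hb (e * s / 2)) as [N HN].
    { assert (0 < e * s) by now apply Rmult_lt_0_compat. lra. }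
    exists N. intros n m Hn Hm.
    apply (max_principle (fun w => q n w - q m w)%C); auto.
    - intros w Hw. apply Ccont_minus; apply dquot_cont; auto.
    - intros w Hw. apply (punctured_off_list _ a b c d (z :: nil)); auto.
      intros v Hv Hnv. simpl in Hnv.
      apply Cdiff_minus; apply dquot_diff_off; auto; intros ->; tauto.
    - intros w Hw. assert (W := S2 w Hw).
      assert (V : w <> z) by (intros ->; rewrite Cmod_sub_diag in W; lra).
      unfold q. rewrite !dquot_off by auto. assert (V' := Csub_neq_0 _ _ V).
      replace ((f n w - f n z) / (w - z) - (f m w - f m z) / (w - z))%C
        with (((f n w - f m w) - (f n z - f m z)) / (w - z))%C by (field; auto).
      rewrite Cmod_div by auto. apply Rle_div_l; [lra|].
      eapply Rle_trans; [apply Cmod_triangle_sub|].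
      assert (X1 := HN n m Hn Hm w (proj1 Hw)). assert (X2 := HN n m Hn Hm z Rz).
      assert (e * s <= e * Cmod (w - z)) by (apply Rmult_le_compat_l; lra). lra. }
  destruct (unif_cauchy_lim _ q z Hq Rz) as [L HL].
  assert (HQ : forall w, rect a b c d w -> Clim (fun n => q n w) (dquot F z L w)).
  { intros w Hw. destruct (Ceq_dec w z) as [->|Nw]; [now rewrite dquot_diag|].
    rewrite dquot_off by auto.
    apply (Clim_ext (fun n => / (w - z) * (f n w - f n z))%C).
    - intros n. unfold q. rewrite dquot_off by auto. unfold Cdiv. ring.
    - replace ((F w - F z) / (w - z))%C with (/ (w - z) * (F w - F z))%C by (unfold Cdiv; ring).
      apply Clim_scal, Clim_minus; auto. }
  exists L. apply dquot_cont_Cder. intros e He. rewrite dquot_diag.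
  destruct (Hq (e / 4)) as [N HN]; [lra|].
  destruct (dquot_cont_diag (f N) z (l N) (Hl N) (e / 4)) as [dl [Hdl K]]; [lra|].
  exists (Rmin dl s). split; [now apply Rmin_pos|]. intros w Hw.
  specialize (K w (Rlt_le_trans _ _ _ Hw (Rmin_l _ _))).
  assert (Rw : rect a b c d w).
  { destruct (S1 w (Rlt_le_trans _ _ _ Hw (Rmin_r _ _))). split; lra. }
  assert (B1 := Clim_bound _ _ (q N w) (e / 4) N (HQ w Rw)).
  specialize (B1 ltac:(intros n Hn; apply HN; auto)).
  assert (B2 := Clim_bound _ _ (q N z) (e / 4) N HL).
  specialize (B2 ltac:(intros n Hn; apply HN; auto)).
  fold (q N) in K.
  replace (dquot F z L w - L)%C
    with (((q N w - q N z) - (q N w - dquot F z L w)) + (q N z - L))%C by ring.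
  assert (T1 := Cmod_triangle ((q N w - q N z) - (q N w - dquot F z L w)) (q N z - L)).
  assert (T2 := Cmod_triangle_sub (q N w - q N z) (q N w - dquot F z L w)). lra.
Qed.

Lemma strip_max (f : C -> C) (eta M T : R) : 0 < eta ->
  (forall z, Rabs (Im z) <= eta -> Cdiff f z) ->
  (forall z, Rabs (Im z) = eta -> Cmod (f z) <= M) ->
  (forall z, Rabs (Im z) <= eta -> T <= Rabs (Re z) -> Cmod (f z) <= M) ->
  forall z, Rabs (Im z) <= eta -> Cmod (f z) <= M.
Proof.
  intros He Hf Hb HT z Hz.
  (* The rectangle of half-width [S] contains [z], and its vertical sides lie where the bound is
     assumed. *)
  set (S := Rmax (Rabs T) (Rabs (Re z))).
  assert (S1 : Rabs T <= S) by apply Rmax_l. assert (S2 : Rabs (Re z) <= S) by apply Rmax_r.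
  assert (S0 := Rabs_pos T). assert (S3 := Rle_abs T).
  apply (max_principle_diff f (- S) S (- eta) eta); try lra.
  - intros w [_ W]. apply Hf. now apply Rabs_le.
  - intros w [[W1 W2] Hw].
    assert (W3 : Rabs (Im w) <= eta) by now apply Rabs_le.
    destruct Hw as [E|[E|[E|E]]].
    + apply HT; auto. rewrite E, Rabs_Ropp, Rabs_right; lra.
    + apply HT; auto. rewrite E, Rabs_right; lra.
    + apply Hb. rewrite E, Rabs_Ropp, Rabs_right; lra.
    + apply Hb. rewrite E, Rabs_right; lra.
  - split; apply Rabs_le_between; auto.
Qed.

Definition square (p : C) (r : R) : C -> Prop := rect (Re p - r) (Re p + r) (Im p - r) (Im p + r).

Lemma square_int (p : C) (r : R) : 0 < r ->
  rect_int_pt (Re p - r) (Re p + r) (Im p - r) (Im p + r) p.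
Proof. intros H. split; lra. Qed.

Lemma square_le (p : C) (r : R) (w : C) : square p r w -> Cmod (w - p) <= 2 * r.
Proof.
  intros [H1 H2]. eapply Rle_trans; [apply Cmod_le_abs|]. destruct w, p; simpl in *.
  replace (2 * r) with (r + r) by ring. apply Rplus_le_compat; apply Rabs_le; lra.
Qed.

Lemma square_bdry_ge (p : C) (r : R) (w : C) :
  rect_bdry (Re p - r) (Re p + r) (Im p - r) (Im p + r) w -> r <= Cmod (w - p).
Proof.
  intros [[W1 W2] H].
  assert (X := re_le_Cmod (w - p)). assert (Y := Rabs_im_le_Cmod (w - p)).
  assert (X1 := Rle_abs (Re (w - p))). assert (Y1 := Rle_abs (Im (w - p))).
  assert (X2 := Rle_abs (- Re (w - p))). assert (Y2 := Rle_abs (- Im (w - p))).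
  rewrite Rabs_Ropp in X2, Y2. destruct w, p; simpl in *.
  destruct H as [E|[E|[E|E]]]; lra.
Qed.

Lemma square_mem (p : C) (r : R) (w : C) : Cmod (w - p) <= r -> square p r w.
Proof.
  intros H. assert (X := re_le_Cmod (w - p)). assert (Y := Rabs_im_le_Cmod (w - p)).
  destruct w, p; simpl in *. split; simpl.
  - assert (Z : Rabs (r0 + - r2) <= r) by lra. apply Rabs_le_between in Z. lra.
  - assert (Z : Rabs (r1 + - r3) <= r) by lra. apply Rabs_le_between in Z. lra.
Qed.

(** Removable singularities: the cofactor is the difference quotient at [p], and differentiability
    at [p] itself is [dquot_diff_diag]. *)
Lemma Cdiff_divide (f : C -> C) (p : C) (r : R) : 0 < r -> f p = RtoC 0 ->
  (forall w, square p r w -> Cdiff f w) ->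
  exists h, (forall w, f w = ((w - p) * h w)%C) /\ (forall w, square p r w -> Cdiff h w).
Proof.
  intros Hr H0 Hf.
  destruct (Hf p) as [l Hl]; [split; lra|].
  exists (dquot f p l). split.
  - intros w. rewrite (dquot_eq f p l w), H0. ring.
  - intros w Hw. destruct (Ceq_dec w p) as [->|N].
    + now apply (dquot_diff_diag f _ _ _ _ p l (square_int p r Hr) Hf).
    + apply dquot_diff_off; auto.
Qed.

Lemma entire_divide (f : C -> C) (p : C) : (forall w, Cdiff f w) -> f p = RtoC 0 ->
  exists h, (forall w, f w = ((w - p) * h w)%C) /\ (forall w, Cdiff h w).
Proof.
  intros Hf H0. destruct (Hf p) as [l Hl].
  exists (dquot f p l). split.
  - intros w. rewrite (dquot_eq f p l w), H0. ring.
  - intros w. destruct (Ceq_dec w p) as [->|N].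
    + apply (dquot_diff_diag f _ _ _ _ p l (square_int p 1 Rlt_0_1)); auto.
    + apply dquot_diff_off; auto.
Qed.

(** If zeros accumulated at [p], every power of [w - p] would divide [G]. The maximum principle for
    the cofactors on a large square then bounds any value [G z0] by [B / 2^n] for all [n]. *)
Theorem entire_zero_isolated (G : C -> C) (p : C) : (forall w, Cdiff G w) ->
  (exists z, G z <> RtoC 0) ->
  exists r, 0 < r /\ forall z, 0 < Cmod (z - p) < r -> G z <> RtoC 0.
Proof.
  intros HG [z0 Hz0]. apply Classical_Prop.NNPP. intros HN. apply Hz0.
  assert (D : forall n : nat, exists h, (forall w, G w = ((w - p) ^ n * h w)%C) /\ (forall w, Cdiff h w)).
  { induction n as [|n [h [E Hh]]].
    - exists G. split; auto. intros w. simpl. ring.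
    - destruct (Ceq_dec (h p) 0) as [Z|NZ].
      + destruct (entire_divide h p Hh Z) as [k [Ek Hk]]. exists k. split; auto.
        intros w. rewrite (E w), (Ek w). simpl. ring.
      + exfalso. apply HN.
        destruct (Ccont_neq_0 h p (Cdiff_cont _ _ (Hh p)) NZ) as [d [Hd K]].
        exists d. split; auto. intros z [Z1 Z2]. rewrite (E z).
        apply Cmult_neq_0; [|now apply K].
        apply Cpow_nz. now apply Cmod_gt_0. }
  set (rho := Cmod (z0 - p)). assert (Hrho := Cmod_ge_0 (z0 - p)). fold rho in Hrho.
  (* More than twice [rho], so that [(rho / r)^n <= 2^(-n)]; the summand 1 keeps the square
     nondegenerate when [z0 = p]. *)
  set (r := 2 * rho + 1). assert (Hr : 0 < r) by (unfold r; lra).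
  destruct (rect_bounded G (Re p - r) (Re p + r) (Im p - r) (Im p + r)) as [B [HB0 HB]]; try lra.
  { intros w _. apply Cdiff_cont, HG. }
  apply Cmod_eq_0. apply Rle_antisym; [|apply Cmod_ge_0].
  apply le_epsilon. intros e He. rewrite Rplus_0_l.
  destruct (pow_half_small B e He) as [n Hn].
  destruct (D n) as [h [E Hh]].
  assert (Bh : Cmod (h z0) <= B / r ^ n).
  { apply (max_principle_diff h (Re p - r) (Re p + r) (Im p - r) (Im p + r)); try lra; auto.
    - intros w Hw. assert (W := square_bdry_ge p r w Hw).
      assert (X := HB w (proj1 Hw)). rewrite (E w), Cmod_mult, Cmod_pow in X.
      apply Rle_div_r; [now apply pow_lt|].
      eapply Rle_trans; [|apply X]. rewrite Rmult_comm. apply Rmult_le_compat_r; [apply Cmod_ge_0|].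
      apply pow_incr. lra.
    - apply square_mem. fold rho. unfold r. lra. }
  rewrite (E z0), Cmod_mult, Cmod_pow. fold rho.
  apply Rle_trans with (B / 2 ^ n); [|lra].
  apply Rle_trans with (rho ^ n * (B / r ^ n)).
  { apply Rmult_le_compat_l; [now apply pow_le|auto]. }
  apply (Rmult_le_reg_r (2 ^ n)); [apply pow_lt; lra|].
  replace (B / 2 ^ n * 2 ^ n) with B by (field; apply pow_nonzero; lra).
  replace (rho ^ n * (B / r ^ n) * 2 ^ n) with (B * ((2 * rho) ^ n / r ^ n)).
  - rewrite <- (Rmult_1_r B) at 2. apply Rmult_le_compat_l; auto.
    apply Rle_div_l; [now apply pow_lt|]. rewrite Rmult_1_l. apply pow_incr. unfold r. lra.
  - rewrite Rpow_mult_distr. field. apply pow_nonzero. lra.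
Qed.

(** * Unordered sums *)

Definition Rsum (f : R -> R) (l : list R) : R := fold_right (fun a acc => f a + acc) 0 l.

Lemma Rsum_perm (f : R -> R) (l l' : list R) : Permutation l l' -> Rsum f l = Rsum f l'.
Proof. induction 1; simpl; try lra; congruence. Qed.

Lemma Csum_perm (F : R -> C) (l l' : list R) : Permutation l l' -> Csum F l = Csum F l'.
Proof. induction 1; simpl; auto; try congruence; try ring. Qed.

Lemma Rsum_app (f : R -> R) (l l' : list R) : Rsum f (l ++ l') = Rsum f l + Rsum f l'.
Proof. induction l; simpl; [ring|]. rewrite IHl. ring. Qed.

Lemma Csum_app (F : R -> C) (l l' : list R) : Csum F (l ++ l') = (Csum F l + Csum F l')%C.
Proof. induction l; simpl; [ring|]. rewrite IHl. ring. Qed.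

Lemma Rsum_nonneg (f : R -> R) (l : list R) : (forall a, In a l -> 0 <= f a) -> 0 <= Rsum f l.
Proof.
  induction l; intros H; simpl; [lra|].
  apply Rplus_le_le_0_compat; [apply H; now left|]. apply IHl. intros b Hb; apply H; now right.
Qed.

Lemma Rsum_le (f g : R -> R) (l : list R) :
  (forall a, In a l -> f a <= g a) -> Rsum f l <= Rsum g l.
Proof.
  induction l; intros H; simpl; [lra|].
  apply Rplus_le_compat; [apply H; now left|]. apply IHl. intros b Hb; apply H; now right.
Qed.

Lemma Rsum_scal (k : R) (f : R -> R) (l : list R) : Rsum (fun a => k * f a) l = k * Rsum f l.
Proof. induction l; simpl; [ring|]. rewrite IHl. ring. Qed.

Lemma Csum_minus (F G : R -> C) (l : list R) :
  Csum (fun a => F a - G a)%C l = (Csum F l - Csum G l)%C.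
Proof. induction l; simpl; [ring|]. rewrite IHl. ring. Qed.

Lemma Csum_scal (k : C) (F : R -> C) (l : list R) :
  Csum (fun a => k * F a)%C l = (k * Csum F l)%C.
Proof. induction l; simpl; [ring|]. rewrite IHl. ring. Qed.

Lemma Csum_ext (F G : R -> C) (l : list R) :
  (forall a, In a l -> F a = G a) -> Csum F l = Csum G l.
Proof.
  induction l; intros H; simpl; auto.
  rewrite H by now left. rewrite IHl; auto. intros b Hb; apply H; now right.
Qed.

Lemma Cmod_Csum_le (F : R -> C) (l : list R) : Cmod (Csum F l) <= Rsum (fun a => Cmod (F a)) l.
Proof.
  induction l; simpl; [rewrite Cmod_0; lra|].
  eapply Rle_trans; [apply Cmod_triangle|]. lra.
Qed.

Lemma Re_Csum (F : R -> C) (l : list R) : Re (Csum F l) = Rsum (fun a => Re (F a)) l.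
Proof. induction l; simpl; auto. unfold Re in *. simpl. now rewrite IHl. Qed.

Lemma Im_Csum (F : R -> C) (l : list R) : Im (Csum F l) = Rsum (fun a => Im (F a)) l.
Proof. induction l; simpl; auto. unfold Im in *. simpl. now rewrite IHl. Qed.

Lemma filter_perm {A : Type} (p : A -> bool) (l : list A) :
  Permutation (filter p l ++ filter (fun a => negb (p a)) l) l.
Proof.
  induction l as [|a l IH]; simpl; auto. destruct (p a); simpl.
  - now constructor.
  - rewrite <- Permutation_middle. now constructor.
Qed.

Definition inb (l : list R) (a : R) : bool := if in_dec Req_EM_T a l then true else false.

Lemma inb_true (l : list R) (a : R) : inb l a = true <-> In a l.
Proof. unfold inb. destruct (in_dec Req_EM_T a l); split; auto; discriminate. Qed.

Lemma inb_false (l : list R) (a : R) : negb (inb l a) = true <-> ~ In a l.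
Proof. unfold inb. destruct (in_dec Req_EM_T a l); simpl; split; auto; try discriminate; tauto. Qed.

Definition ldiff (l l0 : list R) : list R := filter (fun a => negb (inb l0 a)) l.

Lemma ldiff_perm (l l0 : list R) : NoDup l -> NoDup l0 -> incl l0 l ->
  Permutation (l0 ++ ldiff l l0) l.
Proof.
  intros Hl H0 Hi. rewrite <- (filter_perm (inb l0) l) at 2.
  apply Permutation_app_tail. apply NoDup_Permutation; auto; [now apply NoDup_filter|].
  intros a. rewrite filter_In, inb_true. split; [intros; split; auto|tauto].
Qed.

Lemma ldiff_In (l l0 : list R) (a : R) : In a (ldiff l l0) <-> In a l /\ ~ In a l0.
Proof. unfold ldiff. now rewrite filter_In, inb_false. Qed.

Lemma finite_part_filter (A : R -> Prop) (p : R -> bool) (l : list R) :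
  finite_part A l -> finite_part A (filter p l).
Proof.
  intros [H1 H2]. split; [now apply NoDup_filter|].
  intros a Ha. apply filter_In in Ha. now apply H2.
Qed.

Lemma finite_part_union (A : R -> Prop) (l l' : list R) : finite_part A l -> finite_part A l' ->
  exists k, finite_part A k /\ incl l k /\ incl l' k.
Proof.
  intros [H1 H2] [H3 H4]. exists (nodup Req_EM_T (l ++ l')). split; [split|split].
  - apply NoDup_nodup.
  - intros a Ha. apply nodup_In, in_app_or in Ha. destruct Ha; auto.
  - intros a Ha. apply nodup_In, in_or_app. auto.
  - intros a Ha. apply nodup_In, in_or_app. auto.
Qed.

Lemma Rsum_incl (f : R -> R) (l l' : list R) : (forall a, 0 <= f a) -> NoDup l -> NoDup l' ->
  incl l l' -> Rsum f l <= Rsum f l'.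
Proof.
  intros Hf H1 H2 Hi. rewrite <- (Rsum_perm f _ _ (ldiff_perm l' l H2 H1 Hi)), Rsum_app.
  assert (0 <= Rsum f (ldiff l' l)) by (apply Rsum_nonneg; auto). lra.
Qed.

(** A finite part whose sum of moduli comes within [e] of the supremum leaves less than [e] for any
    disjoint one. *)
Lemma abs_summable_tail (A : R -> Prop) (F : R -> C) : abs_summable A F ->
  forall e, 0 < e -> exists l0, finite_part A l0 /\
    forall l, finite_part A l -> (forall a, In a l -> ~ In a l0) ->
      Rsum (fun a => Cmod (F a)) l <= e.
Proof.
  intros [B HB] e He.
  destruct (completeness (fun y => exists l, finite_part A l /\ y = Rsum (fun a => Cmod (F a)) l))
    as [M [M1 M2]].
  - exists B. intros y [l [Hl ->]]. now apply HB.
  - exists 0, nil. split; auto. split; [constructor|]. intros a [].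
  - apply Classical_Prop.NNPP. intros HN.
    assert (M <= M - e); [|lra]. apply M2. intros y [l [Hl ->]].
    apply Rnot_lt_le. intros Hlt. apply HN. exists l. split; auto. intros l' Hl' Hd.
    assert (K : Rsum (fun a => Cmod (F a)) (l ++ l') <= M).
    { apply M1. exists (l ++ l'). split; auto. destruct Hl as [H1 H2], Hl' as [H3 H4]. split.
      - apply NoDup_app; auto. intros a Ha Ha'. now apply (Hd a).
      - intros a Ha. apply in_app_or in Ha. destruct Ha; auto. }
    rewrite Rsum_app in K. lra.
Qed.

Lemma Csum_diff_tail (A : R -> Prop) (F : R -> C) (e : R) (l0 l : list R) :
  finite_part A l0 -> finite_part A l -> incl l0 l ->
  (forall l, finite_part A l -> (forall a, In a l -> ~ In a l0) ->
      Rsum (fun a => Cmod (F a)) l <= e) ->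
  Cmod (Csum F l - Csum F l0) <= e.
Proof.
  intros H0 Hl Hi HT.
  rewrite <- (Csum_perm F _ _ (ldiff_perm l l0 (proj1 Hl) (proj1 H0) Hi)), Csum_app.
  replace (Csum F l0 + Csum F (ldiff l l0) - Csum F l0)%C with (Csum F (ldiff l l0)) by ring.
  eapply Rle_trans; [apply Cmod_Csum_le|]. apply HT.
  - now apply finite_part_filter.
  - intros a Ha. now apply ldiff_In in Ha.
Qed.

Lemma is_usum_tail (A : R -> Prop) (F : R -> C) (S : C) (e : R) (l0 : list R) :
  is_usum A F S -> finite_part A l0 ->
  (forall l, finite_part A l -> (forall a, In a l -> ~ In a l0) ->
      Rsum (fun a => Cmod (F a)) l <= e) ->
  Cmod (S - Csum F l0) <= e.
Proof.
  intros HS H0 HT. apply le_epsilon. intros d Hd.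
  destruct (HS d Hd) as [l1 [H1 K]].
  destruct (finite_part_union A l0 l1 H0 H1) as [l [Hl [I0 I1]]].
  assert (X := Csum_diff_tail A F e l0 l H0 Hl I0 HT).
  specialize (K l Hl I1).
  replace (S - Csum F l0)%C with ((Csum F l - Csum F l0) - (Csum F l - S))%C by ring.
  eapply Rle_trans; [apply Cmod_triangle_sub|]. lra.
Qed.

Lemma is_usum_bound (A : R -> Prop) (F : R -> C) (S : C) (B : R) :
  is_usum A F S -> (forall l, finite_part A l -> Cmod (Csum F l) <= B) -> Cmod S <= B.
Proof.
  intros HS HB. apply le_epsilon. intros d Hd.
  destruct (HS d Hd) as [l1 [H1 K]]. specialize (K l1 H1 (fun a H => H)). specialize (HB l1 H1).
  replace S with (Csum F l1 - (Csum F l1 - S))%C by ring.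
  eapply Rle_trans; [apply Cmod_triangle_sub|]. lra.
Qed.

Lemma is_usum_minus (A : R -> Prop) (F G : R -> C) (S T : C) :
  is_usum A F S -> is_usum A G T -> is_usum A (fun a => F a - G a)%C (S - T)%C.
Proof.
  intros HS HT e He. destruct (HS (e / 2)) as [l1 [H1 K1]]; [lra|].
  destruct (HT (e / 2)) as [l2 [H2 K2]]; [lra|].
  destruct (finite_part_union A l1 l2 H1 H2) as [l0 [Hl0 [I1 I2]]].
  exists l0. split; auto. intros l Hl Hi.
  specialize (K1 l Hl (incl_tran I1 Hi)). specialize (K2 l Hl (incl_tran I2 Hi)).
  rewrite Csum_minus.
  replace (Csum F l - Csum G l - (S - T))%C with ((Csum F l - S) - (Csum G l - T))%C by ring.
  eapply Rle_lt_trans; [apply Cmod_triangle_sub|]. lra.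
Qed.

Lemma is_usum_scal (A : R -> Prop) (F : R -> C) (k S : C) :
  is_usum A F S -> is_usum A (fun a => k * F a)%C (k * S)%C.
Proof.
  intros HS e He. assert (Hk := Cmod_ge_0 k).
  destruct (HS (e / (Cmod k + 1))) as [l0 [H0 K]]; [apply Rdiv_lt_0_compat; lra|].
  exists l0. split; auto. intros l Hl Hi. specialize (K l Hl Hi).
  rewrite Csum_scal. replace (k * Csum F l - k * S)%C with (k * (Csum F l - S))%C by ring.
  rewrite Cmod_mult. apply Rlt_div_r in K; [|lra].
  assert (X := Cmod_ge_0 (Csum F l - S)). nra.
Qed.

(** Lets the sum defining [E_s], which runs over one half of the dual set, be subtracted termwise
    from the dual side of the interpolation formula. *)
Lemma is_usum_extend (A : R -> Prop) (p : R -> bool) (F : R -> C) (S : C) :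
  is_usum (fun a => A a /\ p a = true) F S ->
  is_usum A (fun a => if p a then F a else RtoC 0) S.
Proof.
  intros HS e He. destruct (HS e He) as [l0 [[H1 H2] K]]. exists l0. split.
  { split; auto. intros a Ha. now apply H2. }
  intros l Hl Hi.
  assert (E : forall k, Csum (fun a => if p a then F a else RtoC 0) k = Csum F (filter p k)).
  { induction k as [|a k IH]; simpl; auto. destruct (p a); simpl; rewrite IH; [auto|ring]. }
  rewrite E. apply K.
  - split; [apply NoDup_filter, Hl|]. intros a Ha. apply filter_In in Ha.
    split; [now apply Hl|tauto].
  - intros a Ha. apply filter_In. split; auto. now apply H2.
Qed.

Lemma abs_summable_usum (A : R -> Prop) (F : R -> C) : abs_summable A F -> exists S, is_usum A F S.
Proof.
  intros H. assert (HT := abs_summable_tail A F H).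
  destruct (choice (fun n l0 => finite_part A l0 /\
    forall l, finite_part A l -> (forall a, In a l -> ~ In a l0) ->
      Rsum (fun a => Cmod (F a)) l <= / INR (S n))) as [u Hu].
  { intros n. apply HT. apply Rinv_0_lt_compat, lt_0_INR. lia. }
  assert (N := inv_S_small).
  destruct (Clim_complete (fun n => Csum F (u n))) as [S HS].
  { intros e He. destruct (N (e / 2)) as [M HM]; [lra|]. exists M. intros n m Hn Hm.
    destruct (Hu n) as [P1 T1]. destruct (Hu m) as [P2 T2].
    destruct (finite_part_union A _ _ P1 P2) as [l [Hl [I1 I2]]].
    assert (X1 := Csum_diff_tail A F _ _ l P1 Hl I1 T1).
    assert (X2 := Csum_diff_tail A F _ _ l P2 Hl I2 T2).
    assert (Y1 := HM n Hn). assert (Y2 := HM m Hm).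
    replace (Csum F (u n) - Csum F (u m))%C
      with ((Csum F l - Csum F (u m)) - (Csum F l - Csum F (u n)))%C by ring.
    eapply Rle_lt_trans; [apply Cmod_triangle_sub|]. lra. }
  exists S. intros e He. destruct (N (e / 2)) as [M HM]; [lra|].
  destruct (HS (e / 2)) as [M' HM']; [lra|].
  set (n := max M M'). exists (u n). destruct (Hu n) as [P1 T1]. split; auto.
  intros l Hl Hi. assert (X1 := Csum_diff_tail A F _ _ l P1 Hl Hi T1).
  assert (Y1 := HM n ltac:(unfold n; lia)). assert (Y2 := HM' n ltac:(unfold n; lia)).
  replace (Csum F l - S)%C with ((Csum F l - Csum F (u n)) + (Csum F (u n) - S))%C by ring.
  eapply Rle_lt_trans; [apply Cmod_triangle|]. lra.
Qed.

(** The nonnegative and the negative terms form two sublists, and the sum of moduli over each is the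
    modulus of the sum. *)
Lemma Rsum_abs_le (f : R -> R) (B : R) (l : list R) :
  (forall p, Rabs (Rsum f (filter p l)) <= B) -> Rsum (fun a => Rabs (f a)) l <= 2 * B.
Proof.
  intros H. set (p := fun a => if Rle_dec 0 (f a) then true else false).
  rewrite <- (Rsum_perm _ _ _ (filter_perm p l)), Rsum_app.
  assert (Hp : forall a, p a = true -> 0 <= f a)
    by (intros a; unfold p; destruct (Rle_dec 0 (f a)); [auto|discriminate]).
  assert (Hn : forall a, p a = false -> f a < 0)
    by (intros a; unfold p; destruct (Rle_dec 0 (f a)); [discriminate|lra]).
  assert (E1 : Rsum (fun a => Rabs (f a)) (filter p l) = Rsum f (filter p l)).
  { clear H. clearbody p. induction l as [|a l IH]; simpl; auto.
    destruct (p a) eqn:Ep; simpl; auto. rewrite IH, Rabs_right; auto. now apply Rle_ge, Hp. }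
  assert (E2 : Rsum (fun a => Rabs (f a)) (filter (fun a => negb (p a)) l)
     = - Rsum f (filter (fun a => negb (p a)) l)).
  { clear H E1. clearbody p. induction l as [|a l IH]; simpl; [ring|].
    destruct (p a) eqn:Ep; simpl; auto. rewrite IH, Rabs_left; [ring|auto]. }
  rewrite E1, E2.
  assert (X := H p). assert (Y := H (fun a => negb (p a))).
  apply Rabs_le_between in X. apply Rabs_le_between in Y. lra.
Qed.

(** Sums over finite parts disjoint from [l0] are uniformly bounded, and so are those over all their
    subsets; selecting terms of one sign gives absolute summability. This supplies the truncations
    of the sum over [L]. *)
Lemma is_usum_abs_summable (A : R -> Prop) (F : R -> C) (S : C) :
  is_usum A F S -> abs_summable A F.
Proof.
  intros HS. destruct (HS 1 Rlt_0_1) as [l0 [H0 K]].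
  assert (D : forall l, finite_part A l -> (forall a, In a l -> ~ In a l0) -> Cmod (Csum F l) <= 2).
  { intros l Hl Hd.
    assert (HU : finite_part A (l0 ++ l)).
    { destruct Hl as [H3 H4], H0 as [H1 H2]. split.
      - apply NoDup_app; auto. intros a Ha Ha'. now apply (Hd a).
      - intros a Ha. apply in_app_or in Ha. destruct Ha; auto. }
    assert (X := K _ HU (incl_appl l (incl_refl l0))).
    assert (Y := K _ H0 (incl_refl l0)).
    rewrite Csum_app in X.
    replace (Csum F l) with ((Csum F l0 + Csum F l - S) - (Csum F l0 - S))%C by ring.
    eapply Rle_trans; [apply Cmod_triangle_sub|]. lra. }
  (* Sums disjoint from [l0] are at most 2; this doubles through the splitting by sign and again
     through the real and imaginary parts. *)
  exists (Rsum (fun a => Cmod (F a)) l0 + 8). intros l Hl.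
  change (Rsum (fun a => Cmod (F a)) l <= Rsum (fun a => Cmod (F a)) l0 + 8).
  rewrite <- (Rsum_perm _ _ _ (filter_perm (inb l0) l)), Rsum_app. fold (ldiff l l0).
  apply Rplus_le_compat.
  - apply Rsum_incl; [intros; apply Cmod_ge_0|apply NoDup_filter, Hl|apply H0|].
    intros a Ha. apply filter_In in Ha. now apply inb_true.
  - assert (Dp : forall p, Cmod (Csum F (filter p (ldiff l l0))) <= 2).
    { intros p. apply D.
      - now apply finite_part_filter, finite_part_filter.
      - intros a Ha. apply filter_In in Ha. destruct Ha as [Ha _]. now apply ldiff_In in Ha. }
    assert (X := Rsum_abs_le (fun a => Re (F a)) 2 (ldiff l l0)).
    assert (Y := Rsum_abs_le (fun a => Im (F a)) 2 (ldiff l l0)).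
    specialize (X ltac:(intros p; rewrite <- Re_Csum; eapply Rle_trans; [apply re_le_Cmod|apply Dp])).
    specialize (Y ltac:(intros p; rewrite <- Im_Csum; eapply Rle_trans; [apply Rabs_im_le_Cmod|apply Dp])).
    apply Rle_trans with (Rsum (fun a => Rabs (Re (F a)) + Rabs (Im (F a))) (ldiff l l0)).
    + apply Rsum_le. intros; apply Cmod_le_abs.
    + assert (E : forall k f g, Rsum (fun a => f a + g a) k = Rsum f k + Rsum g k).
      { induction k; intros; simpl; [ring|rewrite IHk; ring]. }
      rewrite E. lra.
Qed.

(** * Integrals over horizontal lines *)

Definition is_line_int (f : R -> C) (l : C) : Prop :=
  forall e, 0 < e -> exists T, 0 < T /\ forall a b, a <= - T -> T <= b -> Cmod (CI f a b - l) < e.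

(** The Gaussian decay of the integrands enters only through this majorant, whose antiderivative is
    an arctangent; [exp_neg_le] provides it. *)
Definition lorentz_bounded (f : R -> C) (K e : R) : Prop :=
  (forall s, Pcont f s) /\ forall s, Cmod (f s) <= K / (1 + e * s ^ 2).

Lemma exp_neg_le (x : R) : 0 <= x -> exp (- x) <= / (1 + x).
Proof.
  intros H. rewrite exp_Ropp. apply Rinv_le_contravar; [lra|apply exp_ineq1_le].
Qed.

(** [0 < a * b] places the interval on one side of 0, where the majorant may be weakened to
    [K / (e s^2)]. *)
Lemma lorentz_tail (f : R -> C) (K e a b : R) : 0 < e -> 0 <= K -> lorentz_bounded f K e ->
  a <= b -> 0 < a * b -> Cmod (CI f a b) <= 2 * (K / e * (/ a - / b)).
Proof.
  intros He HK [Hc Hf] Hab Hp.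
  assert (N : forall s, a <= s <= b -> s <> 0) by (intros s Hs ->; nra).
  assert (I : is_RInt (fun s => K / e * / s ^ 2) a b (K / e * (/ a - / b))).
  { set (F := fun s => - (K / e) * / s).
    replace (K / e * (/ a - / b)) with (minus (F b) (F a))
      by (unfold F, minus, plus, opp; simpl; ring).
    apply (is_RInt_derive (V := R_CompleteNormedModule) F).
    - intros s. rewrite Rmin_left, Rmax_right by auto. intros Hs. specialize (N s Hs).
      unfold F. auto_derive; auto. field. split; auto. lra.
    - intros s. rewrite Rmin_left, Rmax_right by auto. intros Hs. specialize (N s Hs).
      apply (ex_derive_continuous (V := R_NormedModule)). auto_derive.
      rewrite Rmult_1_r. now apply Rmult_integral_contrapositive_currified. }
  rewrite <- (is_RInt_unique _ _ _ _ I).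
  apply CI_bound_fun; auto.
  - intros s _. apply Hc.
  - eexists; apply I.
  - intros s Hs. specialize (N s Hs). eapply Rle_trans; [apply Hf|].
    assert (0 < s ^ 2) by (generalize (pow2_gt_0 s N); auto).
    replace (K / e * / s ^ 2) with (K / (e * s ^ 2)) by (field; split; lra).
    apply Rdiv_le_compat; nra.
Qed.

Lemma lorentz_nest (f : R -> C) (K e T a b a' b' : R) : 0 < e -> 0 <= K -> lorentz_bounded f K e ->
  0 < T -> a' <= a -> a <= - T -> T <= b -> b <= b' ->
  Cmod (CI f a' b' - CI f a b) <= 4 * (K / e / T).
Proof.
  intros He HK Hf HT H1 H2 H3 H4.
  assert (P : forall x y, Pcont_on f x y) by (intros x y t _; apply Hf).
  rewrite <- (CI_Chasles f a' a b'), <- (CI_Chasles f a b b') by (auto; lra).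
  replace (CI f a' a + (CI f a b + CI f b b') - CI f a b)%C
    with (CI f a' a + CI f b b')%C by ring.
  assert (X := lorentz_tail f K e a' a He HK Hf H1 ltac:(nra)).
  assert (Y := lorentz_tail f K e b b' He HK Hf H4 ltac:(nra)).
  assert (Q : 0 <= K / e) by (apply Rdiv_le_0_compat; lra).
  assert (I1 : / a' - / a <= / T).
  { assert (/ a' < 0) by (apply Rinv_lt_0_compat; lra).
    assert (/ (- a) <= / T) by (apply Rinv_le_contravar; lra).
    rewrite Rinv_opp in H0. lra. }
  assert (I2 : / b - / b' <= / T).
  { assert (0 < / b') by (apply Rinv_0_lt_compat; lra).
    assert (/ b <= / T) by (apply Rinv_le_contravar; lra). lra. }
  assert (X' : K / e * (/ a' - / a) <= K / e * / T) by (apply Rmult_le_compat_l; lra).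
  assert (Y' : K / e * (/ b - / b') <= K / e * / T) by (apply Rmult_le_compat_l; lra).
  assert (TT := Cmod_triangle (CI f a' a) (CI f b b')). unfold Rdiv at 1. lra.
Qed.

Lemma lorentz_bound (f : R -> C) (K e a b : R) : 0 < e -> 0 <= K -> lorentz_bounded f K e ->
  a <= b -> Cmod (CI f a b) <= 2 * PI * K / sqrt e.
Proof.
  intros He HK [Hc Hf] Hab.
  assert (Hs : 0 < sqrt e) by now apply sqrt_lt_R0.
  assert (Es : sqrt e * sqrt e = e) by (apply sqrt_sqrt; lra).
  assert (D : forall s, 0 < 1 + e * s ^ 2) by (intros s; generalize (pow2_ge_0 s); nra).
  set (F := fun s => K / sqrt e * atan (sqrt e * s)).
  assert (I : is_RInt (fun s => K / (1 + e * s ^ 2)) a b (F b - F a)).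
  { apply (is_RInt_derive (V := R_CompleteNormedModule) F).
    - intros s _. unfold F. auto_derive; auto.
      replace (sqrt e * s * (sqrt e * s * 1)) with (e * s ^ 2) by (rewrite <- Es at 1; ring).
      unfold Rsqr. replace (sqrt e * s * (sqrt e * s)) with (e * s ^ 2) by (rewrite <- Es at 1; ring).
      specialize (D s). field. split; simpl in *; lra.
    - intros s _. apply (ex_derive_continuous (V := R_NormedModule)). auto_derive.
      specialize (D s). simpl in D. lra. }
  eapply Rle_trans; [apply (CI_bound_fun f (fun s => K / (1 + e * s ^ 2)) a b Hab)|]; auto.
  - intros s _. apply Hc.
  - eexists; apply I.
  - rewrite (is_RInt_unique _ _ _ _ I). unfold F.
    assert (B1 := atan_bound (sqrt e * b)). assert (B2 := atan_bound (sqrt e * a)).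
    assert (Q : 0 <= K / sqrt e) by (apply Rdiv_le_0_compat; lra).
    assert (X : K / sqrt e * (atan (sqrt e * b) - atan (sqrt e * a)) <= K / sqrt e * PI)
      by (apply Rmult_le_compat_l; lra).
    unfold Rdiv in *. lra.
Qed.

Lemma is_line_int_bound (f : R -> C) (l : C) (B : R) : is_line_int f l ->
  (forall a b, a <= b -> Cmod (CI f a b) <= B) -> Cmod l <= B.
Proof.
  intros H HB. apply le_epsilon. intros e He. destruct (H e He) as [T [HT K]].
  specialize (K (- T) T ltac:(lra) ltac:(lra)). specialize (HB (- T) T ltac:(lra)).
  replace l with (CI f (- T) T - (CI f (- T) T - l))%C by ring.
  eapply Rle_trans; [apply Cmod_triangle_sub|]. lra.
Qed.

Lemma is_line_int_ext (f g : R -> C) (l : C) : (forall s, f s = g s) ->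
  is_line_int f l -> is_line_int g l.
Proof.
  intros E H e He. destruct (H e He) as [T [HT K]]. exists T. split; auto.
  intros a b Ha Hb. rewrite <- (CI_ext f g) by (auto; lra). auto.
Qed.

Lemma is_line_int_plus (f g : R -> C) (l l' : C) :
  (forall s, Pcont f s) -> (forall s, Pcont g s) -> is_line_int f l -> is_line_int g l' ->
  is_line_int (fun s => f s + g s)%C (l + l')%C.
Proof.
  intros Hf Hg H H' e He.
  destruct (H (e / 2)) as [T [HT K]]; [lra|]. destruct (H' (e / 2)) as [T' [HT' K']]; [lra|].
  exists (Rmax T T'). assert (M1 := Rmax_l T T'). assert (M2 := Rmax_r T T').
  split; [lra|]. intros a b Ha Hb.
  rewrite CI_plus; [|lra|intros s _; auto|intros s _; auto].
  specialize (K a b ltac:(lra) ltac:(lra)). specialize (K' a b ltac:(lra) ltac:(lra)).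
  replace (CI f a b + CI g a b - (l + l'))%C with ((CI f a b - l) + (CI g a b - l'))%C by ring.
  eapply Rle_lt_trans; [apply Cmod_triangle|]. lra.
Qed.

Lemma CI_reflect (f : R -> C) (a b : R) : a <= b -> (forall s, Pcont f s) ->
  CI (fun s => f (- s)) a b = CI f (- b) (- a).
Proof.
  intros Hab Hf.
  assert (S : forall h : R -> R, ex_RInt h (- b) (- a) ->
    RInt (fun s => h (- s)) a b = RInt h (- b) (- a)).
  { intros h Hh. apply (is_RInt_unique (V := R_CompleteNormedModule)).
    assert (I := RInt_correct (V := R_CompleteNormedModule) h _ _ Hh).
    apply (is_RInt_swap (V := R_NormedModule)) in I.
    apply (is_RInt_comp_opp (V := R_NormedModule)) in I.
    apply (is_RInt_opp (V := R_NormedModule)) in I.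
    rewrite opp_opp in I. revert I. apply (is_RInt_ext (V := R_NormedModule)).
    intros s _. apply Ropp_involutive. }
  assert (Pf : Pcont_on f (- b) (- a)) by (intros s _; auto).
  unfold CI. f_equal.
  - apply (S (fun s => Re (f s))). apply Pcont_on_re; auto; lra.
  - apply (S (fun s => Im (f s))). apply Pcont_on_im; auto; lra.
Qed.

Lemma is_line_int_reflect (f : R -> C) (l : C) : (forall s, Pcont f s) ->
  is_line_int f l -> is_line_int (fun s => f (- s)) l.
Proof.
  intros Hf H e He. destruct (H e He) as [T [HT K]]. exists T. split; auto.
  intros a b Ha Hb. rewrite CI_reflect by (auto; lra). apply K; lra.
Qed.

Lemma is_line_int_opp (f : R -> C) (l : C) : (forall s, Pcont f s) ->
  is_line_int f l -> is_line_int (fun s => - f s)%C (- l)%C.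
Proof.
  intros Hf H e He. destruct (H e He) as [T [HT K]]. exists T. split; auto.
  intros a b Ha Hb. rewrite (CI_ext _ (fun s => - RtoC 1 * f s)%C) by (try lra; intros; ring).
  rewrite CI_scal; [|lra|intros s _; auto].
  replace (- RtoC 1 * CI f a b - - l)%C with (- (CI f a b - l))%C by ring.
  rewrite Cmod_opp. auto.
Qed.

Lemma lorentz_line_int (f : R -> C) (K e : R) : 0 < e -> 0 <= K -> lorentz_bounded f K e ->
  exists l, is_line_int f l /\ Cmod l <= 2 * PI * K / sqrt e.
Proof.
  intros He HK Hf.
  set (u := fun n : nat => CI f (- INR (S n)) (INR (S n))).
  assert (Q : 0 <= K / e) by (apply Rdiv_le_0_compat; lra).
  assert (Hn : forall d, 0 < d -> exists T, 0 < T /\ 4 * (K / e / T) < d).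
  { intros d Hd. exists (4 * (K / e) / d + 1).
    assert (0 <= 4 * (K / e) / d) by (apply Rdiv_le_0_compat; lra).
    split; [lra|]. replace (4 * (K / e / (4 * (K / e) / d + 1)))
      with (4 * (K / e) / (4 * (K / e) / d + 1)) by (unfold Rdiv; ring).
    apply Rlt_div_l; [lra|]. rewrite Rmult_plus_distr_l.
    replace (d * (4 * (K / e) / d)) with (4 * (K / e)) by (field; lra). lra. }
  assert (Big : forall T, exists N, forall n, (N <= n)%nat -> T <= INR (S n)).
  { intros T. destruct (INR_archimed 1 T Rlt_0_1) as [N HN]. exists N. intros n H.
    assert (INR N <= INR (S n)) by (apply le_INR; lia). lra. }
  destruct (Clim_complete u) as [l Hl].
  { intros d Hd. destruct (Hn d Hd) as [T [HT K1]]. destruct (Big T) as [N HN].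
    exists N. assert (W : forall n m, (N <= n)%nat -> (n <= m)%nat -> Cmod (u m - u n) < d).
    { intros n m H1 H2. eapply Rle_lt_trans; [|apply K1].
      assert (T <= INR (S n)) by auto. assert (INR (S n) <= INR (S m)) by (apply le_INR; lia).
      apply lorentz_nest; auto; lra. }
    intros n m H1 H2. destruct (Nat.le_ge_cases n m); [rewrite Cmod_sub_sym|]; apply W; auto. }
  exists l. assert (IL : is_line_int f l).
  { intros d Hd. destruct (Hn (d / 2)) as [T [HT K1]]; [lra|]. exists T. split; auto.
    intros a b Ha Hb. destruct (Big (Rmax (- a) b)) as [N HN].
    apply Rle_lt_trans with (d / 2); [|lra].
    apply (Clim_bound u l (CI f a b) (d / 2) N Hl).
    intros n H. specialize (HN n H). rewrite Cmod_sub_sym.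
    assert (X := Rmax_l (- a) b). assert (Y := Rmax_r (- a) b).
    apply Rle_trans with (4 * (K / e / T)); [|lra]. apply lorentz_nest; auto; lra. }
  split; auto. apply (is_line_int_bound f l _ IL). intros a b Hab. now apply lorentz_bound.
Qed.

(** The only passage from the componentwise line integrals to the improper integral that defines
    [Fourier]. *)
Lemma RInt_gen_line_int (f : R -> C) (l : C) : (forall s, Pcont f s) -> is_line_int f l ->
  @RInt_gen C_R_CompleteNormedModule f (Rbar_locally m_infty) (Rbar_locally p_infty) = l.
Proof.
  intros Hf Hl. apply (is_RInt_gen_unique (V := C_R_CompleteNormedModule)).
  intros P [e HP]. destruct (Hl e (cond_pos e)) as [T [HT K]].
  refine (Filter_prod _ _ _ (fun a : R => a < - T) (fun b : R => T < b) _ _ _).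
  - exists (- T). auto.
  - exists T. auto.
  - intros a b Ha Hb. exists (CI f a b). split.
    + simpl. assert (Pf : Pcont_on f a b) by (intros s _; auto).
      apply (is_RInt_fct_extend_pair (U := R_NormedModule) (V := R_NormedModule)).
      * apply (RInt_correct (V := R_CompleteNormedModule)), Pcont_on_re; auto; lra.
      * apply (RInt_correct (V := R_CompleteNormedModule)), Pcont_on_im; auto; lra.
    + apply HP. specialize (K a b ltac:(lra) ltac:(lra)). split.
      * eapply Rle_lt_trans; [apply (re_le_Cmod (CI f a b - l))|exact K].
      * eapply Rle_lt_trans; [apply (Rabs_im_le_Cmod (CI f a b - l))|exact K].
Qed.

Lemma Clim_0 (u : nat -> C) (B : R) : (forall n, Cmod (u n) <= B / INR (S n)) -> Clim u 0.
Proof.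
  intros H e He. destruct (inv_S_small (e / (Rabs B + 1))) as [N HN].
  { apply Rdiv_lt_0_compat; auto. generalize (Rabs_pos B). lra. }
  exists N. intros n Hn. specialize (HN n Hn). assert (X := Rabs_pos B). assert (Y := Rle_abs B).
  assert (P : 0 < / INR (S n)) by (apply Rinv_0_lt_compat, lt_0_INR; lia).
  replace (u n - 0)%C with (u n) by ring. eapply Rle_lt_trans; [apply H|].
  apply Rlt_div_r in HN; [|lra]. unfold Rdiv. nra.
Qed.

Lemma is_line_int_Clim (f : R -> C) (l : C) (X : R) : is_line_int f l ->
  Clim (fun n => CI f (X - INR (S n)) (X + INR (S n))) l.
Proof.
  intros H e He. destruct (H e He) as [T [HT K]].
  destruct (INR_archimed 1 (T + Rabs X) Rlt_0_1) as [N HN]. exists N. intros n Hn.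
  assert (INR N <= INR (S n)) by (apply le_INR; lia).
  assert (A1 := Rle_abs X). assert (A2 := Rle_abs (- X)). rewrite Rabs_Ropp in A2.
  apply K; lra.
Qed.

(** The limit of [2 atan (T / b)] as [T] tends to infinity; the value at [b = 0] is arbitrary and
    never occurs. *)
Definition sgn_pi (b : R) : R := if Rlt_dec 0 b then PI else - PI.

Lemma atan_div_compl (T b : R) : 0 < T -> b <> 0 -> 2 * atan (T / b) = sgn_pi b - 2 * atan (b / T).
Proof.
  intros HT Hb. unfold sgn_pi. destruct (Rlt_dec 0 b) as [P|N].
  - replace (T / b) with (/ (b / T)) by (field; lra).
    rewrite atan_inv by (now apply Rdiv_lt_0_compat). lra.
  - assert (Hn : 0 < - b) by lra.
    replace (T / b) with (- / ((- b) / T)) by (field; lra).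
    rewrite atan_opp, atan_inv by (now apply Rdiv_lt_0_compat).
    replace (- b / T) with (- (b / T)) by (field; lra). rewrite atan_opp. lra.
Qed.

Lemma Clim_atan (b : R) : b <> 0 ->
  Clim (fun n => RtoC (2 * atan (INR (S n) / b))) (RtoC (sgn_pi b)).
Proof.
  intros Hb e He.
  assert (C0 : continuity_pt atan 0) by apply derivable_continuous_pt, derivable_pt_atan.
  destruct (C0 (e / 2)) as [d [Hd K]]; [lra|].
  assert (X := Rabs_pos_lt b Hb).
  destruct (inv_S_small (d / Rabs b)) as [N HN]; [now apply Rdiv_lt_0_compat|].
  exists N. intros n Hn. specialize (HN n Hn). set (T := INR (S n)) in *.
  assert (HT : 0 < T) by (apply lt_0_INR; lia).
  rewrite atan_div_compl by auto. rewrite <- RtoC_minus, Cmod_R.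
  replace (sgn_pi b - 2 * atan (b / T) - sgn_pi b) with (- (2 * atan (b / T))) by ring.
  rewrite Rabs_Ropp, Rabs_mult, (Rabs_right 2) by lra.
  specialize (K (b / T)). simpl in K. unfold Rdist in K. rewrite atan_0, !Rminus_0_r in K.
  assert (Rabs (atan (b / T)) < e / 2); [|lra]. apply K. split; [split; [exact I|]|].
  - intros E. apply Hb. replace b with (b / T * T) by (field; lra). rewrite <- E. ring.
  - unfold Rdiv. rewrite Rabs_mult, Rabs_inv, (Rabs_right T) by lra.
    apply Rlt_div_r in HN; auto. lra.
Qed.

(** Centring the window at [Re w] makes the logarithms of the moduli at both ends equal, so that
    only the arctangent survives. *)
Lemma line_inv_int (w : C) (t T : R) : 0 < T -> Im w <> t ->
  CI (fun s => / (w - (s, t)))%C (Re w - T) (Re w + T)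
  = (- Ci * RtoC (2 * atan (T / (Im w - t))))%C.
Proof.
  intros HT Ht. destruct w as [X Y]. simpl in *. set (b := Y - t).
  assert (Hb : b <> 0) by (unfold b; lra).
  assert (D : forall s, 0 < (X - s) ^ 2 + b ^ 2).
  { intros s. assert (0 < b ^ 2) by now apply pow2_gt_0. generalize (pow2_ge_0 (X - s)). lra. }
  assert (N : forall s, ((X, Y) - (s, t))%C <> RtoC 0).
  { intros s E. apply (f_equal Im) in E. simpl in E. lra. }
  set (F := fun s => (- ln ((X - s) ^ 2 + b ^ 2) / 2, atan ((X - s) / b)) : C).
  rewrite (CI_antiderivative _ F).
  - unfold F. replace (X - (X + T)) with (- T) by ring. replace (X - (X - T)) with T by ring.
    replace ((- T) ^ 2) with (T ^ 2) by ring. replace (- T / b) with (- (T / b)) by (field; auto).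
    rewrite atan_opp. unfold Cminus, Cplus, Copp, Cmult, Ci, RtoC; simpl. f_equal; ring.
  - lra.
  - intros s _. apply (Pcont_comp (fun v => / ((X, Y) - v))%C (fun s => (s, t))); [apply Pcont_horiz|].
    apply Ccont_inv; [|apply N]. apply Ccont_minus; [apply Ccont_const|apply Ccont_id].
  - intros s _. unfold F; simpl. specialize (D s).
    auto_derive; [simpl in D; lra|]. fold (Y - t). unfold b in *. field. simpl in D. lra.
  - intros s _. unfold F; simpl. specialize (D s).
    auto_derive; [auto|]. fold (Y - t). unfold b in *. field. simpl in D. repeat split; auto; lra.
Qed.

(** * The Fourier transform of e^(-e t^2) / (w - t) *)

Lemma rect_int_ext (f g : C -> C) (a b c d : R) : a <= b -> c <= d ->
  (forall z, rect_bdry a b c d z -> f z = g z) -> rect_int f a b c d = rect_int g a b c d.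
Proof.
  intros Hab Hcd E. unfold rect_int.
  rewrite (CI_ext (fun t => f (t, c)) (fun t => g (t, c))),
    (CI_ext (fun t => f (t, d)) (fun t => g (t, d))),
    (CI_ext (fun t => f (b, t)) (fun t => g (b, t))),
    (CI_ext (fun t => f (a, t)) (fun t => g (a, t))); auto.
  all: intros t Ht; apply E; split; [split; simpl; lra|simpl; auto].
Qed.

Definition vsides (g : C -> C) (X c d T : R) : C :=
  (CI (fun t => g ((X + T)%R, t)) c d - CI (fun t => g ((X - T)%R, t)) c d)%C.

(** On the vertical sides [|w - z| >= T], so boundedness of [f] on the strip already gives an error
    of order [1 / T]. *)
Lemma vsides_lim (f : C -> C) (w : C) (c d B : R) : c <= d -> (forall z, Cdiff f z) ->
  (forall z, c <= Im z <= d -> Cmod (f z) <= B) ->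
  Clim (fun n => vsides (fun z => f z / (w - z))%C (Re w) c d (INR (S n))) 0.
Proof.
  intros Hcd Hf HB. apply (Clim_0 _ (4 * B * (d - c))). intros n.
  set (T := INR (S n)). assert (HT : 0 < T) by (apply lt_0_INR; lia).
  assert (S : forall x, Rabs (Re w - x) = T ->
    Cmod (CI (fun t => (fun z => f z / (w - z))%C (x, t)) c d) <= 2 * (B / T) * (d - c)).
  { intros x Hx.
    assert (W : forall t, T <= Cmod (w - (x, t))).
    { intros t. rewrite <- Hx. apply (re_le_Cmod (w - (x, t))). }
    assert (N : forall t, (w - (x, t))%C <> RtoC 0).
    { intros t. apply Cmod_gt_0. specialize (W t). lra. }
    apply CI_bound; auto.
    - intros t _. apply (Pcont_comp (fun z => f z / (w - z))%C (fun s => (x, s))); [apply Pcont_vert|].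
      apply Ccont_div; [apply Cdiff_cont, Hf| |apply N].
      apply Ccont_minus; [apply Ccont_const|apply Ccont_id].
    - intros t Ht. rewrite Cmod_div by apply N. apply Rdiv_le_compat; auto using Cmod_ge_0. }
  unfold vsides. eapply Rle_trans; [apply Cmod_triangle_sub|].
  assert (S1 := S (Re w + T) ltac:(replace (Re w - (Re w + T)) with (- T) by ring;
    rewrite Rabs_Ropp; apply Rabs_right; lra)).
  assert (S2 := S (Re w - T) ltac:(replace (Re w - (Re w - T)) with T by ring;
    apply Rabs_right; lra)).
  cbv beta in S1, S2. unfold Rdiv in *. lra.
Qed.

(** The residue theorem for this integrand: [f(z)/(w - z) = f(w)/(w - z) - h(z)] with [h] entire, so
    Goursat's theorem reduces everything to the explicit integral of [1/(w - z)]. The two values of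
    [sgn_pi] tell whether [w] lies between the lines. *)
Theorem line_shift (f : C -> C) (w : C) (t1 t2 B : R) (l1 l2 : C) : t1 <= t2 ->
  (forall z, Cdiff f z) -> Im w <> t1 -> Im w <> t2 ->
  (forall z, t1 <= Im z <= t2 -> Cmod (f z) <= B) ->
  is_line_int (fun s => f (s, t1) / (w - (s, t1)))%C l1 ->
  is_line_int (fun s => f (s, t2) / (w - (s, t2)))%C l2 ->
  (l1 - l2 = - Ci * RtoC (sgn_pi (Im w - t1) - sgn_pi (Im w - t2)) * f w)%C.
Proof.
  intros Ht Hf N1 N2 HB H1 H2.
  destruct (entire_divide (fun z => f z - f w)%C w) as [h [Eh Hh]].
  { intros z. apply Cdiff_minus; [auto|apply Cdiff_const]. }
  { ring. }
  set (F := fun z => (f z / (w - z))%C). set (k := fun z => (1 / (w - z))%C).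
  assert (Hk : forall z, z <> w -> Cdiff k z).
  { intros z Hz. apply Cdiff_div; [apply Cdiff_const| |apply Csub_neq_0; auto].
    apply Cdiff_minus; [apply Cdiff_const|apply Cdiff_id]. }
  set (A := fun T => (CI (fun s => F (s, t1)) (Re w - T) (Re w + T)
                      - CI (fun s => F (s, t2)) (Re w - T) (Re w + T))%C).
  assert (LA : Clim (fun n => A (INR (S n))) (l1 - l2)%C).
  { apply Clim_minus; apply (is_line_int_Clim _ _ (Re w)); auto. }
  assert (LA' : Clim (fun n => A (INR (S n))) (f w * (- Ci * RtoC (sgn_pi (Im w - t1)) - - Ci * RtoC (sgn_pi (Im w - t2))
       + Ci * 0) - Ci * 0)%C).
  { apply (Clim_ext (fun n => let T := INR (S n) in f w * (- Ci * RtoC (2 * atan (T / (Im w - t1)))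
        - - Ci * RtoC (2 * atan (T / (Im w - t2))) + Ci * vsides k (Re w) t1 t2 T)
        - Ci * vsides F (Re w) t1 t2 T)%C).
    - intros n. cbv zeta. set (T := INR (S n)).
      assert (HT : 0 < T) by (apply lt_0_INR; lia).
      assert (NB : forall z, rect_bdry (Re w - T) (Re w + T) t1 t2 z -> z <> w).
      { intros z [_ Hz] ->. destruct Hz as [E|[E|[E|E]]]; lra. }
      assert (I : rect_int F (Re w - T) (Re w + T) t1 t2
        = (f w * rect_int k (Re w - T) (Re w + T) t1 t2)%C).
      { rewrite (rect_int_ext F (fun z => f w * k z - h z)%C); try lra.
        - rewrite rect_int_minus, rect_int_scal, (goursat h); try lra; auto.
          + ring.
          + intros z Hz. apply Cdiff_cont, Hk; auto.
          + intros z Hz. apply Ccont_mult; [apply Ccont_const|]. apply Cdiff_cont, Hk; auto.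
          + intros z Hz. apply Cdiff_cont; auto.
        - intros z Hz. specialize (NB z Hz). unfold F, k.
          replace (h z) with ((f z - f w) / (z - w))%C
            by (rewrite (Eh z); field; now apply Csub_neq_0).
          field. split; apply Csub_neq_0; auto. }
      unfold A. unfold rect_int in I.
      assert (J : forall t, Im w <> t -> CI (fun s => k (s, t)) (Re w - T) (Re w + T)
         = (- Ci * RtoC (2 * atan (T / (Im w - t))))%C).
      { intros t Hn. rewrite <- line_inv_int by auto. apply CI_ext; [lra|].
        intros s _. unfold k. unfold Cdiv. ring. }
      rewrite !J in I by auto. fold (vsides F (Re w) t1 t2 T) in I. fold (vsides k (Re w) t1 t2 T) in I.
      rewrite <- I. ring.
    - apply Clim_minus; apply Clim_scal.
      + apply Clim_plus; [apply Clim_minus; apply Clim_scal, Clim_atan; lra|].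
        apply Clim_scal. apply (vsides_lim (fun _ => RtoC 1) w t1 t2 1 Ht).
        * intros; apply Cdiff_const.
        * intros; rewrite Cmod_1; lra.
      + now apply (vsides_lim f w t1 t2 B Ht). }
  rewrite (Clim_unique _ _ _ LA LA'). rewrite RtoC_minus. ring.
Qed.

(** The numerator [e^(-e t^2) e^(-2 pi i xi t)] of the Fourier integrand, continued to an entire
    function so that the line of integration can be moved. *)
Definition gauss_wave (e xi : R) (z : C) : C :=
  Cexp (RtoC (- e) * (z * z) + RtoC (-2 * PI) * Ci * (RtoC xi * z))%C.

Lemma gauss_wave_diff (e xi : R) (z : C) : Cdiff (gauss_wave e xi) z.
Proof.
  apply (Cdiff_comp (fun z => RtoC (- e) * (z * z) + RtoC (-2 * PI) * Ci * (RtoC xi * z))%C Cexp);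
  [|apply Cdiff_Cexp].
  repeat first [apply Cdiff_plus|apply Cdiff_mult|apply Cdiff_const|apply Cdiff_id].
Qed.

Lemma Cmod_gauss_wave (e xi s t : R) :
  Cmod (gauss_wave e xi (s, t)) = exp (- (e * s ^ 2)) * exp (e * t ^ 2 + 2 * PI * xi * t).
Proof.
  unfold gauss_wave. rewrite Cmod_Cexp, <- exp_plus. f_equal. simpl. ring.
Qed.

Lemma gauss_wave_line_bounded (e xi t : R) (w : C) : 0 < e -> Im w <> t ->
  lorentz_bounded (fun s => gauss_wave e xi (s, t) / (w - (s, t)))%C
    (exp (e * t ^ 2 + 2 * PI * xi * t) / Rabs (Im w - t)) e.
Proof.
  intros He Hw.
  assert (P : 0 < Rabs (Im w - t)) by (apply Rabs_pos_lt; lra).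
  assert (W : forall s, Rabs (Im w - t) <= Cmod (w - (s, t))).
  { intros s. apply (Rabs_im_le_Cmod (w - (s, t))). }
  assert (N : forall s, (w - (s, t))%C <> RtoC 0).
  { intros s. apply Cmod_gt_0. specialize (W s). lra. }
  split; intros s.
  - apply (Pcont_comp (fun z => gauss_wave e xi z / (w - z))%C (fun s => (s, t))); [apply Pcont_horiz|].
    apply Ccont_div; [apply Cdiff_cont, gauss_wave_diff| |apply N].
    apply Ccont_minus; [apply Ccont_const|apply Ccont_id].
  - assert (Q : 0 <= e * s ^ 2) by (generalize (pow2_ge_0 s); nra).
    rewrite Cmod_div by apply N. rewrite Cmod_gauss_wave.
    assert (X := exp_neg_le _ Q). set (M := exp (e * t ^ 2 + 2 * PI * xi * t)).
    assert (HM : 0 < M) by apply exp_pos.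
    apply Rle_trans with (/ (1 + e * s ^ 2) * M / Rabs (Im w - t)).
    + apply Rdiv_le_compat; auto.
      * apply Rmult_le_pos; [left; apply exp_pos|lra].
      * apply Rmult_le_compat_r; lra.
    + right. field. split; lra.
Qed.

Lemma gauss_wave_line_int (e xi t : R) (w : C) : 0 < e -> Im w <> t ->
  exists l, is_line_int (fun s => gauss_wave e xi (s, t) / (w - (s, t)))%C l /\
    Cmod l <= 2 * PI * (exp (e * t ^ 2 + 2 * PI * xi * t) / Rabs (Im w - t)) / sqrt e.
Proof.
  intros He Hw. apply lorentz_line_int; auto.
  - left. apply Rdiv_lt_0_compat; [apply exp_pos|]. apply Rabs_pos_lt; lra.
  - now apply gauss_wave_line_bounded.
Qed.

Lemma gauss_wave_strip_bounded (e xi t1 t2 : R) : 0 < e ->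
  exists B, forall z, t1 <= Im z <= t2 -> Cmod (gauss_wave e xi z) <= B.
Proof.
  intros He. set (m := Rmax (Rabs t1) (Rabs t2)).
  exists (exp (e * m ^ 2 + 2 * PI * Rabs xi * m)). intros [s t] [H1 H2]. simpl in H1, H2.
  rewrite Cmod_gauss_wave, <- exp_plus.
  assert (Hm : Rabs t <= m).
  { assert (M1 := Rmax_l (Rabs t1) (Rabs t2)). assert (M2 := Rmax_r (Rabs t1) (Rabs t2)). fold m in M1, M2.
    apply Rabs_le. assert (A1 := Rle_abs t2). assert (A2 := Rle_abs (- t1)). rewrite Rabs_Ropp in A2. lra. }
  assert (Ht := Rabs_pos t). assert (Hpi := PI_RGT_0).
  assert (X : t ^ 2 <= m ^ 2) by (rewrite <- (pow2_abs t); apply pow_incr; lra).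
  assert (Y : xi * t <= Rabs xi * m).
  { apply Rle_trans with (Rabs (xi * t)); [apply Rle_abs|]. rewrite Rabs_mult.
    apply Rmult_le_compat_l; [apply Rabs_pos|auto]. }
  assert (Z := pow2_ge_0 s).
  assert (- (e * s ^ 2) + (e * t ^ 2 + 2 * PI * xi * t) <= e * m ^ 2 + 2 * PI * Rabs xi * m).
  { assert (e * t ^ 2 <= e * m ^ 2) by (apply Rmult_le_compat_l; lra).
    assert (0 <= e * s ^ 2) by (apply Rmult_le_pos; lra).
    assert (2 * PI * (xi * t) <= 2 * PI * (Rabs xi * m)) by (apply Rmult_le_compat_l; lra).
    lra. }
  now apply exp_le_compat.
Qed.

Lemma Fourier_gauss_cauchy (e xi : R) (w l : C) : 0 < e -> Im w <> 0 ->
  is_line_int (fun s => gauss_wave e xi (s, 0) / (w - (s, 0)))%C l ->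
  Fourier (gauss_cauchy e w) xi = l.
Proof.
  intros He Hw Hl. unfold Fourier.
  assert (E : forall s, (gauss_wave e xi (s, 0%R) / (w - (s, 0%R)))%C =
    (gauss_cauchy e w s * Cexp (RtoC (-2 * PI) * Ci * RtoC (s * xi)))%C).
  { intros s. unfold gauss_wave, gauss_cauchy. rewrite Cexp_plus.
    replace (Cexp (RtoC (- e) * ((s, 0%R) * (s, 0%R)))%C) with (RtoC (exp (- e * s ^ 2))).
    - replace (RtoC (-2 * PI) * Ci * (RtoC xi * (s, 0%R)))%C with (RtoC (-2 * PI) * Ci * RtoC (s * xi))%C.
      + unfold Cdiv. change (RtoC s) with (s, 0%R). ring.
      + change (s, 0%R) with (RtoC s). rewrite !RtoC_mult. ring.
    - change (s, 0%R) with (RtoC s). rewrite <- !RtoC_mult. unfold Cexp, RtoC; simpl.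
      rewrite cos_0, sin_0. f_equal; [|ring]. rewrite Rmult_1_r. f_equal. ring. }
  apply RInt_gen_line_int.
  - intros s. apply (Pcont_ext _ _ s E). now apply gauss_wave_line_bounded.
  - apply (is_line_int_ext _ _ _ E Hl).
Qed.

Lemma sgn_pi_pos (b : R) : 0 < b -> sgn_pi b = PI.
Proof. intros H. unfold sgn_pi. destruct (Rlt_dec 0 b); lra. Qed.

Lemma sgn_pi_neg (b : R) : b < 0 -> sgn_pi b = - PI.
Proof. intros H. unfold sgn_pi. destruct (Rlt_dec 0 b); lra. Qed.

(** The pole [w] lies above the real axis, so no residue is picked up. *)
Lemma gauss_wave_shift_down (e xi n : R) (w l : C) : 0 < e -> 0 < Im w -> 0 < n ->
  is_line_int (fun s => gauss_wave e xi (s, (- n)%R) / (w - (s, (- n)%R)))%C l ->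
  Fourier (gauss_cauchy e w) xi = l.
Proof.
  intros He Hw Hn Hl.
  destruct (gauss_wave_line_int e xi 0 w He) as [l0 [H0 _]]; [lra|].
  destruct (gauss_wave_strip_bounded e xi (- n) 0 He) as [B HB].
  rewrite (Fourier_gauss_cauchy e xi w l0); auto; try lra.
  assert (S := line_shift (gauss_wave e xi) w (- n) 0 B l l0 ltac:(lra) (gauss_wave_diff e xi)
    ltac:(lra) ltac:(lra) HB Hl H0).
  rewrite !sgn_pi_pos, Rminus_diag in S by lra.
  symmetry. apply Csub_eq_0. rewrite S. ring.
Qed.

Lemma gauss_wave_shift_up (e xi n : R) (w l : C) : 0 < e -> 0 < Im w -> Im w < n ->
  is_line_int (fun s => gauss_wave e xi (s, n) / (w - (s, n)))%C l ->
  Fourier (gauss_cauchy e w) xi = (l - RtoC (2 * PI) * Ci * gauss_wave e xi w)%C.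
Proof.
  intros He Hw Hn Hl.
  destruct (gauss_wave_line_int e xi 0 w He) as [l0 [H0 _]]; [lra|].
  destruct (gauss_wave_strip_bounded e xi 0 n He) as [B HB].
  rewrite (Fourier_gauss_cauchy e xi w l0); auto; try lra.
  assert (S := line_shift (gauss_wave e xi) w 0 n B l0 l ltac:(lra) (gauss_wave_diff e xi)
    ltac:(lra) ltac:(lra) HB H0 Hl).
  rewrite sgn_pi_pos, sgn_pi_neg in S by lra.
  replace (PI - - PI) with (2 * PI) in S by ring.
  replace l0 with ((l0 - l) + l)%C by ring. rewrite S. ring.
Qed.

Lemma gauss_wave_even (e : R) (z : C) : gauss_wave e 0 (- z)%C = gauss_wave e 0 z.
Proof. unfold gauss_wave. f_equal. ring. Qed.

(** The substitution [t -> -t] fixes the Gaussian and changes the sign of [w], of [xi] and of the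
    denominator; it reduces the lower half-plane to the upper one. *)
Lemma Fourier_gauss_cauchy_reflect (e xi : R) (w : C) : 0 < e -> Im w <> 0 ->
  Fourier (gauss_cauchy e w) xi = (- Fourier (gauss_cauchy e (- w)) (- xi)%R)%C.
Proof.
  intros He Hw.
  assert (Hw' : Im (- w)%C <> 0) by (intros h; apply Hw; simpl in h; unfold Im; lra).
  destruct (gauss_wave_line_int e (- xi) 0 (- w)%C He Hw') as [l [Hl _]].
  rewrite (Fourier_gauss_cauchy e (- xi) (- w)%C l He Hw' Hl).
  assert (Pc : forall s, Pcont (fun s => gauss_wave e (- xi) (s, 0%R) / (- w - (s, 0%R)))%C s)
    by (apply gauss_wave_line_bounded; auto).
  apply Fourier_gauss_cauchy; auto.
  assert (Hl' := is_line_int_reflect _ _ Pc Hl).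
  apply is_line_int_opp in Hl'.
  - revert Hl'. apply is_line_int_ext. intros s.
    replace ((- s, 0%R) : C) with (- (s, 0%R))%C by (unfold Copp; simpl; f_equal; ring).
    replace (gauss_wave e (- xi) (- (s, 0%R))%C) with (gauss_wave e xi (s, 0%R)).
    + assert (N : (w - (s, 0%R))%C <> RtoC 0).
      { intros E. apply Hw. apply (f_equal Im) in E. simpl in E. unfold Im. lra. }
      field. split; auto. intros E. apply N.
      replace (w - (s, 0%R))%C with (- (- w - - (s, 0%R)))%C by ring.
      rewrite E. ring.
    + unfold gauss_wave. f_equal. rewrite (RtoC_opp xi). ring.
  - intros s. exact (Pcont_reflect _ s (Pc (- s))).
Qed.

(** The negative of the main term of the Fourier transform for [Im w > 0]: the residue at [w], in
    full at negative frequencies and by half at 0. *)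
Definition upper_residue (e xi : R) (w : C) : C :=
  if Rle_dec xi 0 then (RtoC (2 * PI) * Ci * (RtoC (prime_weight xi) * gauss_wave e xi w))%C
  else RtoC 0.

(** [sqrt e] is the error at frequency 0, the exponential that at frequencies of modulus at least
    [tau0], after [exp (- 2 pi eta0 |xi|)] has been split off for the summation against [h]. *)
Definition fourier_err (e eta0 tau0 : R) : R :=
  4 * PI * exp 1 * (sqrt e + exp (- (2 * PI * ((/ sqrt e - eta0) * tau0)))).

(* The contour is moved to height 1 / sqrt e, where the Gaussian costs only a
   factor exp 1; for xi = 0 the shifts up and down are averaged. *)
Theorem Fourier_gauss_cauchy_approx (e Y eta0 tau0 xi : R) (w : C) :
  0 < e -> 0 < eta0 -> eta0 <= Im w <= Y -> 2 * Y <= / sqrt e -> 0 < tau0 ->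
  xi = 0 \/ tau0 <= Rabs xi ->
  Cmod (Fourier (gauss_cauchy e w) xi + upper_residue e xi w)
    <= fourier_err e eta0 tau0 * (1 + Cmod w) * exp (- (2 * PI * eta0 * Rabs xi)).
Proof.
  intros He Heta Hw HY Htau Hxi.
  set (n := / sqrt e) in *. assert (Hs : 0 < sqrt e) by now apply sqrt_lt_R0.
  assert (Hn : 0 < n) by now apply Rinv_0_lt_compat.
  assert (Es : / sqrt e = n) by reflexivity.
  assert (Es' : sqrt e = / n) by (unfold n; now rewrite Rinv_inv).
  assert (En : e * n ^ 2 = 1).
  { unfold n. rewrite <- (sqrt_sqrt e) at 1 by lra. field. lra. }
  assert (Hpi := PI_RGT_0). assert (He1 := exp_pos 1). assert (Hcw := Cmod_ge_0 w).
  set (D := exp (- (2 * PI * eta0 * Rabs xi))). assert (HD : 0 < D) by apply exp_pos.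
  set (Q := exp (- (2 * PI * ((n - eta0) * tau0)))). assert (HQ : 0 < Q) by apply exp_pos.
  assert (Err : fourier_err e eta0 tau0 = 4 * PI * exp 1 * (sqrt e + Q)) by reflexivity.
  (* Of the gain at height [n], the part belonging to [eta0] is kept for summability over the
     frequencies, and the rest is made uniform by [|xi| >= tau0]. *)
  assert (Dec : tau0 <= Rabs xi -> exp (- (2 * PI * (Rabs xi * n))) <= D * Q).
  { intros H. unfold D, Q. rewrite <- exp_plus.
    assert ((n - eta0) * tau0 <= (n - eta0) * Rabs xi) by (apply Rmult_le_compat_l; lra).
    assert (2 * PI * ((n - eta0) * tau0) <= 2 * PI * ((n - eta0) * Rabs xi)) by (apply Rmult_le_compat_l; lra).
    assert (- (2 * PI * (Rabs xi * n)) <= - (2 * PI * eta0 * Rabs xi) + - (2 * PI * ((n - eta0) * tau0))) by lra.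
    now apply exp_le_compat. }
  assert (Main : forall v, v <= 4 * PI * exp 1 * (D * Q) ->
    v <= fourier_err e eta0 tau0 * (1 + Cmod w) * D).
  { intros v Hv. rewrite Err. eapply Rle_trans; [apply Hv|].
    assert (0 < 4 * PI * exp 1) by (apply Rmult_lt_0_compat; lra).
    replace (4 * PI * exp 1 * (sqrt e + Q) * (1 + Cmod w) * D)
      with (4 * PI * exp 1 * ((sqrt e + Q) * (1 + Cmod w) * D)) by ring.
    apply Rmult_le_compat_l; [lra|]. rewrite (Rmult_comm D Q). apply Rmult_le_compat_r; [lra|].
    apply Rle_trans with (Q * 1); [lra|]. apply Rmult_le_compat; lra. }
  (* Lines at distance at least [n / 2] from [w] make the denominator cost [2 / n], which cancels
     the factor [1 / sqrt e = n] of the Lorentzian integral. The condition on [Y] guarantees this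
     distance. *)
  assert (Tail : forall t l, t = n \/ t = - n -> xi * t = - (Rabs xi * n) -> tau0 <= Rabs xi ->
    n / 2 <= Rabs (Im w - t) ->
    Cmod l <= 2 * PI * (exp (e * t ^ 2 + 2 * PI * xi * t) / Rabs (Im w - t)) / sqrt e ->
    Cmod l <= fourier_err e eta0 tau0 * (1 + Cmod w) * D).
  { intros t l Ht Hxt Htx Hd Hl. specialize (Dec Htx). apply Main. eapply Rle_trans; [apply Hl|].
    replace (e * t ^ 2 + 2 * PI * xi * t) with (1 + - (2 * PI * (Rabs xi * n))).
    2:{ replace (2 * PI * xi * t) with (2 * PI * (xi * t)) by ring. rewrite Hxt.
        replace (e * t ^ 2) with 1 by (destruct Ht as [->| ->]; rewrite <- En; ring). ring. }
    rewrite exp_plus. set (E := exp (- (2 * PI * (Rabs xi * n)))) in *.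
    assert (HE : 0 < E) by apply exp_pos.
    assert (X : n / Rabs (Im w - t) <= 2) by (apply Rle_div_l; lra).
    assert (X0 : 0 <= n / Rabs (Im w - t)) by (apply Rdiv_le_0_compat; lra).
    replace (2 * PI * (exp 1 * E / Rabs (Im w - t)) / sqrt e)
      with (2 * PI * exp 1 * E * (n / Rabs (Im w - t))) by (unfold Rdiv; rewrite Es; ring).
    replace (4 * PI * exp 1 * (D * Q)) with (2 * PI * exp 1 * (D * Q) * 2) by ring.
    assert (P0 : 0 <= 2 * PI * exp 1) by (apply Rmult_le_pos; lra).
    apply Rmult_le_compat; auto; [apply Rmult_le_pos; lra|now apply Rmult_le_compat_l]. }
  destruct (Rtotal_order xi 0) as [Lt|[E0|Gt]].
  - destruct Hxi as [h|Hxi]; [lra|].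
    destruct (gauss_wave_line_int e xi n w He) as [l [Hl Bl]]; [lra|].
    rewrite (gauss_wave_shift_up e xi n w l) by (auto; lra).
    unfold upper_residue. destruct (Rle_dec xi 0) as [_|h]; [|lra].
    unfold prime_weight. destruct (Req_EM_T xi 0) as [h|_]; [lra|].
    replace (l - RtoC (2 * PI) * Ci * gauss_wave e xi w
      + RtoC (2 * PI) * Ci * (1 * gauss_wave e xi w))%C with l by ring.
    apply (Tail n); auto; rewrite ?Rabs_left by lra; lra.
  - rewrite E0 in *. clear Dec Tail Hxi.
    assert (D1 : D = 1) by (unfold D; rewrite E0, Rabs_R0, Rmult_0_r, Ropp_0; apply exp_0).
    destruct (gauss_wave_line_int e 0 n w He) as [l1 [Hl1 _]]; [lra|].
    destruct (gauss_wave_line_int e 0 (- n) w He) as [l2 [Hl2 _]]; [lra|].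
    assert (Up := gauss_wave_shift_up e 0 n w l1 He ltac:(lra) ltac:(lra) Hl1).
    assert (Dn := gauss_wave_shift_down e 0 n w l2 He ltac:(lra) Hn Hl2).
    unfold upper_residue. destruct (Rle_dec 0 0) as [_|h]; [|lra].
    unfold prime_weight. destruct (Req_EM_T 0 0) as [_|h]; [|lra].
    set (Phi := Fourier (gauss_cauchy e w) 0) in *.
    (* [Phi] equals [l2], and also [l1] minus the residue; the mean of the two contains half of the
       residue, in accordance with [prime_weight 0]. *)
    assert (P2 : (Phi + RtoC (2 * PI) * Ci * (RtoC (1 / 2) * gauss_wave e 0 w)
      = RtoC (1 / 2) * (l1 + l2))%C).
    { replace l1 with (Phi + RtoC (2 * PI) * Ci * gauss_wave e 0 w)%C by (rewrite Up; ring).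
      rewrite <- Dn. unfold Rdiv. rewrite Rmult_1_l, RtoC_inv. field.
      lra. }
    rewrite P2, Cmod_mult, Cmod_R, Rabs_right by lra.
    assert (Pc1 : forall s, Pcont (fun s => gauss_wave e 0 (s, n) / (w - (s, n)))%C s)
      by (apply gauss_wave_line_bounded; auto; lra).
    assert (Pc2 : forall s, Pcont (fun s => gauss_wave e 0 (s, (- n)%R) / (w - (s, (- n)%R)))%C s)
      by (apply gauss_wave_line_bounded; auto; lra).
    assert (Pc1' : forall s, Pcont (fun s => gauss_wave e 0 ((- s)%R, n) / (w - ((- s)%R, n)))%C s).
    { intros s. exact (Pcont_reflect _ s (Pc1 (- s))). }
    assert (Hl1' := is_line_int_reflect _ _ Pc1 Hl1).
    assert (Sum := is_line_int_plus _ _ _ _ Pc1' Pc2 Hl1' Hl2).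
    (* Once the upper integral is reflected, both integrands carry the same Gaussian and leave the
       numerator [2 w]; the denominators are at least [n] and [n / 2]. *)
    set (K := exp 1 * (2 * Cmod w) / (n * (n / 2))).
    assert (HK : 0 <= K).
    { apply Rdiv_le_0_compat; [|nra]. apply Rmult_le_pos; lra. }
    assert (LB : lorentz_bounded (fun s => gauss_wave e 0 ((- s)%R, n) / (w - ((- s)%R, n))
        + gauss_wave e 0 (s, (- n)%R) / (w - (s, (- n)%R)))%C K e).
    { split.
      - intros s. exact (Pcont_plus _ _ s (Pc1' s) (Pc2 s)).
      - intros s. set (u := (s, (- n)%R) : C).
        replace (((- s)%R, n) : C) with (- u)%C by (unfold u, Copp; simpl; f_equal; ring).
        rewrite gauss_wave_even.
        assert (W1 : n <= Cmod (w - u)).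
        { eapply Rle_trans; [|apply (Rabs_im_le_Cmod (w - u))].
          replace (Im (w - u)) with (Im w + n) by (unfold u, Im; simpl; ring).
          rewrite Rabs_right; lra. }
        assert (W2 : n / 2 <= Cmod (w - - u)).
        { eapply Rle_trans; [|apply (Rabs_im_le_Cmod (w - - u))].
          replace (Im (w - - u)) with (Im w - n) by (unfold u, Im; simpl; ring).
          rewrite Rabs_left; lra. }
        assert (N1 : (w - u)%C <> RtoC 0) by (apply Cmod_gt_0; lra).
        assert (N2 : (w - - u)%C <> RtoC 0) by (apply Cmod_gt_0; lra).
        replace (gauss_wave e 0 u / (w - - u) + gauss_wave e 0 u / (w - u))%C
          with (gauss_wave e 0 u * (RtoC 2 * w) / ((w - u) * (w - - u)))%C by (field; auto).
        rewrite Cmod_div by now apply Cmult_neq_0. rewrite !Cmod_mult, Cmod_R, (Rabs_right 2) by lra.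
        unfold u at 1. rewrite Cmod_gauss_wave.
        replace (e * (- n) ^ 2 + 2 * PI * 0 * - n) with 1 by (rewrite <- En; ring).
        assert (Qs : 0 <= e * s ^ 2) by (generalize (pow2_ge_0 s); nra).
        assert (X := exp_neg_le _ Qs).
        apply Rle_trans with (/ (1 + e * s ^ 2) * exp 1 * (2 * Cmod w) / (n * (n / 2))).
        + apply Rdiv_le_compat.
          * apply Rmult_le_pos; [|lra]. apply Rmult_le_pos; left; apply exp_pos.
          * apply Rmult_le_compat_r; [lra|]. apply Rmult_le_compat_r; lra.
          * nra.
          * apply Rmult_le_compat; lra.
        + right. unfold K. field. split; lra. }
    assert (B := is_line_int_bound _ _ (2 * PI * K / sqrt e) Sum).
    specialize (B ltac:(intros a b Hab; apply lorentz_bound; auto)).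
    rewrite Err, D1.
    apply Rle_trans with (1 / 2 * (2 * PI * K / sqrt e)); [apply Rmult_le_compat_l; lra|].
    replace (1 / 2 * (2 * PI * K / sqrt e)) with (4 * PI * exp 1 * (sqrt e * Cmod w)).
    + replace (4 * PI * exp 1 * (sqrt e + Q) * (1 + Cmod w) * 1)
        with (4 * PI * exp 1 * ((sqrt e + Q) * (1 + Cmod w))) by ring.
      apply Rmult_le_compat_l; [apply Rmult_le_pos; lra|].
      apply Rmult_le_compat; lra.
    + unfold K. rewrite Es'. field. lra.
  - destruct Hxi as [h|Hxi]; [lra|].
    destruct (gauss_wave_line_int e xi (- n) w He) as [l [Hl Bl]]; [lra|].
    rewrite (gauss_wave_shift_down e xi n w l) by (auto; lra).
    unfold upper_residue. destruct (Rle_dec xi 0) as [h|_]; [lra|].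
    replace (l + 0)%C with l by ring.
    apply (Tail (- n)); auto; rewrite ?Rabs_right by lra; lra.
Qed.

(** * Regularised partial fractions *)

Lemma prime_weight_bounds (t : R) : 1 / 2 <= prime_weight t <= 1.
Proof. unfold prime_weight. destruct (Req_EM_T t 0); lra. Qed.

Lemma Cmod_E_term (h : R -> R -> C) (x : R) (z : C) (t : R) :
  Cmod (E_term h x z t) = prime_weight t * (Cmod (h t x) * exp (2 * PI * t * Im z)).
Proof.
  unfold E_term. rewrite !Cmod_mult, Cmod_R, Cmod_Cexp, Rabs_right.
  - do 3 f_equal. simpl. unfold Im. ring.
  - generalize (prime_weight_bounds t). lra.
Qed.

Definition is_sign (s : R) : Prop := s = 1 \/ s = -1.

(** At [z = i s eta0] the exponential in [E_term] has modulus [exp (- 2 pi eta0 |t|)] because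
    [- s t >= 0]; the factor 2 undoes the weight 1/2 at [t = 0]. *)
Lemma side_sums_bounded (Ls : R -> Prop) (h : R -> R -> C) (eta0 x s : R) : is_sign s ->
  abs_summable (E_index Ls s) (E_term h x (0, s * eta0)) ->
  exists B, forall l, finite_part (E_index Ls s) l ->
    Rsum (fun t => Cmod (h t x) * exp (- (2 * PI * eta0 * Rabs t))) l <= B.
Proof.
  intros Hs [B H]. exists (2 * B). intros l Hl.
  apply Rle_trans with (2 * Rsum (fun t => Cmod (E_term h x (0, s * eta0) t)) l).
  - rewrite <- Rsum_scal. apply Rsum_le. intros t Ht. destruct (proj2 Hl t Ht) as [_ Hst].
    rewrite Cmod_E_term. simpl Im.
    replace (2 * PI * t * (s * eta0)) with (- (2 * PI * eta0 * Rabs t)).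
    2:{ destruct Hs as [-> | ->]; [rewrite Rabs_left1 by lra|rewrite Rabs_right by lra]; ring. }
    set (u := Cmod (h t x) * exp (- (2 * PI * eta0 * Rabs t))).
    assert (0 <= u) by (apply Rmult_le_pos; [apply Cmod_ge_0|left; apply exp_pos]).
    generalize (prime_weight_bounds t). nra.
  - apply Rmult_le_compat_l; [lra|]. now apply H.
Qed.

(** With this bound the frequency-wise errors of the Fourier transforms can be summed against
    [h]. *)
Lemma coefficient_sums_bounded (Ls : R -> Prop) (h : R -> R -> C) (eta0 x : R) :
  (forall s, is_sign s -> abs_summable (E_index Ls s) (E_term h x (0, s * eta0))) ->
  exists B, 0 <= B /\ forall l, finite_part Ls l ->
    Rsum (fun t => Cmod (h t x) * exp (- (2 * PI * eta0 * Rabs t))) l <= B.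
Proof.
  intros H.
  destruct (side_sums_bounded Ls h eta0 x 1 ltac:(now left) (H 1 ltac:(now left))) as [B1 H1].
  destruct (side_sums_bounded Ls h eta0 x (-1) ltac:(now right) (H (-1) ltac:(now right))) as [B2 H2].
  set (p := fun t => if Rle_dec t 0 then true else false).
  assert (K : forall l, finite_part Ls l ->
    Rsum (fun t => Cmod (h t x) * exp (- (2 * PI * eta0 * Rabs t))) l <= B1 + B2).
  { intros l [N I]. rewrite <- (Rsum_perm _ _ _ (filter_perm p l)), Rsum_app.
    apply Rplus_le_compat; [apply H1|apply H2]; (split; [now apply NoDup_filter|]);
      intros t Ht; apply filter_In in Ht; destruct Ht as [Ht E]; unfold p in E;
      destruct (Rle_dec t 0); try discriminate; split; auto; lra. }
  exists (B1 + B2). split; auto. apply (K nil). split; [constructor|intros a []].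
Qed.

(** Only the elements of modulus at most 1 matter, and they are finitely many. The gap gives one
    rate of decay for all nonzero frequencies. *)
Lemma locally_finite_gap (A : R -> Prop) : locally_finite A ->
  exists tau, 0 < tau /\ forall a, A a -> a = 0 \/ tau <= Rabs a.
Proof.
  intros H. destruct (H 1) as [l Hl].
  assert (G : exists tau, 0 < tau /\ forall a, In a l -> a = 0 \/ tau <= Rabs a).
  { clear Hl. induction l as [|b l [tau [Ht IH]]]; [exists 1; split; [lra|intros a []]|].
    destruct (Req_dec b 0) as [E|N].
    - exists tau. split; auto. intros a [<-|Ha]; auto.
    - exists (Rmin tau (Rabs b)). split; [apply Rmin_pos; auto; now apply Rabs_pos_lt|].
      intros a [<-|Ha]; [right; apply Rmin_r|].
      destruct (IH a Ha) as [E|E]; auto. right. eapply Rle_trans; [apply Rmin_l|auto]. }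
  destruct G as [tau [Ht G]]. exists (Rmin tau 1). split; [apply Rmin_pos; lra|].
  intros a Ha. destruct (Rle_dec (Rabs a) 1) as [Le|Gt].
  - destruct (G a (Hl a Ha Le)) as [E|E]; auto. right. eapply Rle_trans; [apply Rmin_l|auto].
  - right. eapply Rle_trans; [apply Rmin_r|lra].
Qed.

Lemma prime_weight_opp (t : R) : prime_weight (- t) = prime_weight t.
Proof.
  unfold prime_weight. destruct (Req_EM_T (- t) 0), (Req_EM_T t 0); auto; lra.
Qed.

Lemma gauss_wave_opp (e xi : R) (w : C) : gauss_wave e (- xi) (- w)%C = gauss_wave e xi w.
Proof. unfold gauss_wave. f_equal. rewrite (RtoC_opp xi). ring. Qed.

(** Up to the Gaussian in [w] and the coefficient [h], this is [2 pi i] times a term of [E_s],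
    extended by 0 outside its index set. *)
Definition side_residue (s e xi : R) (w : C) : C :=
  if Rle_dec 0 (- s * xi)
  then (RtoC (2 * PI) * Ci * (RtoC (prime_weight xi) * gauss_wave e xi w))%C else RtoC 0.

Lemma Fourier_side_approx (s e Y eta0 tau0 xi : R) (w : C) : is_sign s ->
  0 < e -> 0 < eta0 -> eta0 <= s * Im w <= Y -> 2 * Y <= / sqrt e -> 0 < tau0 ->
  xi = 0 \/ tau0 <= Rabs xi ->
  Cmod (RtoC s * Fourier (gauss_cauchy e w) xi + side_residue s e xi w)
    <= fourier_err e eta0 tau0 * (1 + Cmod w) * exp (- (2 * PI * eta0 * Rabs xi)).
Proof.
  intros [-> | ->] He Heta Hw HY Htau Hxi.
  - assert (X := Fourier_gauss_cauchy_approx e Y eta0 tau0 xi w He Heta ltac:(lra) HY Htau Hxi).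
    replace (side_residue 1 e xi w) with (upper_residue e xi w).
    + replace (1 * Fourier (gauss_cauchy e w) xi)%C with (Fourier (gauss_cauchy e w) xi) by ring. exact X.
    + unfold upper_residue, side_residue. destruct (Rle_dec xi 0), (Rle_dec 0 (-(1) * xi)); auto; lra.
  - assert (Im (- w)%C = - Im w) as Ew by reflexivity.
    assert (Hxi' : - xi = 0 \/ tau0 <= Rabs (- xi)) by (rewrite Rabs_Ropp; destruct Hxi; [left; lra|auto]).
    assert (X := Fourier_gauss_cauchy_approx e Y eta0 tau0 (- xi) (- w)%C He Heta ltac:(lra) HY Htau Hxi').
    rewrite Rabs_Ropp, Cmod_opp in X.
    replace (side_residue (-1) e xi w) with (upper_residue e (- xi) (- w)%C).
    + rewrite Fourier_gauss_cauchy_reflect by (auto; lra).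
      replace (RtoC (-1) * - Fourier (gauss_cauchy e (- w)) (- xi)%R)%C
        with (Fourier (gauss_cauchy e (- w)%C) (- xi)). exact X.
      replace (RtoC (-1)) with (- RtoC 1)%C by (rewrite <- RtoC_opp; f_equal; ring). ring.
    + unfold upper_residue, side_residue. rewrite prime_weight_opp, gauss_wave_opp.
      destruct (Rle_dec (- xi) 0), (Rle_dec 0 (- -1 * xi)); auto; lra.
Qed.

Lemma is_usum_iff (A A' : R -> Prop) (F : R -> C) (S : C) : (forall a, A a <-> A' a) ->
  is_usum A F S -> is_usum A' F S.
Proof.
  intros E H e He. destruct (H e He) as [l0 [[H1 H2] K]]. exists l0. split.
  - split; auto. intros a Ha. now apply E, H2.
  - intros l [H3 H4] Hi. apply K; auto. split; auto. intros a Ha. now apply E, H4.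
Qed.

(** Termwise, the difference is [(s Fourier + side_residue) h]. Its Fourier factor is small
    uniformly in the frequency, up to the exponential that makes the coefficients summable. *)
Lemma dual_sum_approx (Ls : R -> Prop) (h : R -> R -> C) (s e Y eta0 tau0 x B : R) (w S2 SE : C) :
  is_sign s -> 0 < e -> 0 < eta0 -> eta0 <= s * Im w <= Y -> 2 * Y <= / sqrt e -> 0 < tau0 ->
  (forall a, Ls a -> a = 0 \/ tau0 <= Rabs a) ->
  (forall l, finite_part Ls l ->
    Rsum (fun t => Cmod (h t x) * exp (- (2 * PI * eta0 * Rabs t))) l <= B) ->
  is_usum Ls (fun t => Cmult (Fourier (gauss_cauchy e w) t) (h t x)) S2 ->
  is_usum (E_index Ls s) (E_term h x w) SE ->
  Cmod (RtoC s * S2 + RtoC (2 * PI) * Ci * Cexp (RtoC (- e) * (w * w)) * SE)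
    <= fourier_err e eta0 tau0 * (1 + Cmod w) * B.
Proof.
  intros Hs He Heta Hw HY Htau Hgap HB H2 HE.
  set (p := fun t => if Rle_dec 0 (- s * t) then true else false).
  set (c := (RtoC (2 * PI) * Ci * Cexp (RtoC (- e) * (w * w)))%C).
  assert (HE' : is_usum Ls (fun t => if p t then E_term h x w t else RtoC 0) SE).
  { apply is_usum_extend. revert HE. apply is_usum_iff. intros a. unfold E_index, p.
    destruct (Rle_dec 0 (- s * a)); intuition; discriminate. }
  assert (U := is_usum_minus _ _ _ _ _ (is_usum_scal _ _ (RtoC s) _ H2) (is_usum_scal _ _ (- c)%C _ HE')).
  replace (RtoC s * S2 + c * SE)%C with (RtoC s * S2 - - c * SE)%C by ring.
  set (k := fourier_err e eta0 tau0 * (1 + Cmod w)).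
  assert (Hk : 0 <= k).
  { unfold k, fourier_err. assert (Hpi := PI_RGT_0). assert (H1 := exp_pos 1).
    assert (Hq := exp_pos (- (2 * PI * ((/ sqrt e - eta0) * tau0)))).
    assert (Hse := sqrt_pos e). assert (Hcw := Cmod_ge_0 w).
    apply Rmult_le_pos; [|lra]. apply Rmult_le_pos; [|lra]. apply Rmult_le_pos; lra. }
  apply (is_usum_bound _ _ _ _ U). intros l Hl.
  eapply Rle_trans; [apply Cmod_Csum_le|].
  apply Rle_trans with (k * Rsum (fun t => Cmod (h t x) * exp (- (2 * PI * eta0 * Rabs t))) l).
  - rewrite <- Rsum_scal. apply Rsum_le. intros t Ht.
    assert (X := Fourier_side_approx s e Y eta0 tau0 t w Hs He Heta Hw HY Htau (Hgap t (proj2 Hl t Ht))).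
    fold k in X.
    replace (RtoC s * (Fourier (gauss_cauchy e w) t * h t x) - - c * (if p t then E_term h x w t else 0))%C
      with ((RtoC s * Fourier (gauss_cauchy e w) t + side_residue s e t w) * h t x)%C.
    + rewrite Cmod_mult.
      replace (k * (Cmod (h t x) * exp (- (2 * PI * eta0 * Rabs t))))
        with (k * exp (- (2 * PI * eta0 * Rabs t)) * Cmod (h t x)) by ring.
      apply Rmult_le_compat_r; [apply Cmod_ge_0|auto].
    + unfold side_residue, p, c, E_term. destruct (Rle_dec 0 (- s * t)); [|ring].
      unfold gauss_wave. rewrite Cexp_plus. ring.
  - apply Rmult_le_compat_l; auto.
Qed.

(* The factor exp(e z^2) makes the residues independent of e. *)
Definition pfrac (g : R -> R -> C) (x e : R) (l : list R) (z : C) : C :=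
  (Cexp (RtoC e * (z * z))
   * (gauss_cauchy e z x - Csum (fun lam => gauss_cauchy e z lam * g lam x) l))%C.

Lemma Cmod_Cexp_sqr (e : R) (z : C) :
  Cmod (Cexp (RtoC e * (z * z))) = exp (e * (Re z ^ 2 - Im z ^ 2)).
Proof. rewrite Cmod_Cexp. f_equal. destruct z. simpl. ring. Qed.

Lemma Cexp_sqr_inv (e : R) (z : C) :
  (Cexp (RtoC e * (z * z)) * Cexp (RtoC (- e) * (z * z)))%C = RtoC 1.
Proof. rewrite <- Cexp_plus, <- Cexp_0. f_equal. rewrite RtoC_opp. ring. Qed.

(** The factor does not depend on [a], so a truncation chosen at the single point [i eta0] controls
    the discarded terms at every [z] off the strip. It follows from
    [|i eta0 - a| <= |i eta0 - z| + |z - a|]. *)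
Lemma gauss_cauchy_compare (e eta0 a : R) (z : C) : 0 < eta0 -> eta0 <= Rabs (Im z) ->
  Cmod (gauss_cauchy e z a) <= (2 + Cmod z / eta0) * Cmod (gauss_cauchy e (0, eta0) a).
Proof.
  intros Heta Hz.
  assert (Z1 : eta0 <= Cmod (z - RtoC a)).
  { eapply Rle_trans; [apply Hz|]. replace (Im z) with (Im (z - RtoC a)) by (unfold Im; simpl; ring).
    apply Rabs_im_le_Cmod. }
  assert (Z0 : 0 < Cmod ((0, eta0) - RtoC a)).
  { eapply Rlt_le_trans; [apply Heta|]. eapply Rle_trans; [|apply Rabs_im_le_Cmod].
    simpl. rewrite Rabs_right; lra. }
  assert (M0 : Cmod (0, eta0) <= eta0).
  { eapply Rle_trans; [apply Cmod_le_abs|]. simpl. rewrite Rabs_R0, Rabs_right; lra. }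
  assert (Hc := Cmod_ge_0 z).
  assert (K : Cmod ((0, eta0) - RtoC a) <= (2 + Cmod z / eta0) * Cmod (z - RtoC a)).
  { replace ((0, eta0) - RtoC a)%C with (((0, eta0) - z) + (z - RtoC a))%C by ring.
    assert (T1 := Cmod_triangle ((0, eta0) - z) (z - RtoC a)).
    assert (T2 := Cmod_triangle_sub (0, eta0) z).
    assert (eta0 + Cmod z <= (1 + Cmod z / eta0) * Cmod (z - RtoC a)); [|lra].
    apply Rle_trans with ((1 + Cmod z / eta0) * eta0).
    - right. field. lra.
    - apply Rmult_le_compat_l; auto. assert (0 <= Cmod z / eta0) by (apply Rdiv_le_0_compat; lra). lra. }
  unfold gauss_cauchy. rewrite !Cmod_div by (apply Cmod_gt_0; lra).
  set (A := Cmod (RtoC (exp (- e * a ^ 2)))). assert (HA : 0 <= A) by apply Cmod_ge_0.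
  apply Rle_div_l; [lra|].
  replace ((2 + Cmod z / eta0) * (A / Cmod ((0, eta0) - RtoC a)) * Cmod (z - RtoC a))
    with (A * ((2 + Cmod z / eta0) * Cmod (z - RtoC a) / Cmod ((0, eta0) - RtoC a))) by (field; lra).
  rewrite <- (Rmult_1_r A) at 1. apply Rmult_le_compat_l; auto.
  apply Rle_div_r; lra.
Qed.

(** [(1 + |z|) (2 + 1/eta0)] dominates the factor [2 + |z|/eta0] of [gauss_cauchy_compare], so that
    both errors can share [1 + |z|]. *)
Definition pfrac_err (e eta0 tau0 B d : R) : R := fourier_err e eta0 tau0 * B + (2 + / eta0) * d.

(** Multiplying the interpolation formula by [e^(e z^2)] cancels the Gaussian that [dual_sum_approx]
    leaves in front of [E_s]. The errors are that of the dual side and the discarded terms over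
    [L]. *)
Lemma pfrac_approx (L Ls : R -> Prop) (g h : R -> R -> C) (s e Y eta0 tau0 x B d : R)
    (l : list R) (z v S1 S2 : C) :
  is_sign s -> 0 < e -> 0 < eta0 -> eta0 <= s * Im z <= Y -> 2 * Y <= / sqrt e -> 0 < tau0 ->
  (forall a, Ls a -> a = 0 \/ tau0 <= Rabs a) ->
  (forall l, finite_part Ls l ->
    Rsum (fun t => Cmod (h t x) * exp (- (2 * PI * eta0 * Rabs t))) l <= B) ->
  is_usum L (fun lam => Cmult (gauss_cauchy e z lam) (g lam x)) S1 ->
  is_usum Ls (fun t => Cmult (Fourier (gauss_cauchy e z) t) (h t x)) S2 ->
  gauss_cauchy e z x = Cplus S1 S2 ->
  0 <= d -> finite_part L l ->
  (forall k, finite_part L k -> (forall a, In a k -> ~ In a l) ->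
    Rsum (fun lam => Cmod (gauss_cauchy e (0, eta0) lam * g lam x)) k <= d) ->
  is_E Ls h s x z v ->
  Cmod (RtoC s * pfrac g x e l z + v)
    <= exp (e * Re z ^ 2) * (1 + Cmod z) * pfrac_err e eta0 tau0 B d.
Proof.
  intros Hs He Heta Hz HY Htau Hgap HB H1 H2 Hx Hd Hl Ht [SE [HE ->]].
  assert (X2 := dual_sum_approx Ls h s e Y eta0 tau0 x B z S2 SE Hs He Heta Hz HY Htau Hgap HB H2 HE).
  assert (Az : eta0 <= Rabs (Im z)).
  { destruct Hs as [-> | ->].
    - rewrite Rabs_right; lra.
    - rewrite Rabs_left; lra. }
  set (q := 2 + Cmod z / eta0).
  assert (Hcz := Cmod_ge_0 z).
  assert (Hq : 0 <= q) by (unfold q; assert (0 <= Cmod z / eta0) by (apply Rdiv_le_0_compat; lra); lra).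
  assert (X1 : Cmod (S1 - Csum (fun lam => gauss_cauchy e z lam * g lam x)%C l) <= q * d).
  { apply (is_usum_tail L _ _ _ l H1 Hl). intros k Hk Hdis.
    apply Rle_trans with (q * Rsum (fun lam => Cmod (gauss_cauchy e (0, eta0) lam * g lam x)) k).
    - rewrite <- Rsum_scal. apply Rsum_le. intros a _. rewrite !Cmod_mult.
      assert (C := gauss_cauchy_compare e eta0 a z Heta Az). fold q in C.
      rewrite <- Rmult_assoc. apply Rmult_le_compat_r; [apply Cmod_ge_0|auto].
    - apply Rmult_le_compat_l; auto. }
  set (D := (S1 - Csum (fun lam => gauss_cauchy e z lam * g lam x)%C l)%C) in *.
  assert (E : (RtoC s * pfrac g x e l z + RtoC (2 * PI) * Ci * SE
    = Cexp (RtoC e * (z * z)) * ((RtoC s * S2 + RtoC (2 * PI) * Ci * Cexp (RtoC (- e) * (z * z)) * SE)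
       + RtoC s * D))%C).
  { unfold pfrac, D. rewrite Hx.
    replace (RtoC (2 * PI) * Ci * SE)%C
      with ((Cexp (RtoC e * (z * z)) * Cexp (RtoC (- e) * (z * z))) * (RtoC (2 * PI) * Ci * SE))%C
      by (rewrite Cexp_sqr_inv; ring).
    ring. }
  rewrite E, Cmod_mult, Cmod_Cexp_sqr, Rmult_assoc.
  apply Rmult_le_compat; [left; apply exp_pos|apply Cmod_ge_0| |].
  - assert (e * (Re z ^ 2 - Im z ^ 2) <= e * Re z ^ 2).
    { apply Rmult_le_compat_l; [lra|]. generalize (pow2_ge_0 (Im z)). lra. }
    now apply exp_le_compat.
  - eapply Rle_trans; [apply Cmod_triangle|]. rewrite (Cmod_mult (RtoC s)), Cmod_R.
    replace (Rabs s) with 1.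
    2:{ destruct Hs as [-> | ->]; [rewrite Rabs_right; lra|rewrite Rabs_left; lra]. }
    unfold pfrac_err. rewrite Rmult_plus_distr_l.
    assert (q * d <= (1 + Cmod z) * ((2 + / eta0) * d)); [|lra].
    rewrite <- Rmult_assoc. apply Rmult_le_compat_r; auto. unfold q, Rdiv.
    assert (0 < / eta0) by now apply Rinv_0_lt_compat. nra.
Qed.

(** With [e = q^2] and [q <= 1/(2 eta0)] the exponent is at least [pi tau0 / q], and
    [e^(-u) <= 1/(1 + u)] makes the whole error linear in [q]. *)
Lemma fourier_err_small (eta0 tau0 d : R) : 0 < eta0 -> 0 < tau0 -> 0 < d ->
  exists q0, 0 < q0 /\ forall q, 0 < q <= q0 -> fourier_err (q ^ 2) eta0 tau0 <= d.
Proof.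
  intros Heta Htau Hd. assert (Hpi := PI_RGT_0). assert (H1 := exp_pos 1).
  set (A := 4 * PI * exp 1 * (1 + / (PI * tau0))).
  assert (Hpt : 0 < PI * tau0) by now apply Rmult_lt_0_compat.
  assert (Hi : 0 < / (PI * tau0)) by now apply Rinv_0_lt_compat.
  assert (HA : 0 < A).
  { unfold A. apply Rmult_lt_0_compat; [|lra]. apply Rmult_lt_0_compat; lra. }
  exists (Rmin (/ (2 * eta0)) (d / A)). split.
  { apply Rmin_pos; [apply Rinv_0_lt_compat; lra|now apply Rdiv_lt_0_compat]. }
  intros q [Hq Hle].
  assert (L1 := Rle_trans _ _ _ Hle (Rmin_l _ _)). assert (L2 := Rle_trans _ _ _ Hle (Rmin_r _ _)).
  unfold fourier_err. replace (sqrt (q ^ 2)) with q by (symmetry; apply sqrt_pow2; lra).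
  assert (E : 2 * eta0 <= / q).
  { rewrite <- (Rinv_inv (2 * eta0)). apply Rinv_le_contravar; auto. }
  assert (Iq : 0 < / q) by now apply Rinv_0_lt_compat.
  assert (U : PI * tau0 / q <= 2 * PI * ((/ q - eta0) * tau0)).
  { replace (PI * tau0 / q) with (2 * PI * ((/ q / 2) * tau0)) by (field; lra).
    apply Rmult_le_compat_l; [lra|]. apply Rmult_le_compat_r; lra. }
  assert (U0 : 0 < PI * tau0 / q) by now apply Rdiv_lt_0_compat.
  assert (X : exp (- (2 * PI * ((/ q - eta0) * tau0))) <= q / (PI * tau0)).
  { eapply Rle_trans; [apply exp_neg_le; lra|].
    replace (q / (PI * tau0)) with (/ (PI * tau0 / q)) by (field; split; lra).
    apply Rinv_le_contravar; lra. }
  apply Rle_trans with (A * q).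
  - replace (A * q) with (4 * PI * exp 1 * ((1 + / (PI * tau0)) * q)) by (unfold A; ring).
    apply Rmult_le_compat_l; [apply Rmult_le_pos; lra|]. unfold Rdiv in X. lra.
  - apply Rle_div_r in L2; auto. lra.
Qed.

(** All that the limit process uses of the interpolation formula. A point of [L] with zero
    coefficient need never enter the lists, whence the disjunction; the approximation is uniform
    only up to the stated growth in [z] and for bounded [Im z]. *)
Definition pfrac_good (L Ls : R -> Prop) (g h : R -> R -> C) (eta0 x c : R)
    (e : nat -> R) (l : nat -> list R) : Prop :=
  (forall n, 0 < e n <= c) /\ (forall n, finite_part L (l n)) /\
  (forall lam, L lam -> exists N, forall n, (N <= n)%nat -> In lam (l n) \/ g lam x = RtoC 0) /\
  (forall Y d, 0 < d -> exists N, forall n, (N <= n)%nat -> forall s z v, is_sign s ->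
     eta0 <= s * Im z <= Y -> is_E Ls h s x z v ->
     Cmod (RtoC s * pfrac g x (e n) (l n) z + v) <= exp (e n * Re z ^ 2) * (1 + Cmod z) * d).

Lemma pfrac_good_exists (L Ls : R -> Prop) (g h : R -> R -> C) (eta0 x c : R) :
  0 < eta0 -> 0 < c -> locally_finite Ls ->
  (forall s, is_sign s -> abs_summable (E_index Ls s) (E_term h x (0, s * eta0))) ->
  (forall (eps : R) (z : C), 0 < eps -> eta0 <= Rabs (Im z) ->
      exists S1 S2 : C,
        is_usum L (fun lam => Cmult (gauss_cauchy eps z lam) (g lam x)) S1 /\
        is_usum Ls (fun t => Cmult (Fourier (gauss_cauchy eps z) t) (h t x)) S2 /\
        gauss_cauchy eps z x = Cplus S1 S2) ->
  exists e l, pfrac_good L Ls g h eta0 x c e l.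
Proof.
  intros Heta Hc HLs Hsum Hi.
  destruct (coefficient_sums_bounded Ls h eta0 x Hsum) as [B [HB0 HB]].
  destruct (locally_finite_gap Ls HLs) as [tau0 [Htau Hgap]].
  set (k := Rmin 1 c). assert (Hk : 0 < k) by (apply Rmin_pos; lra).
  assert (K1 : k <= 1) by apply Rmin_l. assert (K2 : k <= c) by apply Rmin_r.
  (* [q n] is [sqrt (e n)]; the factor [k = min 1 c] yields both [q n <= 1/(n + 1)] and
     [e n <= c]. *)
  set (q := fun n => k * / INR (S n)).
  assert (Hin : forall n, 0 < / INR (S n)) by (intros n; apply Rinv_0_lt_compat, lt_0_INR; lia).
  assert (Hin1 : forall n, / INR (S n) <= 1).
  { intros n. rewrite <- Rinv_1. apply Rinv_le_contravar; [lra|].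
    rewrite <- INR_1. apply le_INR. lia. }
  assert (Hq : forall n, 0 < q n) by (intros n; apply Rmult_lt_0_compat; auto).
  assert (Hqi : forall n, q n <= / INR (S n)).
  { intros n. unfold q. specialize (Hin n). nra. }
  set (e := fun n => q n ^ 2).
  assert (He : forall n, 0 < e n <= c).
  { intros n. specialize (Hq n). specialize (Hqi n). specialize (Hin1 n). specialize (Hin n).
    split; unfold e; [nra|]. assert (q n <= k) by (unfold q; nra). simpl. nra. }
  assert (Hse : forall n, sqrt (e n) = q n) by (intros n; apply sqrt_pow2; left; apply Hq).
  destruct (choice (fun n l => finite_part L l /\
    forall k, finite_part L k -> (forall a, In a k -> ~ In a l) ->
      Rsum (fun lam => Cmod (gauss_cauchy (e n) (0, eta0) lam * g lam x)) k <= / INR (S n)))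
    as [l Hl].
  { intros n. destruct (Hi (e n) (0, eta0)) as (S1 & S2 & H1 & _ & _); [apply He|simpl; rewrite Rabs_right; lra|].
    apply (abs_summable_tail L _ (is_usum_abs_summable L _ S1 H1)), Hin. }
  exists e, l. repeat split.
  - apply He.
  - apply He.
  - apply Hl.
  - intros a Ha. now apply (proj1 (Hl n)).
  - intros lam Hlam. destruct (Ceq_dec (g lam x) 0) as [Z|NZ]; [exists O; auto|].
    apply Cmod_gt_0 in NZ.
    assert (Z0 : 0 < Cmod ((0, eta0) - RtoC lam)).
    { eapply Rlt_le_trans; [apply Heta|]. eapply Rle_trans; [|apply Rabs_im_le_Cmod].
      simpl. rewrite Rabs_right; lra. }
    (* Since [e n <= c], the modulus of the term of [lam] at [i eta0] stays above [m] for all [n];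
       once [1/(n + 1) < m], it cannot belong to a discarded tail. *)
    set (m := exp (- c * lam ^ 2) / Cmod ((0, eta0) - RtoC lam) * Cmod (g lam x)).
    assert (Hm : 0 < m).
    { apply Rmult_lt_0_compat; auto. apply Rdiv_lt_0_compat; auto. apply exp_pos. }
    destruct (inv_S_small m Hm) as [N HN]. exists N. intros n Hn. left.
    apply Classical_Prop.NNPP. intros Hni. specialize (HN n Hn).
    destruct (Hl n) as [_ Hk2].
    specialize (Hk2 (lam :: nil)). simpl in Hk2.
    assert (X : Cmod (gauss_cauchy (e n) (0, eta0) lam * g lam x) + 0 <= / INR (S n)).
    { apply Hk2; [split|].
      - constructor; [auto|constructor].
      - intros a [<-|[]]. auto.
      - intros a [<-|[]]. auto. }
    rewrite Cmod_mult in X. unfold gauss_cauchy in X.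
    rewrite Cmod_div, Cmod_R, Rabs_right in X;
      [|left; apply exp_pos|apply Cmod_gt_0; auto].
    assert (Y : m <= exp (- e n * lam ^ 2) / Cmod ((0, eta0) - RtoC lam) * Cmod (g lam x)).
    { apply Rmult_le_compat_r; [lra|]. apply Rmult_le_compat_r; [left; now apply Rinv_0_lt_compat|].
      assert (- c * lam ^ 2 <= - e n * lam ^ 2).
      { generalize (pow2_ge_0 lam) (He n). intros. nra. }
      now apply exp_le_compat. }
    lra.
  - intros Y d Hd.
    (* Half of [d] goes to the dual side, with [B + 1] since [B] may be 0, and half to the
       truncation; [N3] ensures that [1/sqrt (e n)] exceeds [2 Y]. *)
    destruct (fourier_err_small eta0 tau0 (d / (2 * (B + 1))) Heta Htau) as [q0 [Hq0 Kq]].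
    { apply Rdiv_lt_0_compat; lra. }
    assert (Hei : 0 < / eta0) by now apply Rinv_0_lt_compat.
    destruct (inv_S_small (d / (2 * (2 + / eta0)))) as [N1 HN1]; [apply Rdiv_lt_0_compat; lra|].
    destruct (inv_S_small q0 Hq0) as [N2 HN2].
    destruct (inv_S_small (/ (2 * Rabs Y + 1))) as [N3 HN3].
    { apply Rinv_0_lt_compat. generalize (Rabs_pos Y). lra. }
    exists (max N1 (max N2 N3)). intros n Hn s z v Hs Hz Hv.
    specialize (HN1 n ltac:(lia)). specialize (HN2 n ltac:(lia)). specialize (HN3 n ltac:(lia)).
    specialize (Hqi n). specialize (Hq n).
    destruct (Hi (e n) z) as (S1 & S2 & H1 & H2 & H3); [apply He| |].
    { destruct Hs as [-> | ->]; [rewrite Rabs_right; lra|rewrite Rabs_left; lra]. }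
    assert (HYn : 2 * Y <= / sqrt (e n)).
    { rewrite Hse. assert (A := Rle_abs Y). assert (A0 := Rabs_pos Y).
      apply Rle_trans with (2 * Rabs Y + 1); [lra|].
      rewrite <- (Rinv_inv (2 * Rabs Y + 1)). apply Rinv_le_contravar; lra. }
    destruct (Hl n) as [Hl1 Hl2].
    assert (X := pfrac_approx L Ls g h s (e n) Y eta0 tau0 x B (/ INR (S n)) (l n) z v S1 S2
      Hs (proj1 (He n)) Heta Hz HYn Htau Hgap HB H1 H2 H3 (Rlt_le _ _ (Hin n)) Hl1 Hl2 Hv).
    eapply Rle_trans; [apply X|]. apply Rmult_le_compat_l.
    { apply Rmult_le_pos; [left; apply exp_pos|]. generalize (Cmod_ge_0 z). lra. }
    unfold pfrac_err.
    assert (F := Kq (q n) ltac:(lra)). fold (e n) in F.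
    assert (F' : fourier_err (e n) eta0 tau0 * B <= d / 2).
    { apply Rle_trans with (d / (2 * (B + 1)) * B); [apply Rmult_le_compat_r; auto|].
      replace (d / 2) with (d / (2 * (B + 1)) * (B + 1)) by (field; lra).
      apply Rmult_le_compat_l; [|lra]. left. apply Rdiv_lt_0_compat; lra. }
    assert (F2 : (2 + / eta0) * / INR (S n) <= d / 2).
    { apply Rle_trans with ((2 + / eta0) * (d / (2 * (2 + / eta0)))).
      - apply Rmult_le_compat_l; lra.
      - right. field. split; [lra|]. assert (2 * eta0 + 1 > 0) by lra. lra. }
    lra.
Qed.

(** * Removal of the poles and decay in strips *)

Definition regular (L : R -> Prop) (x : R) (z : C) : Prop :=
  z <> RtoC x /\ forall lam, L lam -> z <> RtoC lam.

Lemma Cdiff_Csum (F : R -> C -> C) (l : list R) (z : C) : (forall a, In a l -> Cdiff (F a) z) ->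
  Cdiff (fun w => Csum (fun a => F a w) l) z.
Proof.
  induction l as [|a l IH]; intros H; simpl; [apply Cdiff_const|].
  apply Cdiff_plus; [apply H; now left|apply IH; intros b Hb; apply H; now right].
Qed.

Lemma Cdiff_Cexp_sqr (e : R) (z : C) : Cdiff (fun z => Cexp (RtoC e * (z * z)))%C z.
Proof.
  apply (Cdiff_comp (fun z => RtoC e * (z * z))%C Cexp); [|apply Cdiff_Cexp].
  apply Cdiff_mult; [apply Cdiff_const|]. apply Cdiff_mult; apply Cdiff_id.
Qed.

(** The exponent [4 c] beats one [c] from the growth of [G] and one from [e^(e x^2)] with [e <= c],
    with [2 c] to spare. The factor [z - x] treats the pole at [x], where [G] may be nonzero. *)
Definition weight (G : C -> C) (c x : R) (z : C) : C :=
  (Cexp (RtoC (- (4 * c)) * (z * z)) * G z * (z - RtoC x))%C.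

(** The product [weight * pfrac] with all divisions carried out, where [q lam] stands for
    [G / (z - lam)]; it has values at the poles too. *)
Definition pfrac_entire (G : C -> C) (q : R -> C -> C) (g : R -> R -> C) (c x e : R) (l : list R)
    (z : C) : C :=
  (Cexp (RtoC (- (4 * c)) * (z * z)) * (Cexp (RtoC e * (z * z))
    * (RtoC (exp (- e * x ^ 2)) * G z
       - Csum (fun lam => RtoC (exp (- e * lam ^ 2)) * g lam x * (q lam z * (z - RtoC x))) l)))%C.

Lemma pfrac_entire_eq (G : C -> C) (q : R -> C -> C) (g : R -> R -> C) (c x e : R) (l : list R)
    (z : C) :
  z <> RtoC x -> (forall a, In a l -> z <> RtoC a /\ G z = ((z - RtoC a) * q a z)%C) ->
  pfrac_entire G q g c x e l z = (weight G c x z * pfrac g x e l z)%C.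
Proof.
  intros Hx Hl.
  assert (E : (weight G c x z * pfrac g x e l z = Cexp (RtoC (- (4 * c)) * (z * z)) * (Cexp (RtoC e * (z * z))
    * ((z - RtoC x) * G z * gauss_cauchy e z x
       - (z - RtoC x) * G z * Csum (fun lam => gauss_cauchy e z lam * g lam x) l)))%C)
    by (unfold weight, pfrac; ring).
  rewrite E. rewrite <- Csum_scal. unfold pfrac_entire.
  rewrite (Csum_ext _ (fun a => (z - RtoC x) * G z * (gauss_cauchy e z a * g a x))%C).
  - do 3 f_equal. unfold gauss_cauchy. field. now apply Csub_neq_0.
  - intros a Ha. destruct (Hl a Ha) as [N Eq]. rewrite Eq. unfold gauss_cauchy.
    field. now apply Csub_neq_0.
Qed.

Lemma pfrac_entire_diff (G : C -> C) (q : R -> C -> C) (g : R -> R -> C) (c x e : R) (l : list R)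
    (z : C) : Cdiff G z -> (forall a, In a l -> Cdiff (q a) z) ->
  Cdiff (pfrac_entire G q g c x e l) z.
Proof.
  intros HG Hq. unfold pfrac_entire.
  apply Cdiff_mult; [apply Cdiff_Cexp_sqr|]. apply Cdiff_mult; [apply Cdiff_Cexp_sqr|].
  apply Cdiff_minus; [apply Cdiff_mult; [apply Cdiff_const|auto]|].
  apply (Cdiff_Csum (fun lam z => RtoC (exp (- e * lam ^ 2)) * g lam x * (q lam z * (z - RtoC x)))%C).
  intros a Ha. apply Cdiff_mult; [apply Cdiff_const|]. apply Cdiff_mult; auto.
  apply Cdiff_minus; [apply Cdiff_id|apply Cdiff_const].
Qed.

Lemma weight_bound (G : C -> C) (c x Y : R) : 0 < c -> 0 < Y ->
  (forall eta : R, 0 < eta -> exists K : R, forall x y : R,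
        Rabs y <= eta -> Cmod (G (x, y)) <= K * exp (c * x ^ 2)) ->
  exists A, 0 < A /\ forall z, Rabs (Im z) <= Y ->
    Cmod (weight G c x z) * (exp (c * Re z ^ 2) * (1 + Cmod z)) <= A * exp (- (c * Re z ^ 2)).
Proof.
  intros Hc HY HG. destruct (HG Y HY) as [K HK].
  assert (HK0 : 0 <= K).
  { specialize (HK 0 0). rewrite Rabs_R0 in HK. specialize (HK ltac:(lra)).
    replace (c * 0 ^ 2) with 0 in HK by ring. rewrite exp_0, Rmult_1_r in HK.
    eapply Rle_trans; [apply Cmod_ge_0|apply HK]. }
  set (a := 1 + Y + Rabs x). assert (Ha := Rabs_pos x).
  (* Chosen for [(a + |X|)^2 <= 2 a^2 + 2 X^2 <= D (1 + c X^2) <= D e^(c X^2)]: one of the spare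
     exponents absorbs the polynomial factors. *)
  set (D := 2 * a ^ 2 + 2 / c).
  assert (Hci : 0 < 2 / c) by (apply Rdiv_lt_0_compat; lra).
  assert (HD : 0 < D) by (unfold D; generalize (pow2_ge_0 a); lra).
  set (A := exp (4 * c * Y ^ 2) * K * D).
  assert (HA : 0 <= A).
  { unfold A. apply Rmult_le_pos; [|lra]. apply Rmult_le_pos; [left; apply exp_pos|auto]. }
  exists (A + 1). split; [lra|]. intros z Hz.
  set (X := Re z). set (y := Im z) in *.
  apply Rle_trans with (A * exp (- (c * X ^ 2))).
  2:{ apply Rmult_le_compat_r; [left; apply exp_pos|lra]. }
  unfold weight. rewrite !Cmod_mult, Cmod_Cexp_sqr. fold X y.
  assert (W : exp (- (4 * c) * (X ^ 2 - y ^ 2)) <= exp (4 * c * Y ^ 2) * exp (- (4 * c * X ^ 2))).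
  { rewrite <- exp_plus.
    assert (y ^ 2 <= Y ^ 2).
    { rewrite <- (pow2_abs y). apply pow_incr. split; [apply Rabs_pos|auto]. }
    assert (- (4 * c) * (X ^ 2 - y ^ 2) <= 4 * c * Y ^ 2 + - (4 * c * X ^ 2)).
    { assert (4 * c * y ^ 2 <= 4 * c * Y ^ 2) by (apply Rmult_le_compat_l; lra). lra. }
    now apply exp_le_compat. }
  assert (Gz : Cmod (G z) <= K * exp (c * X ^ 2)).
  { replace z with (X, y) by (unfold X, y; destruct z; reflexivity). now apply HK. }
  assert (Cz : Cmod z <= Rabs X + Y).
  { eapply Rle_trans; [apply Cmod_le_abs|]. fold X y. lra. }
  assert (Czx : Cmod (z - RtoC x) <= Rabs X + Y + Rabs x).
  { eapply Rle_trans; [apply Cmod_triangle_sub|]. rewrite Cmod_R. lra. }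
  assert (HX := Rabs_pos X).
  assert (Pz : Cmod (z - RtoC x) * (1 + Cmod z) <= D * exp (c * X ^ 2)).
  { apply Rle_trans with ((a + Rabs X) * (a + Rabs X)).
    - apply Rmult_le_compat; try apply Cmod_ge_0; unfold a; try lra. generalize (Cmod_ge_0 z); lra.
    - assert (E1 := exp_ineq1_le (c * X ^ 2)).
      apply Rle_trans with (D * (1 + c * X ^ 2)); [|apply Rmult_le_compat_l; lra].
      assert (Sx : Rabs X * Rabs X = X ^ 2) by (rewrite <- (pow2_abs X); ring).
      replace (D * (1 + c * X ^ 2)) with (2 * a ^ 2 + 2 / c + 2 * a ^ 2 * (c * X ^ 2) + 2 * X ^ 2)
        by (unfold D; field; lra).
      assert (0 <= 2 * a ^ 2 * (c * X ^ 2)).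
      { apply Rmult_le_pos; [generalize (pow2_ge_0 a); lra|]. apply Rmult_le_pos; [lra|apply pow2_ge_0]. }
      assert (Q := pow2_ge_0 (a - Rabs X)).
      replace ((a - Rabs X) ^ 2) with (a ^ 2 - 2 * a * Rabs X + Rabs X * Rabs X) in Q by ring.
      replace ((a + Rabs X) * (a + Rabs X)) with (a ^ 2 + 2 * a * Rabs X + Rabs X * Rabs X) by ring.
      rewrite Sx in *. lra. }
  assert (Ex : A * exp (- (c * X ^ 2)) =
    (exp (4 * c * Y ^ 2) * exp (- (4 * c * X ^ 2))) * (K * exp (c * X ^ 2)) * exp (c * X ^ 2) * (D * exp (c * X ^ 2))).
  { unfold A.
    replace (exp (- (c * X ^ 2))) with (exp (- (4 * c * X ^ 2)) * exp (c * X ^ 2) * exp (c * X ^ 2) * exp (c * X ^ 2))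
      by (rewrite <- !exp_plus; f_equal; ring). ring. }
  rewrite Ex.
  replace (exp (- (4 * c) * (X ^ 2 - y ^ 2)) * Cmod (G z) * Cmod (z - RtoC x) * (exp (c * X ^ 2) * (1 + Cmod z)))
    with (exp (- (4 * c) * (X ^ 2 - y ^ 2)) * Cmod (G z) * exp (c * X ^ 2) * (Cmod (z - RtoC x) * (1 + Cmod z))) by ring.
  assert (P0 := Cmod_ge_0 (G z)). assert (P1 := exp_pos (- (4 * c) * (X ^ 2 - y ^ 2))).
  assert (P2 := exp_pos (c * X ^ 2)). assert (P3 := Cmod_ge_0 (z - RtoC x)). assert (P4 := Cmod_ge_0 z).
  apply Rmult_le_compat; auto.
  - apply Rmult_le_pos; [|lra]. apply Rmult_le_pos; lra.
  - apply Rmult_le_pos; lra.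
  - apply Rmult_le_compat_r; [lra|]. apply Rmult_le_compat; lra.
Qed.

(** At horizontal distance 1 or more from the finitely many poles, each fraction is at most 1. The
    constants depend on [e] and [l], which is harmless: they only decide how wide a rectangle has to
    be. *)
Lemma pfrac_growth (g : R -> R -> C) (x e c : R) (l : list R) : 0 < e <= c ->
  exists D T, 0 <= D /\ (forall a, In a l -> Rabs a < T) /\ Rabs x < T /\ forall z, T <= Rabs (Re z) ->
    Cmod (pfrac g x e l z) <= exp (c * Re z ^ 2) * D.
Proof.
  intros [He Hc].
  assert (HT : exists T, (forall a, In a (x :: l) -> Rabs a + 1 <= T)).
  { generalize (x :: l). intros k. induction k as [|a k [T HT]]; [exists 0; intros a []|].
    exists (Rmax T (Rabs a + 1)). intros b [<-|Hb]; [apply Rmax_r|].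
    eapply Rle_trans; [apply HT; auto|apply Rmax_l]. }
  destruct HT as [T HT].
  exists (1 + Rsum (fun a => Cmod (g a x)) l), T.
  assert (N : forall a, In a l -> 0 <= Cmod (g a x)) by (intros; apply Cmod_ge_0).
  assert (S0 := Rsum_nonneg _ l N).
  split; [lra|]. split.
  { intros a Ha. specialize (HT a (or_intror Ha)). lra. }
  split. { specialize (HT x (or_introl eq_refl)). lra. }
  intros z Hz.
  assert (GC : forall a, In a (x :: l) -> Cmod (gauss_cauchy e z a) <= 1).
  { intros a Ha. specialize (HT a Ha).
    assert (Za : 1 <= Cmod (z - RtoC a)).
    { eapply Rle_trans; [|apply re_le_Cmod].
      replace (Re (z - RtoC a)) with (Re z - a) by (unfold Re; simpl; ring).
      generalize (Rabs_triang_inv (Re z) a). lra. }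
    unfold gauss_cauchy. rewrite Cmod_div, Cmod_R by (apply Cmod_gt_0; lra).
    apply Rle_div_l; [lra|]. rewrite Rabs_right by (left; apply exp_pos).
    apply Rle_trans with 1; [|lra]. rewrite <- exp_0.
    assert (- e * a ^ 2 <= 0) by (generalize (pow2_ge_0 a); nra).
    now apply exp_le_compat. }
  unfold pfrac. rewrite Cmod_mult, Cmod_Cexp_sqr.
  apply Rmult_le_compat; [left; apply exp_pos|apply Cmod_ge_0| |].
  - assert (e * (Re z ^ 2 - Im z ^ 2) <= c * Re z ^ 2).
    { apply Rle_trans with (e * Re z ^ 2).
      - apply Rmult_le_compat_l; [lra|]. generalize (pow2_ge_0 (Im z)); lra.
      - apply Rmult_le_compat_r; [apply pow2_ge_0|lra]. }
    now apply exp_le_compat.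
  - eapply Rle_trans; [apply Cmod_triangle_sub|]. apply Rplus_le_compat; [apply GC; now left|].
    eapply Rle_trans; [apply Cmod_Csum_le|]. apply Rsum_le. intros a Ha. rewrite Cmod_mult.
    rewrite <- (Rmult_1_l (Cmod (g a x))) at 2. apply Rmult_le_compat_r; [apply Cmod_ge_0|].
    apply GC. now right.
Qed.

Lemma pfrac_entire_decay (G : C -> C) (q : R -> C -> C) (g : R -> R -> C) (c x e Y A m : R) (l : list R) :
  0 < c -> 0 < e <= c -> 0 < A -> 0 < m ->
  (forall z, Rabs (Im z) <= Y ->
    Cmod (weight G c x z) * (exp (c * Re z ^ 2) * (1 + Cmod z)) <= A * exp (- (c * Re z ^ 2))) ->
  (forall a, In a l -> forall z, G z = ((z - RtoC a) * q a z)%C) ->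
  exists T, forall z, Rabs (Im z) <= Y -> T <= Rabs (Re z) ->
    Cmod (pfrac_entire G q g c x e l z) <= m.
Proof.
  intros Hc He HA Hm HW Hq.
  destruct (pfrac_growth g x e c l He) as (D & T & HD & HTl & HTx & HT).
  (* The product is at most [A D e^(-c X^2) <= A D / (c |X|)] once [|X| >= 1], and this is at most
     [m] beyond [T']. *)
  set (T' := A * D / (c * m)).
  exists (Rmax T (Rmax 1 T')). intros z Hz HX.
  assert (X1 := Rle_trans _ _ _ (Rmax_l _ _) HX).
  assert (X2 := Rle_trans _ _ _ (Rmax_r _ _) HX).
  assert (X3 := Rle_trans _ _ _ (Rmax_l _ _) X2). assert (X4 := Rle_trans _ _ _ (Rmax_r _ _) X2).
  assert (Nz : forall a, Rabs a < T -> z <> RtoC a).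
  { intros a Ha ->. simpl in X1. lra. }
  rewrite pfrac_entire_eq; auto.
  rewrite Cmod_mult. specialize (HT z X1). specialize (HW z Hz).
  set (W := Cmod (weight G c x z)) in *. assert (W0 : 0 <= W) by apply Cmod_ge_0.
  set (E := exp (c * Re z ^ 2)) in *. assert (HE : 0 < E) by apply exp_pos.
  assert (Cz := Cmod_ge_0 z).
  assert (W1 : W * E <= A * exp (- (c * Re z ^ 2))).
  { eapply Rle_trans; [|apply HW]. apply Rmult_le_compat_l; auto. nra. }
  assert (Sx : Rabs (Re z) <= Re z ^ 2) by (rewrite <- (pow2_abs (Re z)); nra).
  assert (Ec : exp (- (c * Re z ^ 2)) <= / (c * Rabs (Re z))).
  { assert (c * Rabs (Re z) <= c * Re z ^ 2) by (apply Rmult_le_compat_l; lra).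
    assert (0 < c * Rabs (Re z)) by (apply Rmult_lt_0_compat; lra).
    eapply Rle_trans; [apply exp_neg_le; lra|]. apply Rinv_le_contravar; lra. }
  apply Rle_trans with (W * E * D).
  { rewrite Rmult_assoc. now apply Rmult_le_compat_l. }
  apply Rle_trans with (A * / (c * Rabs (Re z)) * D).
  { apply Rmult_le_compat_r; auto. eapply Rle_trans; [apply W1|]. apply Rmult_le_compat_l; lra. }
  replace (A * / (c * Rabs (Re z)) * D) with (A * D / c / Rabs (Re z)) by (field; split; lra).
  apply Rle_div_l; [lra|]. replace (A * D / c) with (m * T') by (unfold T'; field; split; lra).
  apply Rmult_le_compat_l; lra.
Qed.

(** * The limit e -> 0 *)

Lemma regular_off_real (L : R -> Prop) (x : R) (z : C) : Im z <> 0 -> regular L x z.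
Proof. intros H. split; [|intros lam _]; intros ->; apply H; reflexivity. Qed.

Definition E_defined (Ls : R -> Prop) (h : R -> R -> C) (eta0 x : R) : Prop :=
  forall s z, is_sign s -> eta0 <= s * Im z -> exists v, is_E Ls h s x z v.

Definition admissible (L : R -> Prop) (G : C -> C) (c : R) : Prop :=
  (forall z, Cdiff G z) /\ (exists z, G z <> RtoC 0) /\
  (forall lam, L lam -> G (RtoC lam) = RtoC 0) /\ 0 < c /\
  forall eta : R, 0 < eta -> exists K : R, forall x y : R,
        Rabs y <= eta -> Cmod (G (x, y)) <= K * exp (c * x ^ 2).

(** On the lines [|Im z| = Y] two truncations approximate the same value of [E_s], which cancels in
    their difference; thus no bound on [E_s] enters. The weighted difference is entire and small on
    these lines, hence in the whole strip. *)
Lemma strip_cauchy (L Ls : R -> Prop) (g h : R -> R -> C) (G : C -> C) (eta0 x c Y d : R)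
    (e : nat -> R) (l : nat -> list R) :
  0 < eta0 -> admissible L G c -> E_defined Ls h eta0 x -> pfrac_good L Ls g h eta0 x c e l ->
  eta0 <= Y -> 0 < d ->
  exists N, forall n m, (N <= n)%nat -> (N <= m)%nat -> forall z, regular L x z -> Rabs (Im z) <= Y ->
    Cmod (weight G c x z) * Cmod (pfrac g x (e n) (l n) z - pfrac g x (e m) (l m) z) <= d.
Proof.
  intros Heta (HG & HGn & HGL & Hc & HGb) HE (He & Hl & _ & HP) HY Hd.
  destruct (weight_bound G c x Y Hc ltac:(lra) HGb) as [A [HA HW]].
  (* The cofactors of [G] at the points of [L]; outside [L] the function [G] itself is only a dummy
     value. *)
  destruct (choice (fun a q => L a -> (forall z, G z = ((z - RtoC a) * q z)%C) /\ forall z, Cdiff q z))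
    as [q Hq].
  { intros a. destruct (classic (L a)) as [La|Na].
    - destruct (entire_divide G (RtoC a) HG (HGL a La)) as [q Hq]. now exists q.
    - exists G. tauto. }
  destruct (HP Y (d / (2 * A))) as [N HN]; [apply Rdiv_lt_0_compat; lra|].
  exists N. intros n m Hn Hm.
  set (P := fun n => pfrac g x (e n) (l n)).
  set (F := fun n => pfrac_entire G q g c x (e n) (l n)).
  assert (FE : forall n z, regular L x z -> F n z = (weight G c x z * P n z)%C).
  { intros k z [Z1 Z2]. apply pfrac_entire_eq; auto. intros a Ha.
    assert (La := proj2 (Hl k) a Ha). split; [now apply Z2|]. now apply Hq. }
  assert (S : forall z, Rabs (Im z) <= Y -> Cmod (F n z - F m z) <= d).
  { assert (Dec : forall k, exists T, forall z, Rabs (Im z) <= Y -> T <= Rabs (Re z) -> Cmod (F k z) <= d / 2).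
    { intros k. apply (pfrac_entire_decay G q g c x (e k) Y A (d / 2) (l k)); auto; try lra.
      intros a Ha. apply Hq. now apply (proj2 (Hl k)). }
    destruct (Dec n) as [T1 HT1]. destruct (Dec m) as [T2 HT2].
    apply (strip_max _ Y d (Rmax T1 T2)); [lra| | |].
    - intros z _. apply Cdiff_minus; apply pfrac_entire_diff; auto;
      intros a Ha; apply Hq; [now apply (proj2 (Hl n))|now apply (proj2 (Hl m))].
    - intros z Hz.
      assert (Iz : Im z <> 0) by (intros h0; rewrite h0, Rabs_R0 in Hz; lra).
      assert (Hs : exists s, is_sign s /\ s * Im z = Y).
      { unfold Rabs in Hz. destruct (Rcase_abs (Im z)).
        - exists (-1). split; [right; auto|lra].
        - exists 1. split; [left; auto|lra]. }
      destruct Hs as [s [Hs Es]].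
      destruct (HE s z Hs ltac:(lra)) as [v Hv].
      assert (B : forall k, (N <= k)%nat ->
        Cmod (RtoC s * P k z + v) <= exp (c * Re z ^ 2) * (1 + Cmod z) * (d / (2 * A))).
      { intros k Hk. eapply Rle_trans; [apply (HN k Hk s z v Hs ltac:(lra) Hv)|].
        apply Rmult_le_compat_r; [left; apply Rdiv_lt_0_compat; lra|].
        apply Rmult_le_compat_r; [generalize (Cmod_ge_0 z); lra|].
        assert (e k * Re z ^ 2 <= c * Re z ^ 2) by (apply Rmult_le_compat_r; [apply pow2_ge_0|apply He]).
        now apply exp_le_compat. }
      assert (R := regular_off_real L x z Iz).
      rewrite !FE by auto.
      assert (Q : Cmod (P n z - P m z) <= 2 * (exp (c * Re z ^ 2) * (1 + Cmod z) * (d / (2 * A)))).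
      { replace (Cmod (P n z - P m z)) with (Cmod ((RtoC s * P n z + v) - (RtoC s * P m z + v))).
        - eapply Rle_trans; [apply Cmod_triangle_sub|].
          assert (B1 := B n Hn). assert (B2 := B m Hm). lra.
        - replace ((RtoC s * P n z + v) - (RtoC s * P m z + v))%C with (RtoC s * (P n z - P m z))%C by ring.
          rewrite Cmod_mult, Cmod_R. destruct Hs as [-> | ->].
          + rewrite Rabs_right by lra. ring.
          + rewrite Rabs_left by lra. ring. }
      replace (weight G c x z * P n z - weight G c x z * P m z)%C
        with (weight G c x z * (P n z - P m z))%C by ring.
      rewrite Cmod_mult.
      assert (W0 := Cmod_ge_0 (weight G c x z)). specialize (HW z ltac:(lra)).
      eapply Rle_trans; [apply Rmult_le_compat_l; [auto|apply Q]|].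
      replace (Cmod (weight G c x z) * (2 * (exp (c * Re z ^ 2) * (1 + Cmod z) * (d / (2 * A)))))
        with (Cmod (weight G c x z) * (exp (c * Re z ^ 2) * (1 + Cmod z)) * (d / A)) by (field; lra).
      apply Rle_trans with (A * 1 * (d / A)); [|right; field; lra].
      apply Rmult_le_compat_r; [left; apply Rdiv_lt_0_compat; lra|].
      eapply Rle_trans; [apply HW|]. apply Rmult_le_compat_l; [lra|].
      rewrite <- exp_0. assert (- (c * Re z ^ 2) <= 0) by (generalize (pow2_ge_0 (Re z)); nra).
      now apply exp_le_compat.
    - intros z Hz HT. eapply Rle_trans; [apply Cmod_triangle_sub|].
      assert (X1 := HT1 z Hz (Rle_trans _ _ _ (Rmax_l _ _) HT)).
      assert (X2 := HT2 z Hz (Rle_trans _ _ _ (Rmax_r _ _) HT)). lra. }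
  intros z Rz Hz. specialize (S z Hz). rewrite !FE in S by auto.
  rewrite <- Cmod_mult. fold (P n z) (P m z).
  replace (weight G c x z * (P n z - P m z))%C
    with (weight G c x z * P n z - weight G c x z * P m z)%C by ring. exact S.
Qed.

(** The four sides are degenerate rectangles, on each of which [1 / f] is continuous and therefore
    bounded. *)
Lemma bdry_lower_bound (f : C -> C) (a b c d : R) : a <= b -> c <= d ->
  (forall z, rect_bdry a b c d z -> Ccont f z /\ f z <> RtoC 0) ->
  exists m, 0 < m /\ forall z, rect_bdry a b c d z -> m <= Cmod (f z).
Proof.
  intros Hab Hcd H.
  assert (S : forall a' b' c' d', a' <= b' -> c' <= d' ->
    (forall z, rect a' b' c' d' z -> rect_bdry a b c d z) ->
    exists B, 0 <= B /\ forall z, rect a' b' c' d' z -> Cmod (/ f z) <= B).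
  { intros a' b' c' d' H1 H2 Hi. apply rect_bounded; auto.
    intros z Hz. destruct (H z (Hi z Hz)). now apply Ccont_inv. }
  destruct (S a a c d) as [B1 [P1 K1]]; try lra.
  { intros z [[Z1 Z2] Z3]. split; [split|]; lra. }
  destruct (S b b c d) as [B2 [P2 K2]]; try lra.
  { intros z [[Z1 Z2] Z3]. split; [split|]; lra. }
  destruct (S a b c c) as [B3 [P3 K3]]; try lra.
  { intros z [[Z1 Z2] Z3]. split; [split|]; lra. }
  destruct (S a b d d) as [B4 [P4 K4]]; try lra.
  { intros z [[Z1 Z2] Z3]. split; [split|]; lra. }
  set (B := B1 + B2 + B3 + B4 + 1).
  exists (/ B). split; [apply Rinv_0_lt_compat; unfold B; lra|].
  intros z Hz. destruct (H z Hz) as [_ Hnz].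
  assert (K : Cmod (/ f z) <= B).
  { unfold B. destruct Hz as [[[Z1 Z2] [Z3 Z4]] [E|[E|[E|E]]]].
    - specialize (K1 z ltac:(split; lra)). lra.
    - specialize (K2 z ltac:(split; lra)). lra.
    - specialize (K3 z ltac:(split; lra)). lra.
    - specialize (K4 z ltac:(split; lra)). lra. }
  rewrite Cmod_inv in K by auto. apply Cmod_gt_0 in Hnz.
  rewrite <- (Rinv_inv (Cmod (f z))). apply Rinv_le_contravar; auto. now apply Rinv_0_lt_compat.
Qed.

Lemma weight_diff (G : C -> C) (c x : R) (z : C) : Cdiff G z -> Cdiff (weight G c x) z.
Proof.
  intros HG. unfold weight. apply Cdiff_mult; [apply Cdiff_mult; [apply Cdiff_Cexp_sqr|auto]|].
  apply Cdiff_minus; [apply Cdiff_id|apply Cdiff_const].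
Qed.

(** As [L] lies in the zero set of [G], the isolation of these zeros isolates the points of [L] as
    well; [x] is kept away by [r1]. *)
Lemma good_square (L : R -> Prop) (G : C -> C) (c x : R) (p : C) : admissible L G c ->
  exists r, 0 < r /\ forall z, square p r z -> z <> p -> G z <> RtoC 0 /\ regular L x z.
Proof.
  intros (HG & HGn & HGL & _).
  destruct (entire_zero_isolated G p HG HGn) as [r0 [Hr0 K]].
  set (r1 := if Ceq_dec (RtoC x) p then 1 else Cmod (RtoC x - p)).
  assert (Hr1 : 0 < r1).
  { unfold r1. destruct (Ceq_dec (RtoC x) p); [lra|now apply Cmod_sub_gt_0]. }
  set (r := Rmin r0 r1 / 4).
  assert (Hm : 0 < Rmin r0 r1) by now apply Rmin_pos.
  assert (M1 := Rmin_l r0 r1). assert (M2 := Rmin_r r0 r1).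
  exists r. split; [unfold r; lra|]. intros z Hz Hp.
  assert (B := square_le p r z Hz). assert (P := Cmod_sub_gt_0 z p Hp).
  assert (Gz : G z <> RtoC 0) by (apply K; unfold r in B; lra).
  split; auto. split.
  - intros E. assert (r1 <= Cmod (z - p)); [|unfold r in B; lra].
    unfold r1. destruct (Ceq_dec (RtoC x) p) as [E'|_]; [congruence|]. rewrite E. lra.
  - intros lam Hlam E. apply Gz. rewrite E. auto.
Qed.

Lemma square_cauchy (L Ls : R -> Prop) (g h : R -> R -> C) (G : C -> C) (eta0 x c r : R) (p : C)
    (e : nat -> R) (l : nat -> list R) :
  0 < eta0 -> admissible L G c -> E_defined Ls h eta0 x -> pfrac_good L Ls g h eta0 x c e l ->
  0 < r -> (forall z, square p r z -> z <> p -> G z <> RtoC 0 /\ regular L x z) ->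
  unif_cauchy (rect_bdry (Re p - r) (Re p + r) (Im p - r) (Im p + r))
    (fun n => pfrac g x (e n) (l n)).
Proof.
  intros Heta HG HE HP Hr Hsq d Hd.
  assert (NB : forall z, rect_bdry (Re p - r) (Re p + r) (Im p - r) (Im p + r) z -> z <> p).
  { intros z Hz ->. apply square_bdry_ge in Hz. rewrite Cmod_sub_diag in Hz. lra. }
  destruct (bdry_lower_bound (weight G c x) (Re p - r) (Re p + r) (Im p - r) (Im p + r)) as [m [Hm Km]];
    try lra.
  { intros z Hz. split.
    - apply Cdiff_cont, weight_diff, HG.
    - destruct (Hsq z (proj1 Hz) (NB z Hz)) as [Gz [Zx _]].
      unfold weight. apply Cmult_neq_0; [apply Cmult_neq_0; [apply Cexp_neq_0|auto]|now apply Csub_neq_0]. }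
  (* The strip is high enough to contain the square, and the tolerance [m d] anticipates the
     division by the lower bound [m] of the weight. *)
  destruct (strip_cauchy L Ls g h G eta0 x c (Rmax eta0 (Rabs (Im p) + r)) (m * d) e l Heta HG HE HP)
    as [N HN]; [apply Rmax_l|now apply Rmult_lt_0_compat|].
  exists N. intros n k Hn Hk z Hz.
  destruct (Hsq z (proj1 Hz) (NB z Hz)) as [_ Rz].
  assert (Iz : Rabs (Im z) <= Rmax eta0 (Rabs (Im p) + r)).
  { eapply Rle_trans; [|apply Rmax_r]. destruct Hz as [[_ [Z1 Z2]] _].
    replace (Im z) with (Im p + (Im z - Im p)) by ring.
    eapply Rle_trans; [apply Rabs_triang|]. apply Rplus_le_compat_l. apply Rabs_le; lra. }
  specialize (HN n k Hn Hk z Rz Iz). specialize (Km z Hz).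
  apply (Rmult_le_reg_l m); auto. eapply Rle_trans; [|apply HN].
  apply Rmult_le_compat_r; [apply Cmod_ge_0|auto].
Qed.

(** * Local behaviour of the limit and residues *)

Lemma gauss_cauchy_diff (e a : R) (z : C) : z <> RtoC a -> Cdiff (fun z => gauss_cauchy e z a) z.
Proof.
  intros H. unfold gauss_cauchy. apply Cdiff_div; [apply Cdiff_const| |now apply Csub_neq_0].
  apply Cdiff_minus; [apply Cdiff_id|apply Cdiff_const].
Qed.

Lemma pfrac_diff (L : R -> Prop) (g : R -> R -> C) (x e : R) (l : list R) (z : C) :
  finite_part L l -> regular L x z -> Cdiff (pfrac g x e l) z.
Proof.
  intros [_ Hl] [Zx Zl]. unfold pfrac. apply Cdiff_mult; [apply Cdiff_Cexp_sqr|].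
  apply Cdiff_minus; [now apply gauss_cauchy_diff|].
  apply (Cdiff_Csum (fun lam z => gauss_cauchy e z lam * g lam x)%C).
  intros a Ha. apply Cdiff_mult; [apply gauss_cauchy_diff; auto|apply Cdiff_const].
Qed.

(** For [b = a] the quotient is cancelled by definition, since division at [z = a] would give a
    wrong value. *)
Definition pole_term (e a : R) (z : C) (b : R) : C :=
  if Req_EM_T b a then RtoC (exp (- e * b ^ 2)) else ((z - RtoC a) * gauss_cauchy e z b)%C.

(* (z - a) pfrac(z), with its removable singularity at a removed. *)
Definition pole_num (g : R -> R -> C) (x e : R) (l : list R) (a : R) (z : C) : C :=
  (Cexp (RtoC e * (z * z))
   * (pole_term e a z x - Csum (fun lam => pole_term e a z lam * g lam x) l))%C.

Lemma pole_num_eq (g : R -> R -> C) (x e : R) (l : list R) (a : R) (z : C) : z <> RtoC a ->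
  pole_num g x e l a z = ((z - RtoC a) * pfrac g x e l z)%C.
Proof.
  intros H.
  assert (T : forall b, pole_term e a z b = ((z - RtoC a) * gauss_cauchy e z b)%C).
  { intros b. unfold pole_term. destruct (Req_EM_T b a) as [->|_]; auto.
    unfold gauss_cauchy. field. now apply Csub_neq_0. }
  unfold pole_num, pfrac. rewrite T.
  rewrite (Csum_ext _ (fun lam => (z - RtoC a) * (gauss_cauchy e z lam * g lam x))%C).
  - rewrite Csum_scal. ring.
  - intros b _. rewrite T. ring.
Qed.

Lemma pole_num_diff (L : R -> Prop) (g : R -> R -> C) (x e : R) (l : list R) (a : R) (z : C) :
  finite_part L l -> z = RtoC a \/ regular L x z -> Cdiff (pole_num g x e l a) z.
Proof.
  intros [_ Hl] Hz.
  assert (T : forall b, b = x \/ In b l -> Cdiff (fun z => pole_term e a z b) z).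
  { intros b Hb. unfold pole_term. destruct (Req_EM_T b a) as [->|N]; [apply Cdiff_const|].
    apply Cdiff_mult; [apply Cdiff_minus; [apply Cdiff_id|apply Cdiff_const]|].
    apply gauss_cauchy_diff. destruct Hz as [->|[Z1 Z2]].
    - intros E. apply N. now apply RtoC_inj.
    - destruct Hb as [->|Hb]; auto. }
  unfold pole_num. apply Cdiff_mult; [apply Cdiff_Cexp_sqr|].
  apply Cdiff_minus; [apply T; auto|].
  apply (Cdiff_Csum (fun lam z => pole_term e a z lam * g lam x)%C).
  intros b Hb. apply Cdiff_mult; [apply T; auto|apply Cdiff_const].
Qed.

(** The outer factor [e^(e a^2)] cancels the Gaussian [e^(-e a^2)] of the only terms that survive at
    [a], so [e] disappears from the residue. If [a = x] is in the list, both contributions occur. *)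
Lemma pole_num_at (g : R -> R -> C) (x e : R) (l : list R) (a : R) : NoDup l ->
  pole_num g x e l a (RtoC a) =
  ((if Req_EM_T x a then RtoC 1 else RtoC 0) - (if inb l a then g a x else RtoC 0))%C.
Proof.
  intros Nd.
  set (E := RtoC (exp (- e * a ^ 2))).
  assert (EE : (Cexp (RtoC e * (RtoC a * RtoC a)) * E)%C = RtoC 1).
  { unfold E. rewrite <- !RtoC_mult. unfold Cexp, Cmult, RtoC; simpl.
    rewrite cos_0, sin_0. f_equal; [|ring].
    replace (exp (e * (a * a)) * 1 * exp (- e * (a * (a * 1))) - exp (e * (a * a)) * 0 * 0)
      with (exp (e * (a * a)) * exp (- e * (a * (a * 1)))) by ring.
    rewrite <- exp_plus.
    replace (e * (a * a) + - e * (a * (a * 1))) with 0 by ring. apply exp_0. }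
  assert (T : forall b, pole_term e a (RtoC a) b = (if Req_EM_T b a then E else RtoC 0)).
  { intros b. unfold pole_term. destruct (Req_EM_T b a) as [->|_]; auto. ring. }
  assert (S : Csum (fun lam => pole_term e a (RtoC a) lam * g lam x)%C l
    = (E * (if inb l a then g a x else RtoC 0))%C).
  { clear EE. induction l as [|b l IH]; [simpl; unfold inb; simpl; ring|].
    inversion_clear Nd. simpl. rewrite IH by auto. rewrite T. clear IH.
    unfold inb. destruct (Req_EM_T b a) as [->|Nb].
    - destruct (in_dec Req_EM_T a l) as [Hi|_]; [tauto|].
      destruct (in_dec Req_EM_T a (a :: l)) as [_|Hn]; [ring|]. exfalso; apply Hn; now left.
    - destruct (in_dec Req_EM_T a l) as [Hi|Hn]; destruct (in_dec Req_EM_T a (b :: l)) as [Hi'|Hn'];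
        try ring.
      + exfalso. apply Hn'. now right.
      + destruct Hi' as [h|h]; congruence. }
  unfold pole_num. rewrite S, T.
  replace (if Req_EM_T x a then E else RtoC 0)%C
    with (E * (if Req_EM_T x a then RtoC 1 else RtoC 0))%C by (destruct (Req_EM_T x a); ring).
  set (u := if Req_EM_T x a then RtoC 1 else RtoC 0). set (v := if inb l a then g a x else RtoC 0).
  replace (Cexp (RtoC e * (RtoC a * RtoC a)) * (E * u - E * v))%C
    with ((Cexp (RtoC e * (RtoC a * RtoC a)) * E) * (u - v))%C by ring.
  rewrite EE. ring.
Qed.

(** One limit function is fixed for all points at once, so that the arguments near different points
    describe the same [B]; where no limit exists its value is arbitrary. *)
Definition pfrac_limit (g : R -> R -> C) (x : R) (e : nat -> R) (l : nat -> list R) (B : C -> C) : Prop :=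
  forall z, (exists b, Clim (fun n => pfrac g x (e n) (l n) z) b) ->
    Clim (fun n => pfrac g x (e n) (l n) z) (B z).

Lemma limit_near_regular (L Ls : R -> Prop) (g h : R -> R -> C) (G : C -> C) (eta0 x c : R) (p : C)
    (e : nat -> R) (l : nat -> list R) (B : C -> C) :
  0 < eta0 -> admissible L G c -> E_defined Ls h eta0 x -> pfrac_good L Ls g h eta0 x c e l ->
  pfrac_limit g x e l B -> regular L x p ->
  exists r, 0 < r /\ forall z, Cdisc p r z ->
    Clim (fun n => pfrac g x (e n) (l n) z) (B z) /\ Cdiff B z.
Proof.
  intros Heta HG HE HP HB Hp.
  destruct (good_square L G c x p HG) as [r [Hr Hsq]].
  assert (U := square_cauchy L Ls g h G eta0 x c r p e l Heta HG HE HP Hr Hsq).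
  assert (D : forall n z, square p r z -> Cdiff (pfrac g x (e n) (l n)) z).
  { intros n z Hz. destruct HP as (_ & Hl & _). apply (pfrac_diff L); auto.
    destruct (Ceq_dec z p) as [->|Nz]; auto. now apply Hsq. }
  assert (V := unif_cauchy_rect _ (Re p - r) (Re p + r) (Im p - r) (Im p + r) ltac:(lra) ltac:(lra) D U).
  assert (LB : forall z, square p r z -> Clim (fun n => pfrac g x (e n) (l n) z) (B z)).
  { intros z Hz. apply HB. apply (unif_cauchy_lim _ _ z V Hz). }
  destruct (rect_interior_disc _ _ _ _ _ (square_int p r Hr)) as [r' [Hr' [K _]]].
  exists r'. split; auto. intros z Hz. specialize (K z Hz). split.
  - apply LB. destruct K; split; lra.
  - apply (weierstrass_diff _ B _ _ _ _ z D U LB K).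
Qed.

(** The functions [(z - a) pfrac] are holomorphic at [a] too and converge near it to a holomorphic
    [F]. As their value at [a] is eventually [rho], dividing [F - rho] by [z - a] yields the regular
    part. *)
Lemma limit_near_pole (L Ls : R -> Prop) (g h : R -> R -> C) (G : C -> C) (eta0 x c a : R) (rho : C)
    (e : nat -> R) (l : nat -> list R) (B : C -> C) :
  0 < eta0 -> admissible L G c -> E_defined Ls h eta0 x -> pfrac_good L Ls g h eta0 x c e l ->
  pfrac_limit g x e l B ->
  (exists N, forall n, (N <= n)%nat -> pole_num g x (e n) (l n) a (RtoC a) = rho) ->
  simple_pole B (RtoC a) rho.
Proof.
  intros Heta HG HE HP HB [N0 HN0]. set (p := RtoC a).
  destruct (good_square L G c x p HG) as [r [Hr Hsq]].
  assert (U := square_cauchy L Ls g h G eta0 x c r p e l Heta HG HE HP Hr Hsq).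
  set (f := fun n => pole_num g x (e n) (l n) a).
  assert (D : forall n z, square p r z -> Cdiff (f n) z).
  { intros n z Hz. destruct HP as (_ & Hl & _). apply (pole_num_diff L); auto.
    destruct (Ceq_dec z p) as [->|Nz]; auto. right. now apply Hsq. }
  assert (NB : forall z, rect_bdry (Re p - r) (Re p + r) (Im p - r) (Im p + r) z -> z <> p).
  { intros z Hz ->. apply square_bdry_ge in Hz. rewrite Cmod_sub_diag in Hz. lra. }
  assert (U' : unif_cauchy (rect_bdry (Re p - r) (Re p + r) (Im p - r) (Im p + r)) f).
  { intros d Hd. destruct (U (d / (2 * r))) as [N HN]; [apply Rdiv_lt_0_compat; lra|].
    exists N. intros n m Hn Hm z Hz. unfold f. rewrite !pole_num_eq by (apply (NB z Hz)).
    specialize (HN n m Hn Hm z Hz).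
    match goal with |- Cmod (?A * ?X - _ * ?Y) <= _ =>
      replace (A * X - A * Y)%C with (A * (X - Y))%C by ring end.
    rewrite Cmod_mult. replace d with (2 * r * (d / (2 * r))) by (field; lra).
    apply Rmult_le_compat; try apply Cmod_ge_0; auto. apply (square_le p r z (proj1 Hz)). }
  assert (V := unif_cauchy_rect f (Re p - r) (Re p + r) (Im p - r) (Im p + r) ltac:(lra) ltac:(lra) D U').
  destruct (choice (fun z b => square p r z -> Clim (fun n => f n z) b)) as [F HF].
  { intros z. destruct (classic (square p r z)) as [S|S].
    - destruct (unif_cauchy_lim _ f z V S) as [b Hb]. now exists b.
    - exists (RtoC 0). tauto. }
  assert (Fp : F p = rho).
  { apply (Clim_unique (fun n => f n p)).
    - apply HF. split; lra.
    - intros d Hd. exists N0. intros n Hn. unfold f, p. rewrite HN0 by auto.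
      rewrite Cmod_sub_diag. auto. }
  (* The square is halved because [weierstrass_diff] reaches interior points only. *)
  destruct (Cdiff_divide (fun z => F z - rho)%C p (r / 2)) as [phi [Ephi Dphi]].
  - lra.
  - rewrite Fp. ring.
  - intros z Hz. apply Cdiff_minus; [|apply Cdiff_const].
    apply (weierstrass_diff f F _ _ _ _ z D U' HF). destruct Hz; split; lra.
  - exists phi, (r / 2). split; [lra|]. split.
    + intros z Hz. apply Cdiff_iff, Dphi, square_mem. unfold Cdisc in Hz. lra.
    + intros z Hz Nz.
      assert (Sz : square p r z) by (apply square_mem; unfold Cdisc in Hz; lra).
      assert (Nz' := Csub_neq_0 _ _ Nz).
      assert (LP : Clim (fun n => pfrac g x (e n) (l n) z) (/ (z - p) * F z)%C).
      { apply (Clim_ext (fun n => / (z - p) * f n z)%C).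
        - intros n. unfold f. rewrite pole_num_eq by auto. fold p. field. auto.
        - apply Clim_scal. auto. }
      assert (BE : B z = (/ (z - p) * F z)%C).
      { apply (Clim_unique _ _ _ (HB z ltac:(now eexists; apply LP)) LP). }
      rewrite BE. replace (F z) with (rho + (z - p) * phi z)%C by (rewrite <- Ephi; ring).
      fold p. field. auto.
Qed.

(** A point of [L] ends up in the lists or has coefficient zero, and both give the same residue. *)
Lemma eventually_residue (L Ls : R -> Prop) (g h : R -> R -> C) (eta0 x c a : R)
    (e : nat -> R) (l : nat -> list R) : pfrac_good L Ls g h eta0 x c e l ->
  (L a -> exists N, forall n, (N <= n)%nat -> pole_num g x (e n) (l n) a (RtoC a) =
    ((if Req_EM_T x a then RtoC 1 else RtoC 0) - g a x)%C) /\
  (~ L a -> exists N, forall n, (N <= n)%nat -> pole_num g x (e n) (l n) a (RtoC a) =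
    (if Req_EM_T x a then RtoC 1 else RtoC 0)).
Proof.
  intros (_ & Hl & HI & _). split; intros La.
  - destruct (HI a La) as [N HN]. exists N. intros n Hn.
    rewrite pole_num_at by apply (proj1 (Hl n)). f_equal. f_equal.
    destruct (inb (l n) a) eqn:E; auto. destruct (HN n Hn) as [Hi|Z]; auto.
    apply inb_true in Hi. congruence.
  - exists O. intros n _. rewrite pole_num_at by apply (proj1 (Hl n)).
    destruct (inb (l n) a) eqn:E; [|ring]. exfalso. apply La. apply (proj2 (Hl n)).
    now apply inb_true.
Qed.

Lemma simple_pole_scal (k : C) (M : C -> C) (p rho : C) : simple_pole M p rho ->
  simple_pole (fun z => k * M z)%C p (k * rho)%C.
Proof.
  intros (phi & r & Hr & Hphi & E). exists (fun z => k * phi z)%C, r. split; auto. split.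
  - intros z Hz. apply Cdiff_iff, Cdiff_mult; [apply Cdiff_const|]. apply Cdiff_iff, Hphi, Hz.
  - intros z Hz Nz. rewrite E by auto. unfold Cdiv. ring.
Qed.

Lemma simple_pole_meromorphic_at (M : C -> C) (p rho : C) : simple_pole M p rho ->
  exists (n : nat) (phi : C -> C) (r : R),
    0 < r /\ holomorphic_on (Cdisc p r) phi /\
    forall z : C, Cdisc p r z -> z <> p -> M z = Cdiv (phi z) (Cpow (Cminus z p) n).
Proof.
  intros (phi & r & Hr & Hphi & E). exists 1%nat, (fun z => rho + (z - p) * phi z)%C, r.
  split; auto. split.
  - intros z Hz. apply Cdiff_iff, Cdiff_plus; [apply Cdiff_const|].
    apply Cdiff_mult; [apply Cdiff_minus; [apply Cdiff_id|apply Cdiff_const]|].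
    apply Cdiff_iff, Hphi, Hz.
  - intros z Hz Nz. rewrite E by auto. simpl. field. now apply Csub_neq_0.
Qed.

Lemma limit_continuation (L Ls : R -> Prop) (g h : R -> R -> C) (G : C -> C) (eta0 x c s : R)
    (e : nat -> R) (l : nat -> list R) (B : C -> C) :
  is_sign s -> 0 < eta0 -> admissible L G c -> E_defined Ls h eta0 x ->
  pfrac_good L Ls g h eta0 x c e l -> pfrac_limit g x e l B ->
  E_continuation L Ls g h eta0 s x (fun z => RtoC (- s) * B z)%C.
Proof.
  intros Hs Heta HG HE HP HB.
  assert (Reg := fun p => limit_near_regular L Ls g h G eta0 x c p e l B Heta HG HE HP HB).
  assert (Pole := fun a rho => limit_near_pole L Ls g h G eta0 x c a rho e l B Heta HG HE HP HB).
  assert (Res := fun a => eventually_residue L Ls g h eta0 x c a e l HP).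
  assert (PL : forall a, L a ->
    simple_pole B (RtoC a) ((if Req_EM_T x a then RtoC 1 else RtoC 0) - g a x)%C).
  { intros a La. apply Pole. now apply Res. }
  assert (PX : ~ L x -> simple_pole B (RtoC x) (RtoC 1)).
  { intros Nx. apply Pole. destruct (proj2 (Res x) Nx) as [N HN]. exists N.
    intros n Hn. rewrite HN by auto. destruct (Req_EM_T x x); congruence. }
  split; [|split; [|split; [|split; [|split]]]].
  - intros z Hz.
    assert (Iz : Im z <> 0) by (intros h0; rewrite h0 in Hz; lra).
    destruct (Reg z (regular_off_real L x z Iz)) as [r [Hr K]].
    destruct (K z) as [LB _]; [unfold Cdisc; rewrite Cmod_sub_diag; auto|].
    destruct (HE s z Hs Hz) as [v Hv].
    replace (RtoC (- s) * B z)%C with v; auto.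
    (* On the side [s], the truncations times [s] tend to [- E_s], which identifies [E_s] with
       [- s B] there. *)
    assert (Ls1 : Clim (fun n => RtoC s * pfrac g x (e n) (l n) z)%C (- v)%C).
    { intros d Hd. destruct HP as (He & _ & _ & HP).
      set (M := exp (c * Re z ^ 2) * (1 + Cmod z)).
      assert (HM : 0 < M).
      { apply Rmult_lt_0_compat; [apply exp_pos|generalize (Cmod_ge_0 z); lra]. }
      destruct (HP (s * Im z) (d / (2 * M))) as [N HN]; [apply Rdiv_lt_0_compat; lra|].
      exists N. intros n Hn. specialize (HN n Hn s z v Hs ltac:(lra) Hv).
      replace (RtoC s * pfrac g x (e n) (l n) z - - v)%C
        with (RtoC s * pfrac g x (e n) (l n) z + v)%C by ring.
      eapply Rle_lt_trans; [apply HN|]. apply Rle_lt_trans with (M * (d / (2 * M))).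
      - apply Rmult_le_compat_r; [left; apply Rdiv_lt_0_compat; lra|].
        apply Rmult_le_compat_r; [generalize (Cmod_ge_0 z); lra|].
        assert (e n * Re z ^ 2 <= c * Re z ^ 2) by (apply Rmult_le_compat_r; [apply pow2_ge_0|apply He]).
        now apply exp_le_compat.
      - replace (M * (d / (2 * M))) with (d / 2) by (field; lra). lra. }
    assert (X := Clim_unique _ _ _ Ls1 (Clim_scal (RtoC s) _ _ LB)).
    replace v with (- (- v))%C by ring. rewrite X, RtoC_opp. ring.
  - assert (MB : forall p, exists (n : nat) (phi : C -> C) (r : R),
      0 < r /\ holomorphic_on (Cdisc p r) phi /\
      forall z : C, Cdisc p r z -> z <> p ->
        (RtoC (- s) * B z)%C = Cdiv (phi z) (Cpow (Cminus z p) n)); [|exact MB].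
    intros p. destruct (classic (regular L x p)) as [Rp|Np].
    + destruct (Reg p Rp) as [r [Hr K]]. exists O, (fun z => RtoC (- s) * B z)%C, r.
      split; auto. split.
      * intros z Hz. apply Cdiff_iff, Cdiff_mult; [apply Cdiff_const|]. now apply K.
      * intros z _ _. simpl. field.
    (* A point that is not regular is either in [L], or it is [x] with [x] outside [L]; the two
       cases use different residues. *)
    + assert (Q : exists a, p = RtoC a /\ (L a \/ (~ L a /\ a = x))).
      { apply Classical_Prop.NNPP. intros HN. apply Np. split.
        - intros E. apply HN. exists x. destruct (classic (L x)); auto.
        - intros lam Hlam E. apply HN. exists lam. auto. }
      destruct Q as [a [-> [La|[Na ->]]]].
      * apply (simple_pole_meromorphic_at (fun z => RtoC (- s) * B z)%C _ _
          (simple_pole_scal (RtoC (- s)) _ _ _ (PL a La))).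
      * apply (simple_pole_meromorphic_at (fun z => RtoC (- s) * B z)%C _ _
          (simple_pole_scal (RtoC (- s)) _ _ _ (PX Na))).
  - intros z Hz. destruct (Reg z Hz) as [r [Hr K]]. apply Cdiff_iff, Cdiff_mult; [apply Cdiff_const|].
    apply K. unfold Cdisc. rewrite Cmod_sub_diag. auto.
  - intros Nx. assert (X := simple_pole_scal (RtoC (- s)) _ _ _ (PX Nx)).
    rewrite Cmult_1_r in X. exact X.
  - intros a La Nax. assert (X := simple_pole_scal (RtoC (- s)) _ _ _ (PL a La)).
    destruct (Req_EM_T x a); [congruence|].
    replace (RtoC s * g a x)%C with (RtoC (- s) * (RtoC 0 - g a x))%C by (rewrite RtoC_opp; ring). exact X.
  - intros Lx. assert (X := simple_pole_scal (RtoC (- s)) _ _ _ (PL x Lx)).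
    destruct (Req_EM_T x x); [|congruence].
    replace (RtoC (- s) + RtoC s * g x x)%C with (RtoC (- s) * (RtoC 1 - g x x))%C by (rewrite RtoC_opp; ring).
    exact X.
Qed.

Theorem theorem2
  (L : R -> Prop)
  (HG : exists (G : C -> C) (c : R),
      entire G /\ (exists z : C, G z <> RtoC 0) /\
      (forall lam : R, L lam -> G (RtoC lam) = RtoC 0) /\
      0 < c /\
      forall eta : R, 0 < eta -> exists K : R, forall x y : R,
        Rabs y <= eta -> Cmod (G (x, y)) <= K * exp (c * x ^ 2))
  (Ls : R -> Prop) (HLs : locally_finite Ls)
  (g h : R -> R -> C)
  (eta0 : R) (Heta0 : 0 < eta0)
  (Ha : forall (x : R) (z : C),
      (eta0 <= Im z -> abs_summable (E_index Ls 1) (E_term h x z)) /\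
      (eta0 <= - Im z -> abs_summable (E_index Ls (-1)) (E_term h x z)))
  (Hb : forall eps x : R, 0 < eps ->
      forall delta : R, 0 < delta -> exists T : R, forall lam : R,
        L lam -> T < Rabs lam -> Cmod (g lam x) * exp (- eps * lam ^ 2) < delta)
  (Hc : forall (eps : R) (z : C), 0 < eps -> eta0 <= Rabs (Im z) ->
      forall x : R, exists S1 S2 : C,
        is_usum L (fun lam => Cmult (gauss_cauchy eps z lam) (g lam x)) S1 /\
        is_usum Ls (fun t => Cmult (Fourier (gauss_cauchy eps z) t) (h t x)) S2 /\
        gauss_cauchy eps z x = Cplus S1 S2) :
  forall x : R, exists Ep Em : C -> C,
    E_continuation L Ls g h eta0 1 x Ep /\
    E_continuation L Ls g h eta0 (-1) x Em /\
    (forall z : C, z <> RtoC x -> (forall lam : R, L lam -> z <> RtoC lam) ->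
       Ep z = Copp (Em z)).
Proof.
  intros x. destruct HG as (G & c & HGe & HGn & HGL & Hc0 & HGb).
  assert (Adm : admissible L G c).
  { repeat split; auto. intros z. apply Cdiff_iff. now apply HGe. }
  assert (HE : E_defined Ls h eta0 x).
  { intros s z [-> | ->] Hz; destruct (Ha x z) as [H1 H2].
    - destruct (abs_summable_usum _ _ (H1 ltac:(lra))) as [S HS].
      exists (RtoC (2 * PI) * Ci * S)%C, S. auto.
    - destruct (abs_summable_usum _ _ (H2 ltac:(lra))) as [S HS].
      exists (RtoC (2 * PI) * Ci * S)%C, S. auto. }
  destruct (pfrac_good_exists L Ls g h eta0 x c Heta0 Hc0 HLs) as (e & l & HP).
  - intros s [-> | ->]; apply Ha; simpl; lra.
  - intros eps z H1 H2. apply Hc; auto.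
  - destruct (choice (fun z b => (exists b', Clim (fun n => pfrac g x (e n) (l n) z) b') ->
      Clim (fun n => pfrac g x (e n) (l n) z) b)) as [B HB].
    { intros z. destruct (classic (exists b', Clim (fun n => pfrac g x (e n) (l n) z) b')) as [[b Hb']|N].
      - now exists b.
      - exists (RtoC 0). tauto. }
    (* One function serves both sides, as [E_+ = - B] and [E_- = B]; the functional equation is then
       immediate. *)
    exists (fun z => RtoC (- (1)) * B z)%C, (fun z => RtoC (- (-1)) * B z)%C.
    split; [|split].
    + apply (limit_continuation L Ls g h G eta0 x c 1 e l B); auto. now left.
    + apply (limit_continuation L Ls g h G eta0 x c (-1) e l B); auto. now right.
    + intros z _ _. replace (- -1) with 1 by ring. rewrite RtoC_opp. ring.
Qed.
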